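(* Let $A_i=\begin{pmatrix}a_i&b_i\\c_i&d_i\end{pmatrix}\in\mathbb{R}^{2\times2}$ with $\det A_i=1$ and $b_i>0$ ($i=1,2$). Let $f=f_0+\mathbf{i}f_1+\mathbf{j}f_2+\mathbf{k}f_3\in L^1(\mathbb{R}^2,\mathbb{H})$ ($f_n$ real-valued), $(x_0,y_0)\in\mathbb{R}^2$, and suppose $f$ is a quaternion bounded variation function (QBVF) in a cross-neighborhood of $(x_0,y_0)$. Put $f_a=f_0+\mathbf{i}f_1$, $f_b=f_2+\mathbf{i}f_3$, $f_d=f_0+\mathbf{j}f_2$, $f_e=f_1+\mathbf{j}f_3$, so that $f=f_a+f_b\mathbf{j}=f_d+\mathbf{i}f_e$. Below, $f(x_0,y_0)$ is understood as $$f(x_0,y_0)=\frac{f(x_0+0,y_0+0)+f(x_0+0,y_0-0)+f(x_0-0,y_0+0)+f(x_0-0,y_0-0)}{4}.$$ (Right-sided case.) If $e^{\mathbf{i}\frac{a_1}{2b_1}s^2}f_a(s,t)e^{\mathbf{j}\frac{a_2}{2b_2}t^2}$ and $e^{-\mathbf{i}\frac{a_1}{2b_1}s^2}f_b(s,t)e^{\mathbf{j}\frac{a_2}{2b_2}t^2}$ belong to $\mathbf{LC}$ in this cross-neighborhood, then $$f(x_0,y_0)=\lim_{N,M\to\infty}\int_{-N}^{N}\int_{-M}^{M}K_{A_1^{-1}}^{\mathbf{i}}(u,x_0)\mathcal{L}_T^{\mathbf{i},\mathbf{j}}(f_a)(u,v)K_{A_2^{-1}}^{\mathbf{j}}(v,y_0)\,du\,dv+\lim_{N,M\to\infty}\int_{-N}^{N}\int_{-M}^{M}K_{A_1^{-1}}^{-\mathbf{i}}(u,x_0)\mathcal{L}_T^{-\mathbf{i},\mathbf{j}}(f_b)(u,v)K_{A_2^{-1}}^{\mathbf{j}}(v,y_0)\,du\,dv\;\mathbf{j}.$$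 (Left-sided case.) If $e^{\mathbf{i}\frac{a_1}{2b_1}s^2}f_d(s,t)e^{\mathbf{j}\frac{a_2}{2b_2}t^2}$ and $e^{\mathbf{i}\frac{a_1}{2b_1}s^2}f_e(s,t)e^{-\mathbf{j}\frac{a_2}{2b_2}t^2}$ belong to $\mathbf{LC}$ in this cross-neighborhood, then $$f(x_0,y_0)=\lim_{N,M\to\infty}\int_{-N}^{N}\int_{-M}^{M}K_{A_1^{-1}}^{\mathbf{i}}(u,x_0)\mathcal{L}_T^{\mathbf{i},\mathbf{j}}(f_d)(u,v)K_{A_2^{-1}}^{\mathbf{j}}(v,y_0)\,du\,dv+\mathbf{i}\lim_{N,M\to\infty}\int_{-N}^{N}\int_{-M}^{M}K_{A_1^{-1}}^{\mathbf{i}}(u,x_0)\mathcal{L}_T^{\mathbf{i},-\mathbf{j}}(f_e)(u,v)K_{A_2^{-1}}^{-\mathbf{j}}(v,y_0)\,du\,dv.$$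
   Context: $\mathbb{H}$ is the algebra of quaternions $q=q_0+\mathbf{i}q_1+\mathbf{j}q_2+\mathbf{k}q_3$ ($q_n\in\mathbb{R}$) with $\mathbf{i}^2=\mathbf{j}^2=\mathbf{k}^2=-1$, $\mathbf{i}\mathbf{j}=-\mathbf{j}\mathbf{i}=\mathbf{k}$, $\mathbf{j}\mathbf{k}=-\mathbf{k}\mathbf{j}=\mathbf{i}$, $\mathbf{k}\mathbf{i}=-\mathbf{i}\mathbf{k}=\mathbf{j}$, and modulus $|q|=(q_0^2+q_1^2+q_2^2+q_3^2)^{1/2}$; $e^{\mu\theta}=\cos\theta+\mu\sin\theta$ for $\mu\in\{\pm\mathbf{i},\pm\mathbf{j}\}$. $L^1(\mathbb{R}^2,\mathbb{H})$ is the space of $f:\mathbb{R}^2\to\mathbb{H}$ with $\int_{\mathbb{R}^2}|f|\,ds\,dt<\infty$; integrals are taken componentwise. One-sided limits: $f(x_0\pm0,y_0\pm0)=\lim_{h\to0^+,k\to0^+}f(x_0\pm h,y_0\pm k)$ (all four sign combinations, double limits). In the double integrals $u\in[-M,M]$, $v\in[-N,N]$, and $M,N\to\infty$ independently. Kernels and transform: for a real matrix $A=\begin{pmatrix}a&b\\c&d\end{pmatrix}$ with $\det A=1$, $b\neq0$, and $\mu\in\{\pm\mathbf{i},\pm\mathbf{j}\}$, $K_A^{\mu}(x,y)=\frac{1}{\sqrt{\mu2\pi b}}e^{\mu(\frac{a}{2b}x^2-\frac1bxy+\frac{d}{2b}y^2)}$, where $\sqrt{\mu2\pi b}=\sqrt{2\pi|b|}\,e^{\mu\,\mathrm{sgn}(b)\pi/4}$;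 $A^{-1}=\begin{pmatrix}d&-b\\-c&a\end{pmatrix}$. For $\mu\in\{\pm\mathbf{i}\}$, $\nu\in\{\pm\mathbf{j}\}$, the two-sided quaternion linear canonical transform is $\mathcal{L}_T^{\mu,\nu}(g)(u,v)=\int_{\mathbb{R}^2}K_{A_1}^{\mu}(s,u)g(s,t)K_{A_2}^{\nu}(t,v)\,ds\,dt$. (The two formulas are called the inversion formulas of the right-sided transform $\int_{\mathbb{R}^2}f K_{A_1}^{\mathbf{i}}K_{A_2}^{\mathbf{j}}\,ds\,dt$ and of the left-sided transform $\int_{\mathbb{R}^2}K_{A_1}^{\mathbf{i}}K_{A_2}^{\mathbf{j}}f\,ds\,dt$ respectively.) Bounded variation: a real function $f$ on a rectangle $[\alpha_1,\beta_1]\times[\alpha_2,\beta_2]$ is a bounded variation function (BVF) if (i) the sums $\sum_{i=0}^{m-1}\sum_{j=0}^{n-1}|f(s_{i+1},t_{j+1})-f(s_{i+1},t_j)-f(s_i,t_{j+1})+f(s_i,t_j)|$ are bounded over all nets $\alpha_1=s_0<\dots<s_m=\beta_1$, $\alpha_2=t_0<\dots<t_n=\beta_2$; (ii) for at least one $\tilde s\in[\alpha_1,\beta_1]$, $f(\tilde s,\cdot)$ is of (one-dimensional) bounded variation on $[\alpha_2,\beta_2]$; (iii) for at least one $\tilde t\in[\alpha_2,\beta_2]$, $f(\cdot,\tilde t)$ is of bounded variation on $[\alpha_1,\beta_1]$. A quaternionic function is a QBVF if and only if each of its four real components is a BVF. Cross-neighborhood: for $\varepsilon_1,\varepsilon_2>0$,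 the set of points $(s,t)$ with $|s-x_0|\le\varepsilon_1$ or $|t-y_0|\le\varepsilon_2$ (or both). A function is a BVF (QBVF) in this set if its restriction to each closed bounded rectangle contained in it is. Class $\mathbf{LC}$: for a function $g$ on $\mathbb{R}^2$ put $\tilde g(s,t)=g(x_0-s,y_0-t)+g(x_0+s,y_0+t)+g(x_0-s,y_0+t)+g(x_0+s,y_0-t)$, $\mathbb{A}=\{s\in\mathbb{R}:\int_{\mathbb{R}}|\tilde g(s,t)|dt<\infty\}$, $\mathbb{B}=\{t\in\mathbb{R}:\int_{\mathbb{R}}|\tilde g(s,t)|ds<\infty\}$. Then $g$ belongs to $\mathbf{LC}$ in the cross-neighborhood of $(x_0,y_0)$ with parameters $\varepsilon_1,\varepsilon_2$ if for some $a\in\mathbb{A}$, $b\in\mathbb{B}$ $$\int_{\varepsilon_2}^{\infty}\int_0^{\varepsilon_1}\left|\frac{\tilde g(s,t)-\tilde g(a,t)}{s}\right|ds\,dt<\infty,\qquad \int_{\varepsilon_1}^{\infty}\int_0^{\varepsilon_2}\left|\frac{\tilde g(s,t)-\tilde g(s,b)}{t}\right|dt\,ds<\infty.$$ *)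

(* Defs.v *)
From HB Require Import structures.
From mathcomp Require Import all_boot all_order all_algebra ring lra.
From mathcomp Require Import all_classical all_reals all_analysis.

Set Implicit Arguments.
Unset Strict Implicit.
Unset Printing Implicit Defensive.

Import Order.TTheory GRing.Theory Num.Theory.
Import numFieldNormedType.Exports.

Local Open Scope classical_set_scope.
Local Open Scope ring_scope.

(* [Quat q0 q1 q2 q3] is q0 + i q1 + j q2 + k q3 *)
Record quat (R : Type) := Quat { q0 : R; q1 : R; q2 : R; q3 : R }.

Definition quat_tuple (R : Type) (q : quat R) := (q0 q, q1 q, q2 q, q3 q).
Definition tuple_quat (R : Type) (t : R * R * R * R) :=
  let: (a, b, c, d) := t in Quat a b c d.
Lemma quat_tupleK (R : Type) : cancel (@quat_tuple R) (@tuple_quat R).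
Proof. by case. Qed.

HB.instance Definition _ (R : realType) :=
  Choice.copy (quat R) (can_type (@quat_tupleK R)).

Section QuatAlgebra.
Variable R : realType.
Implicit Types (p q r : quat R) (a b : R).

Definition qzero : quat R := Quat 0 0 0 0.
Definition qone : quat R := Quat 1 0 0 0.
Definition qopp q : quat R := Quat (- q0 q) (- q1 q) (- q2 q) (- q3 q).
Definition qadd p q : quat R :=
  Quat (q0 p + q0 q) (q1 p + q1 q) (q2 p + q2 q) (q3 p + q3 q).
Definition qscale a q : quat R := Quat (a * q0 q) (a * q1 q) (a * q2 q) (a * q3 q).
Definition qmul p q : quat R := Quat
  (q0 p * q0 q - q1 p * q1 q - q2 p * q2 q - q3 p * q3 q)
  (q0 p * q1 q + q1 p * q0 q + q2 p * q3 q - q3 p * q2 q)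
  (q0 p * q2 q + q2 p * q0 q + q3 p * q1 q - q1 p * q3 q)
  (q0 p * q3 q + q3 p * q0 q + q1 p * q2 q - q2 p * q1 q).
Definition qsqr q : R := q0 q ^+ 2 + q1 q ^+ 2 + q2 q ^+ 2 + q3 q ^+ 2.
Definition qconj q : quat R := Quat (q0 q) (- q1 q) (- q2 q) (- q3 q).
Definition qnorm q : R := Num.sqrt (qsqr q).

Local Ltac qring :=
  repeat case=> ? ? ? ?; rewrite /qadd /qmul /qscale /qopp /=; congr Quat; ring.

Lemma qaddA : associative qadd. Proof. qring. Qed.
Lemma qaddC : commutative qadd. Proof. qring. Qed.
Lemma qadd0 : left_id qzero qadd. Proof. qring. Qed.
Lemma qaddN : left_inverse qzero qopp qadd. Proof. qring. Qed.
HB.instance Definition _ := GRing.isZmodule.Build (quat R) qaddA qaddC qadd0 qaddN.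

Lemma qmulA : associative qmul. Proof. qring. Qed.
Lemma qmul1l : left_id qone qmul. Proof. qring. Qed.
Lemma qmul1r : right_id qone qmul. Proof. qring. Qed.
Lemma qmulDl : left_distributive qmul qadd. Proof. qring. Qed.
Lemma qmulDr : right_distributive qmul qadd. Proof. qring. Qed.
Lemma qone_neq0 : qone != 0.
Proof. by apply/eqP => -[/eqP]; rewrite oner_eq0. Qed.
HB.instance Definition _ := GRing.Zmodule_isNzRing.Build (quat R)
  qmulA qmul1l qmul1r qmulDl qmulDr qone_neq0.

Lemma qscaleA a b q : qscale a (qscale b q) = qscale (a * b) q.
Proof. by move: q; qring. Qed.
Lemma qscale1 : left_id 1 qscale. Proof. qring. Qed.
Lemma qscaleDr : right_distributive qscale qadd. Proof. by move=> ?; qring. Qed.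
Lemma qscaleDl q : forall a b, qscale (a + b) q = qadd (qscale a q) (qscale b q).
Proof. by move: q => [? ? ? ?] ? ?; congr Quat; rewrite mulrDl. Qed.
HB.instance Definition _ := GRing.Zmodule_isLmodule.Build R (quat R)
  qscaleA qscale1 qscaleDr qscaleDl.

Lemma qscaleAl a p q : qscale a (qmul p q) = qmul (qscale a p) q.
Proof. by move: p q; qring. Qed.
HB.instance Definition _ := GRing.Lmodule_isLalgebra.Build R (quat R) qscaleAl.

Lemma qscaleAr a p q : qscale a (qmul p q) = qmul p (qscale a q).
Proof. by move: p q; qring. Qed.
HB.instance Definition _ := GRing.Lalgebra_isAlgebra.Build R (quat R) qscaleAr.

Lemma qsqr_ge0 q : 0 <= qsqr q.
Proof. by rewrite !addr_ge0// sqr_ge0. Qed.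

Lemma qsqr_eq0 q : qsqr q = 0 -> q = 0.
Proof.
case: q => a b c d; rewrite /qsqr/= => /eqP.
rewrite !paddr_eq0 ?addr_ge0 ?sqr_ge0// !sqrf_eq0.
by move=> /andP[/andP[/andP[/eqP-> /eqP->] /eqP->] /eqP->].
Qed.

Lemma qconj_mull q : qconj q * q = qsqr q *: 1.
Proof. by case: q => ? ? ? ?; congr Quat; rewrite /qsqr/=; ring. Qed.

Lemma qconj_mulr q : q * qconj q = qsqr q *: 1.
Proof. by case: q => ? ? ? ?; congr Quat; rewrite /qsqr/=; ring. Qed.

Definition qinv q : quat R := if q == 0 then q else (qsqr q)^-1 *: qconj q.

Definition qunit : {pred quat R} := [pred q | q != 0].

Lemma qmulV : {in qunit, left_inverse 1 qinv *%R}.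
Proof.
move=> q; rewrite inE /qinv => q0; rewrite (negbTE q0).
rewrite -scalerAl qconj_mull scalerA mulVf ?scale1r//.
by apply: contraNneq q0 => /qsqr_eq0 ->.
Qed.

Lemma qmulrV : {in qunit, right_inverse 1 qinv *%R}.
Proof.
move=> q; rewrite inE /qinv => q0; rewrite (negbTE q0).
rewrite -scalerAr qconj_mulr scalerA mulVf ?scale1r//.
by apply: contraNneq q0 => /qsqr_eq0 ->.
Qed.

Lemma qunitP p q : q * p = 1 /\ p * q = 1 -> qunit p.
Proof.
move=> [qp _]; apply/eqP => p0; move: qp; rewrite p0 mulr0 => /esym/eqP.
by rewrite oner_eq0.
Qed.

Lemma qinv_out : {in [predC qunit], qinv =1 id}.
Proof. by move=> q; rewrite !inE negbK /qinv => /eqP ->; rewrite eqxx. Qed.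

HB.instance Definition _ := GRing.NzRing_hasMulInverse.Build (quat R)
  qmulV qmulrV qunitP qinv_out.

Lemma qnormD p q : qnorm (p + q) <= qnorm p + qnorm q.
Proof.
rewrite -(@ler_pXn2r _ 2)// ?nnegrE ?addr_ge0 ?sqrtr_ge0//.
rewrite sqrrD !sqr_sqrtr ?qsqr_ge0//.
pose s := q0 p * q0 q + q1 p * q1 q + q2 p * q2 q + q3 p * q3 q.
have -> : qsqr (p + q) = qsqr p + s *+ 2 + qsqr q by rewrite /qsqr /s /=; ring.
rewrite lerD2r lerD2l lerMn2r/= /qnorm -sqrtrM ?qsqr_ge0//.
rewrite (le_trans (ler_norm s))// -sqrtr_sqr ler_sqrt ?mulr_ge0 ?qsqr_ge0//.
rewrite -subr_ge0.
have -> : qsqr p * qsqr q - s ^+ 2 =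
  (q0 p * q1 q - q1 p * q0 q) ^+ 2 + (q0 p * q2 q - q2 p * q0 q) ^+ 2 +
  (q0 p * q3 q - q3 p * q0 q) ^+ 2 + (q1 p * q2 q - q2 p * q1 q) ^+ 2 +
  (q1 p * q3 q - q3 p * q1 q) ^+ 2 + (q2 p * q3 q - q3 p * q2 q) ^+ 2.
  by rewrite /qsqr /s; ring.
by rewrite !addr_ge0// sqr_ge0.
Qed.

Lemma qnormZ a q : qnorm (a *: q) = `|a| * qnorm q.
Proof.
rewrite /qnorm -sqrtr_sqr -sqrtrM ?sqr_ge0//; congr Num.sqrt.
by case: q => ? ? ? ?; rewrite /qsqr/=; ring.
Qed.

Lemma qnorm_eq0 q : qnorm q = 0 -> q = 0.
Proof.
move=> /eqP; rewrite sqrtr_eq0 => q0; apply: qsqr_eq0.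
by apply/eqP; rewrite eq_le q0 qsqr_ge0.
Qed.

(* `|q| is the modulus and [-->] is convergence in modulus *)
HB.instance Definition _ := Lmodule_isNormed.Build R (quat R) qnormD qnormZ qnorm_eq0.

End QuatAlgebra.

Definition qi {R : realType} : quat R := Quat 0 1 0 0.
Definition qj {R : realType} : quat R := Quat 0 0 1 0.
Definition qk {R : realType} : quat R := Quat 0 0 0 1.

Lemma quat_units (R : realType) :
  [/\ qi * qi = -1 :> quat R, qj * qj = -1 :> quat R & qk * qk = -1 :> quat R] /\
  [/\ qi * qj = qk :> quat R, qj * qk = qi :> quat R & qk * qi = qj :> quat R] /\
  [/\ qj * qi = - qk :> quat R, qk * qj = - qi :> quat R
    & qi * qk = - qj :> quat R].
Proof. by do !split; congr Quat; rewrite /=; ring. Qed.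

Section Kernels.
Variable R : realType.
Implicit Types (mu nu : quat R) (A : 'M[R]_2).

(* e^(mu theta), for mu^2 = -1 *)
Definition qexp mu (theta : R) : quat R := (cos theta)%:A + mu * (sin theta)%:A.

(* the square root of mu 2 pi b *)
Definition lct_sqrt mu (b : R) : quat R :=
  Num.sqrt (2 * pi * `|b|) *: qexp mu (Num.sg b * (pi / 4)).

Definition lct_kernel mu A (x y : R) : quat R :=
  let: (a, b, d) := (A 0 0, A 0 1, A 1 1) in
  (lct_sqrt mu b)^-1 *
  qexp mu (a / (2 * b) * x ^+ 2 - b^-1 * x * y + d / (2 * b) * y ^+ 2).

End Kernels.

Section Integration.
Context d (T : measurableType d) (R : realType) (m : {measure set T -> \bar R}).
Local Open Scope ereal_scope.

(* The sigma-algebras of the library on R and R * R are the Borel ones; a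
   function is Lebesgue measurable iff it agrees almost everywhere with a Borel
   function. On nonnegative such functions the library integral, a supremum over
   simple functions, is the Lebesgue integral. *)
Definition ae_measurable (h : T -> R) :=
  exists2 h' : T -> R, measurable_fun setT h' & {ae m, forall x, h x = h' x}.

Definition qmeasurable (F : T -> quat R) :=
  [/\ ae_measurable (@q0 R \o F), ae_measurable (@q1 R \o F),
      ae_measurable (@q2 R \o F) & ae_measurable (@q3 R \o F)].

Definition qL1 (F : T -> quat R) :=
  qmeasurable F /\ \int[m]_x (`|F x|)%:E < +oo.

Definition qintegral (D : set T) (F : T -> quat R) : quat R :=
  Quat (\int[m]_(x in D) q0 (F x))%R (\int[m]_(x in D) q1 (F x))%R
       (\int[m]_(x in D) q2 (F x))%R (\int[m]_(x in D) q3 (F x))%R.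

End Integration.

Section Inversion.
Variable R : realType.
Local Notation leb := (@lebesgue_measure R).
Local Notation leb2 := (leb \x leb)%E.
Implicit Types (mu nu : quat R) (A : 'M[R]_2) (g : R * R -> quat R).

Definition qL1_plane g := qL1 leb2 g.

Definition qlct mu nu A1 A2 g (u v : R) : quat R :=
  qintegral leb2 setT
    (fun p => lct_kernel mu A1 p.1 u * g p * lct_kernel nu A2 p.2 v).

Definition qlct_inv_trunc mu nu A1 A2 g (x0 y0 M N : R) : quat R :=
  qintegral leb `[- N, N] (fun v => qintegral leb `[- M, M] (fun u =>
    lct_kernel mu (invmx A1) u x0 * qlct mu nu A1 A2 g u v *
    lct_kernel nu (invmx A2) v y0)).

(* the double limit as M, N tend to +oo independently *)
Definition qlct_inv_cvg mu nu A1 A2 g (x0 y0 : R) (l : quat R) :=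
  (fun MN : R * R => qlct_inv_trunc mu nu A1 A2 g x0 y0 MN.1 MN.2) @
    filter_prod (+oo : set_system R) (+oo : set_system R) --> l.

(* g(x0 +- 0, y0 +- 0) = l, with signs s1, s2 in {1, -1} *)
Definition quadrant_limit g (x0 y0 s1 s2 : R) (l : quat R) :=
  (fun hk : R * R => g (x0 + s1 * hk.1, y0 + s2 * hk.2)) @
    filter_prod (0 : R)^'+ (0 : R)^'+ --> l.

(* the four quadrant limits exist and q is their mean *)
Definition quadrant_mean g (x0 y0 : R) (q : quat R) :=
  exists lpp lpm lmp lmm : quat R,
    [/\ quadrant_limit g x0 y0 1 1 lpp, quadrant_limit g x0 y0 1 (-1) lpm,
        quadrant_limit g x0 y0 (-1) 1 lmp, quadrant_limit g x0 y0 (-1) (-1) lmm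
      & q = 4^-1 *: (lpp + lpm + lmp + lmm)].

(* As in [variation], the nets are a1 :: s and a2 :: t. *)
Definition variation2 (a1 b1 a2 b2 : R) (h : R * R -> R) (s t : seq R) : R :=
  let S := nth b1 (a1 :: s) in let T := nth b2 (a2 :: t) in
  \sum_(0 <= i < size s) \sum_(0 <= j < size t)
    `|h (S i.+1, T j.+1) - h (S i.+1, T j) - h (S i, T j.+1) + h (S i, T j)|.

Definition BVF (a1 b1 a2 b2 : R) (h : R * R -> R) :=
  [/\ exists V : R, forall s t, itv_partition a1 b1 s -> itv_partition a2 b2 t ->
        variation2 a1 b1 a2 b2 h s t <= V,
      exists2 s, s \in `[a1, b1] & bounded_variation a2 b2 (fun t => h (s, t))
    & exists2 t, t \in `[a2, b2] & bounded_variation a1 b1 (fun s => h (s, t))].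

Definition QBVF (a1 b1 a2 b2 : R) g :=
  [/\ BVF a1 b1 a2 b2 (@q0 R \o g), BVF a1 b1 a2 b2 (@q1 R \o g),
      BVF a1 b1 a2 b2 (@q2 R \o g) & BVF a1 b1 a2 b2 (@q3 R \o g)].

Definition cross_nbhd (x0 y0 e1 e2 : R) : set (R * R) :=
  [set p | `|p.1 - x0| <= e1 \/ `|p.2 - y0| <= e2].

Definition QBVF_in (D : set (R * R)) g :=
  forall a1 b1 a2 b2 : R, a1 < b1 -> a2 < b2 ->
    `[a1, b1] `*` `[a2, b2] `<=` D -> QBVF a1 b1 a2 b2 g.

Definition symmetrization g (x0 y0 : R) (p : R * R) : quat R :=
  g (x0 - p.1, y0 - p.2) + g (x0 + p.1, y0 + p.2) +
  g (x0 - p.1, y0 + p.2) + g (x0 + p.1, y0 - p.2).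

Definition LC (x0 y0 e1 e2 : R) g :=
  let gt := symmetrization g x0 y0 in
  let AA := [set s | qL1 leb (fun t => gt (s, t))] in
  let BB := [set t | qL1 leb (fun s => gt (s, t))] in
  exists a b : R, [/\ AA a, BB b,
    (\int[leb]_(t in `[e2, +oo[) \int[leb]_(s in `[0%R, e1])
       (`|s^-1 *: (gt (s, t) - gt (a, t))|%R)%:E < +oo)%E &
    (\int[leb]_(s in `[e1, +oo[) \int[leb]_(t in `[0%R, e2])
       (`|t^-1 *: (gt (s, t) - gt (s, b))|%R)%:E < +oo)%E].

End Inversion.

(* Main.v *)
Require Import Defs.
From HB Require Import structures.
From mathcomp Require Import all_boot all_order all_algebra ring lra.
From mathcomp Require Import all_classical all_reals all_analysis.
From mathcomp Require Import measurable_realfun.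
Import Order.TTheory GRing.Theory Num.Theory.
Import numFieldNormedType.Exports.
Local Open Scope classical_set_scope.
Local Open Scope ring_scope.
Set Implicit Arguments.
Unset Strict Implicit.
Unset Printing Implicit Defensive.

(** Inversion of the quaternion linear canonical transform at a jump point.

    Fix imaginary units mu, nu, put al_i = a_i / (2 b_i), and let
      G (s, t) = e^(mu al_1 s^2) g (s, t) e^(nu al_2 t^2)
    be g multiplied by the two chirps.  The product of the kernels of A and of
    its inverse is, up to the factor 1 / (2 pi b), the product of the chirp in
    s, the inverse chirp in x0, and the pure exponential
    e^(mu u (x0 - s) / b): the terms in u^2 cancel ([lct_kernel_mul]).
    Integrate in u over [-M, M].  The sine part of the exponential is odd in u
    and vanishes, so that only the real number 2 sin (M (x0 - s) / b) / ((x0 - s) / b)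
    remains, and a real factor commutes with every quaternion
    ([plane_qexp_averagel]).  After the same step in v, on the right, the
    truncated inverse transform is
      pi^-2 E1 (int G (s, t) k_(M/b1) (x0 - s) k_(N/b2) (y0 - t)) E2,
    where k_M (s) = sin (M s) / s and E1, E2 are the inverse chirps at x0 and y0
    ([qlct_inv_truncE]).  This uses mu^2 = nu^2 = -1 and holds for every
    integrable g; so it is enough to study the four real components of this
    Dirichlet integral.

    Let h be a component of G and H its sum over the four reflections at
    (x0, y0).  Folding the plane at this point turns the integral of h into the
    integral of H over a quadrant, which e1 and e2 cut into four rectangles.
    Away from both axes 1 / (s t) is bounded and the Riemann-Lebesgue lemma
    gives 0 ([far_corner_cvg]).  Along an axis the class LC makes
    (H (s, t) - H (a, t)) / s integrable, and the section H (a, t) that is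
    subtracted contributes a bounded Dirichlet integral in s times a
    Riemann-Lebesgue integral in t; the limit is again 0 ([strip1_cvg],
    [strip2_cvg]).  On the central rectangle H is of bounded variation, and
    Jordan's argument in s, uniform in N, followed by Jordan's argument in t
    gives (pi/2)^2 times the limit of H at the corner ([double_jordan]).
    Altogether the limit is (pi/2)^2 (sum of the four quadrant limits of h)
    ([plane_dirichlet]); the factors E1, E2 undo the chirps at (x0, y0), and
    pi^-2 (pi/2)^2 = 1/4 makes the mean of the quadrant limits of g
    ([qlct_inversion]).

    The theorem applies this to g = f_a, f_b with units (i, j), (-i, j), and to
    g = f_d, f_e with units (i, j), (i, -j), and recombines with
    f = f_a + f_b j = f_d + i f_e.

    Functions are only almost everywhere equal to Borel functions, whereas
    bounded variation and quadrant limits concern the values themselves; hence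
    the pairs h, h' below, in which h' is a Borel version of h. *)

(** * Almost everywhere changes of the integrand, and Fubini's theorem *)

Lemma ae_imply d (T : measurableType d) (R : realType)
    (m : {measure set T -> \bar R}) (P Q : T -> Prop) :
  (forall x, P x -> Q x) -> {ae m, forall x, P x} -> {ae m, forall x, Q x}.
Proof. by move=> PQ; apply: filterS. Qed.

Lemma ae_imply2 d (T : measurableType d) (R : realType)
    (m : {measure set T -> \bar R}) (P Q S : T -> Prop) :
  (forall x, P x -> Q x -> S x) -> {ae m, forall x, P x} ->
  {ae m, forall x, Q x} -> {ae m, forall x, S x}.
Proof. by move=> PQ; apply: filterS2. Qed.

Section LowerIntegral.
Context d (T : measurableType d) (R : realType) (m : {measure set T -> \bar R}).
Local Open Scope ereal_scope.
Import HBNNSimple.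

(** The integral of a nonnegative function, measurable or not, is the supremum of
    the integrals of the simple functions below it.  A simple function below f
    that is set to 0 on the exceptional null set lies below g and keeps its
    integral.  This is what allows Borel versions inside the iterated integrals
    of the class LC. *)
Lemma ge0_ae_le_lower_integral (D : set T) (f g : T -> \bar R) :
  measurable D -> (forall x, D x -> 0 <= f x) -> (forall x, D x -> 0 <= g x) ->
  {ae m, forall x, D x -> f x <= g x} ->
  \int[m]_(x in D) f x <= \int[m]_(x in D) g x.
Proof.
move=> mD f0 g0 [N [mN N0 fgN]].
rewrite !ge0_integralE//; apply: ge_ereal_sup => _ [h /= hf <-].
have mNc : measurable (~` N) by exact: measurableC.
pose h' := proj_nnsfun h mNc.
apply: ereal_sup_ubound; exists h'.
  move=> x; rewrite /h' /= mindicE in_setC.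
  case: (boolP (x \in N)) => [_|/negP Nx]; rewrite /= ?mulr0 ?mulr1.
    by rewrite patchE; case: ifPn => // /set_mem; apply: g0.
  apply: le_trans (hf x) _; rewrite !patchE; case: ifPn => // /set_mem Dx.
  by apply: contrapT => fg; apply/Nx/mem_set; apply: fgN => /= /(_ Dx).
rewrite -!integralT_nnsfun.
have H (k : {nnsfun T >-> R}) :
    \int[m]_x (k x)%:E = \int[m]_(x in setT `\` N) (k x)%:E.
  apply: (ge0_negligible_integral mN) => //.
    by apply/measurable_EFinP; exact: measurable_funP.
  by move=> x _ /=; rewrite lee_fin.
rewrite (H h) (H h').
apply: eq_integral => x; rewrite inE /= => -[_ Nx].
by rewrite /h' /= mindicE mem_set ?mulr1.
Qed.

Lemma ae_eq_lower_integral (D : set T) (f g : T -> \bar R) :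
  measurable D -> {ae m, forall x, D x -> f x = g x} ->
  \int[m]_(x in D) f x = \int[m]_(x in D) g x.
Proof.
move=> mD fg.
have H (u v : T -> \bar R) : (forall x, 0 <= u x) -> (forall x, 0 <= v x) ->
    {ae m, forall x, D x -> u x = v x} ->
    \int[m]_(x in D) u x = \int[m]_(x in D) v x.
  move=> u0 v0 uv; apply/eqP; rewrite eq_le; apply/andP; split;
    apply: ge0_ae_le_lower_integral => //; apply: filterS uv => x + Dx => /(_ Dx) ->//.
rewrite integralE [RHS]integralE; congr (_ - _); apply: H => //;
  apply: filterS fg => x + Dx => /(_ Dx) fgx.
- by rewrite !funeposE fgx.
- by rewrite !funenegE fgx.
Qed.

Lemma ae_eq_lower_Rintegral (D : set T) (f g : T -> R) :
  measurable D -> {ae m, forall x, D x -> f x = g x} ->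
  Rintegral m D f = Rintegral m D g.
Proof.
move=> mD fg; congr fine; apply: ae_eq_lower_integral => //.
by apply: filterS fg => x + Dx => /(_ Dx) ->.
Qed.

End LowerIntegral.

Lemma EFin_abs_fine_le (R : realType) (x : \bar R) :
  (`|(fine x)%:E| <= `|x|)%E.
Proof. by case: x => [r||] //=; rewrite normr0 leey. Qed.

Section RFubini.
Context d1 d2 (T1 : measurableType d1) (T2 : measurableType d2) (R : realType).
Variable m1 : {sigma_finite_measure set T1 -> \bar R}.
Variable m2 : {sigma_finite_measure set T2 -> \bar R}.
Local Notation m12 := (m1 \x m2)%E.

Lemma product_null_xsection (N : set (T1 * T2)) : m12.-negligible N ->
  {ae m1, forall x, m2.-negligible (xsection N x)}.
Proof.
move=> [N' [mN' N'0 NN']].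
have mx : measurable_fun setT (m2 \o xsection N') by exact: measurable_fun_xsection.
have /ae_eq_integral_abs : (\int[m1]_x `|(m2 \o xsection N') x| = 0)%E.
  by under eq_integral do rewrite gee0_abs ?measure_ge0//; exact: N'0.
move=> /(_ measurableT mx); apply: filterS => x /= /(_ I) Nx0.
exists (xsection N' x); split => //; first exact: measurable_xsection.
by move=> y; rewrite !xsectionE/= => /NN'.
Qed.

Lemma product_null_ysection (N : set (T1 * T2)) : m12.-negligible N ->
  {ae m2, forall y, m1.-negligible (ysection N y)}.
Proof.
move=> [N' [mN' N'0 NN']].
have mx : measurable_fun setT (m1 \o ysection N') by exact: measurable_fun_ysection.
have /ae_eq_integral_abs : (\int[m2]_x `|(m1 \o ysection N') x| = 0)%E.
  under eq_integral do rewrite gee0_abs ?measure_ge0//.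
  under eq_integral do rewrite -indic_fubini_tonelli_GE//.
  rewrite -indic_fubini_tonelli// -indic_fubini_tonelli1//.
  by rewrite integral_indic// setIT.
move=> /(_ measurableT mx); apply: filterS => x /= /(_ I) Nx0.
exists (ysection N' x); split => //; first exact: measurable_ysection.
by move=> y; rewrite !ysectionE/= => /NN'.
Qed.

Lemma ae_product1 (P : T1 * T2 -> Prop) : {ae m12, forall p, P p} ->
  {ae m1, forall x, {ae m2, forall y, P (x, y)}}.
Proof.
by move=> /product_null_xsection; apply: filterS => x; apply: negligibleS => y;
   rewrite xsectionE.
Qed.

Lemma ae_product2 (P : T1 * T2 -> Prop) : {ae m12, forall p, P p} ->
  {ae m2, forall y, {ae m1, forall x, P (x, y)}}.
Proof.
by move=> /product_null_ysection; apply: filterS => x; apply: negligibleS => y;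
   rewrite ysectionE.
Qed.

Lemma integrable_partial2 (f : T1 * T2 -> \bar R) :
  m12.-integrable setT f -> m2.-integrable setT (fubini_G m1 f).
Proof.
move=> fi; have mf := measurable_int _ fi.
have mG : measurable_fun setT (fun y => (\int[m1]_x `|f (x, y)|)%E).
  apply: (measurable_fun_fubini_tonelli_G (abse \o f)) => //=.
  exact: measurableT_comp.
apply/integrableP; split; first exact: (measurable_fubini_G fi).
apply: le_lt_trans ((integrable21ltyP m1 m2 mf).1 fi).
apply: ge0_le_integral => //.
- by apply: measurableT_comp => //; exact: (measurable_fubini_G fi).
- move=> y _; apply: le_abse_integral => //.
  exact: measurable_fun_pair1 mf.
Qed.

Section on_rectangle.
Variables (D1 : set T1) (D2 : set T2) (f : T1 * T2 -> R).
Hypotheses (mD1 : measurable D1) (mD2 : measurable D2).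
Hypothesis fi : m12.-integrable (D1 `*` D2) (EFin \o f).

Let g := (EFin \o f) \_ (D1 `*` D2).

Let gi : m12.-integrable setT g.
Proof. by apply/(integrable_mkcond _ _).1 => //; exact: measurableX. Qed.

Let g1 x y : D1 x -> g (x, y) = ((fun y => (f (x, y))%:E) \_ D2) y.
Proof.
move=> D1x; rewrite /g !patchE; congr (if _ then _ else _).
by apply/idP/idP => [/set_mem[_ /=] ?|/set_mem ?]; apply/mem_set.
Qed.

Let g2 x y : D2 y -> g (x, y) = ((fun x => (f (x, y))%:E) \_ D1) x.
Proof.
move=> D2y; rewrite /g !patchE; congr (if _ then _ else _).
by apply/idP/idP => [/set_mem[/= ? _] |/set_mem ?]; apply/mem_set.
Qed.

Let g10 x y : ~ D1 x -> g (x, y) = 0%E.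
Proof. by move=> D1x; rewrite /g patchE memNset// => -[]. Qed.

Let g20 x y : ~ D2 y -> g (x, y) = 0%E.
Proof. by move=> D2y; rewrite /g patchE memNset// => -[]. Qed.

Let FE : fubini_F m2 g = (fun x => \int[m2]_(y in D2) (f (x, y))%:E)%E \_ D1.
Proof.
apply/funext => x; rewrite /fubini_F patchE; case: ifPn => [/set_mem D1x|].
  by under eq_integral do rewrite g1//; rewrite -integral_mkcond.
move=> /negP D1x; apply: integral0_eq => y _; apply: g10.
by move=> /mem_set.
Qed.

Let GE : fubini_G m1 g = (fun y => \int[m1]_(x in D1) (f (x, y))%:E)%E \_ D2.
Proof.
apply/funext => y; rewrite /fubini_G patchE; case: ifPn => [/set_mem D2y|].
  by under eq_integral do rewrite g2//; rewrite -integral_mkcond.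
move=> /negP D2y; apply: integral0_eq => x _; apply: g20.
by move=> /mem_set.
Qed.

Let F_fin : {ae m1, forall x, D1 x -> (\int[m2]_(y in D2) (f (x, y))%:E)%E =
   (\int[m2]_(y in D2) f (x, y))%:E}.
Proof.
apply: filterS (ae_integrable1 gi) => x gix D1x.
rewrite /Rintegral fineK//; apply: integrable_fin_num => //.
apply/(integrable_mkcond _ _).2 => //.
by rewrite (_ : _ \_ _ = (fun y => g (x, y)))//; apply/funext => y; rewrite g1.
Qed.

Let G_fin : {ae m2, forall y, D2 y -> (\int[m1]_(x in D1) (f (x, y))%:E)%E =
   (\int[m1]_(x in D1) f (x, y))%:E}.
Proof.
apply: filterS (ae_integrable2 gi) => y giy D2y.
rewrite /Rintegral fineK//; apply: integrable_fin_num => //.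
apply/(integrable_mkcond _ _).2 => //.
by rewrite (_ : _ \_ _ = (fun x => g (x, y)))//; apply/funext => x; rewrite g2.
Qed.

(** The inner integrals may be infinite for the points of a null set, where the
    real-valued integral is 0 by convention; by [ae_eq_lower_integral] this does
    not change the outer integral. *)
Lemma Rintegral12 : \int[m12]_(p in D1 `*` D2) f p =
  \int[m1]_(x in D1) \int[m2]_(y in D2) f (x, y).
Proof.
transitivity (fine (\int[m1]_x (fubini_F m2 g) x)%E).
  by rewrite [LHS]/Rintegral integral_mkcond -/g -integral12_prod_meas1.
rewrite FE -integral_mkcond.
by rewrite [RHS]/Rintegral; congr fine; apply: ae_eq_lower_integral.
Qed.

Lemma Rintegral21 : \int[m12]_(p in D1 `*` D2) f p =
  \int[m2]_(y in D2) \int[m1]_(x in D1) f (x, y).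
Proof.
transitivity (fine (\int[m2]_y (fubini_G m1 g) y)%E).
  by rewrite [LHS]/Rintegral integral_mkcond -/g -integral21_prod_meas1.
rewrite GE -integral_mkcond.
by rewrite [RHS]/Rintegral; congr fine; apply: ae_eq_lower_integral.
Qed.

Lemma ae_integrable_section1 :
  {ae m1, forall x, D1 x -> m2.-integrable D2 (EFin \o (fun y => f (x, y)))}.
Proof.
apply: filterS (ae_integrable1 gi) => x gix D1x.
apply/(integrable_mkcond _ _).2 => //.
by rewrite (_ : _ \_ _ = (fun y => g (x, y)))//; apply/funext => y; rewrite g1.
Qed.

Lemma integrable_Rintegral1 :
  m1.-integrable D1 (EFin \o (fun x => \int[m2]_(y in D2) f (x, y))).
Proof.
have := integrable_fubini_F gi; rewrite FE => /(integrable_mkcond _ mD1).2 iF.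
have mF := measurable_int _ iF.
apply: (le_integrable mD1 _ _ iF).
  by apply/measurable_EFinP; exact: (measurableT_comp _ mF).
by move=> x D1x; rewrite /Rintegral /= EFin_abs_fine_le.
Qed.

Lemma integrable_Rintegral2 :
  m2.-integrable D2 (EFin \o (fun y => \int[m1]_(x in D1) f (x, y))).
Proof.
have := integrable_partial2 gi; rewrite GE => /(integrable_mkcond _ mD2).2 iF.
have mF := measurable_int _ iF.
apply: (le_integrable mD2 _ _ iF).
  by apply/measurable_EFinP; exact: (measurableT_comp _ mF).
by move=> x D1x; rewrite /Rintegral /= EFin_abs_fine_le.
Qed.

End on_rectangle.

End RFubini.

Section BoundedIntegrands.
Context d (T : measurableType d) (R : realType) (m : {measure set T -> \bar R}).

Lemma bounded_integrable (D : set T) (f : T -> R) (B : R) :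
  measurable D -> (m D < +oo)%E -> measurable_fun D f ->
  (forall x, D x -> `|f x| <= B) -> m.-integrable D (EFin \o f).
Proof.
move=> mD Dfin mf fB; apply: measurable_bounded_integrable => //.
exists B; split; first exact: num_real.
by move=> x Bx t Dt /=; rewrite (le_trans (fB _ Dt))// ltW.
Qed.

Lemma integrable_bounded_mul (D : set T) (h f : T -> R) (B : R) :
  measurable D -> measurable_fun D h -> (forall x, D x -> `|h x| <= B) ->
  m.-integrable D (EFin \o f) -> m.-integrable D (EFin \o (fun x => h x * f x)).
Proof.
move=> mD mh hB fi.
rewrite (_ : _ \o _ = (EFin \o h) \* (EFin \o f))%E//.
apply: integrableMr => //.
exists B; split; first exact: num_real.
by move=> x Bx t Dt /=; rewrite (le_trans (hB _ Dt))// ltW.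
Qed.

Lemma le_norm_Rintegral_weight (D : set T) (h f : T -> R) (B : R) :
  measurable D -> measurable_fun D h -> (forall x, D x -> `|h x| <= B) ->
  m.-integrable D (EFin \o f) ->
  `|\int[m]_(x in D) (h x * f x)| <= B * \int[m]_(x in D) `|f x|.
Proof.
move=> mD mh hB fi; have hfi := integrable_bounded_mul mD mh hB fi.
apply: (le_trans (le_normr_Rintegral mD hfi)).
have nfi := integrable_norm fi.
rewrite -RintegralZl//; apply: le_Rintegral => //.
- exact: integrable_norm hfi.
- exact: integrableZl nfi.
- by move=> x Dx; rewrite normrM ler_wpM2r// hB.
Qed.

End BoundedIntegrands.

(** * Reflections of the line and of the plane *)

Section MeasurePreserving.
Context d (T : measurableType d) (R : realType) (m : {measure set T -> \bar R}).
Variable phi : T -> T.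
Hypothesis mphi : measurable_fun setT phi.
Hypothesis phiE : forall A, measurable A -> m (phi @^-1` A) = m A.

Let measurable_preimage (A : set T) : measurable A -> measurable (phi @^-1` A).
Proof. by move=> mA; rewrite -[X in measurable X]setTI; exact: mphi. Qed.

Lemma ge0_integral_preserving (f : T -> \bar R) :
  measurable_fun setT f -> (forall x, 0 <= f x)%E ->
  (\int[m]_x f (phi x) = \int[m]_x f x)%E.
Proof.
move=> mf f0.
pose mphi' : {mfun T >-> T} := HB.pack phi (isMeasurableFun.Build _ _ _ _ _ mphi).
have := @ge0_integral_pushforward _ _ _ _ R phi mphi m setT f measurableT mf (fun x _ => f0 x).
rewrite preimage_setT => <-.
rewrite (_ : pushforward m phi = pushforward m mphi')//.
apply: (@eq_measure_integral _ _ _ _ m (pushforward m mphi')) => A mA _.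
exact: phiE.
Qed.

Lemma integrable_preserving (f : T -> R) : m.-integrable setT (EFin \o f) ->
  m.-integrable setT (EFin \o (f \o phi)).
Proof.
move=> /integrableP[mf fi]; apply/integrableP; split.
  exact: (measurableT_comp mf).
have -> : (\int[m]_x `|(EFin \o (f \o phi)) x| = \int[m]_x `|(EFin \o f) x|)%E.
  rewrite -[RHS]ge0_integral_preserving//.
  exact: measurableT_comp.
exact: fi.
Qed.

Lemma Rintegral_preserving (f : T -> R) : m.-integrable setT (EFin \o f) ->
  \int[m]_x f (phi x) = \int[m]_x f x.
Proof.
move=> fi; have /measurable_EFinP mf := measurable_int _ fi.
pose mphi' : {mfun T >-> T} := HB.pack phi (isMeasurableFun.Build _ _ _ _ _ mphi).
congr fine.
have := @integral_pushforward _ _ _ _ R phi mphi m setT (EFin \o f) _ _ measurableT.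
rewrite preimage_setT => <-.
- rewrite (_ : pushforward m phi = pushforward m mphi')//.
  apply: (@eq_measure_integral _ _ _ _ m (pushforward m mphi')) => A mA _.
  exact: phiE.
- exact/measurable_EFinP.
- exact: integrable_preserving.
Qed.

Lemma ae_preserving (P : T -> Prop) : {ae m, forall x, P x} ->
  {ae m, forall x, P (phi x)}.
Proof.
move=> [N [mN N0 PN]]; exists (phi @^-1` N); split.
- exact: measurable_preimage.
- by have := phiE mN; rewrite N0.
- by move=> x /= Px; apply: PN.
Qed.

End MeasurePreserving.

Section Lebesgue1D.
Variable R : realType.
Local Notation leb := (@lebesgue_measure R).
Local Notation leb2 := (leb \x leb)%E.

Lemma measurable_affine (c k : R) : measurable_fun setT (fun t : R => c + k * t).
Proof.
apply: continuous_measurable_fun => t.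
by apply: cvgD; [exact: cvg_cst|apply: cvgM; [exact: cvg_cst|exact: cvg_id]].
Qed.

(** Lebesgue measure is determined by its values on the intervals ]a, b], which a
    reflection or a translation maps to intervals of the same length. *)
Lemma leb_reflection (c k : R) : k = 1 \/ k = -1 -> forall A, measurable A ->
  leb ((fun t : R => c + k * t) @^-1` A) = leb A.
Proof.
move=> kE A mA; pose phi := fun t : measurableTypeR R => (c + k * t : measurableTypeR R).
have mphi : measurable_fun setT phi by exact: measurable_affine.
pose mphi' : {mfun measurableTypeR R >-> measurableTypeR R} :=
  HB.pack phi (isMeasurableFun.Build _ _ _ _ _ mphi).
apply/esym; apply: (@lebesgue_measure_unique _ (pushforward leb mphi')) => //.
move=> _ [[a b] _ <-].
transitivity (leb (phi @^-1` `]a, b])); last by [].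
case: kE => kE.
- have -> : phi @^-1` `]a, b] = `]a - c, b - c]%classic.
    apply/seteqP; split => t; rewrite /= !in_itv/= /phi kE mul1r => /andP[? ?];
    by apply/andP; split; lra.
  rewrite !lebesgue_measure_itv/= !lte_fin ltrD2r.
  by case: ifP => // _; rewrite -!EFinB; congr EFin; ring.
- have -> : phi @^-1` `]a, b] = `[c - b, c - a[%classic.
    apply/seteqP; split => t; rewrite /= !in_itv/= /phi kE mulN1r => /andP[? ?];
    by apply/andP; split; lra.
  rewrite !lebesgue_measure_itv/= !lte_fin ltrD2l ltrN2.
  by case: ifP => // _; rewrite -!EFinB; congr EFin; ring.
Qed.

Lemma integrable_reflection (c k : R) (f : R -> R) : k = 1 \/ k = -1 ->
  leb.-integrable setT (EFin \o f) ->
  leb.-integrable setT (EFin \o (fun t => f (c + k * t))).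
Proof.
move=> kE; exact: (@integrable_preserving _ (measurableTypeR R) R leb _
  (measurable_affine c k) (leb_reflection c kE)).
Qed.

Lemma Rintegral_reflection (c k : R) (f : R -> R) : k = 1 \/ k = -1 ->
  leb.-integrable setT (EFin \o f) ->
  \int[leb]_t f (c + k * t) = \int[leb]_t f t.
Proof.
move=> kE; exact: (@Rintegral_preserving _ (measurableTypeR R) R leb _
  (measurable_affine c k) (leb_reflection c kE)).
Qed.

Definition plane_reflection (x0 y0 k l : R) (p : R * R) : R * R :=
  (x0 + k * p.1, y0 + l * p.2).

Lemma measurable_plane_reflection x0 y0 k l :
  measurable_fun setT (plane_reflection x0 y0 k l).
Proof.
apply/measurable_fun_pairP; split => /=.
  exact: (measurableT_comp (measurable_affine x0 k) measurable_fst).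
exact: (measurableT_comp (measurable_affine y0 l) measurable_snd).
Qed.

Lemma leb2_plane_reflection x0 y0 (k l : R) : k = 1 \/ k = -1 -> l = 1 \/ l = -1 ->
  forall A, measurable A -> leb2 (plane_reflection x0 y0 k l @^-1` A) = leb2 A.
Proof.
move=> kE lE A mA.
pose phi : measurableTypeR R * measurableTypeR R -> measurableTypeR R * measurableTypeR R :=
  plane_reflection x0 y0 k l.
have mphi : measurable_fun setT phi by exact: measurable_plane_reflection.
pose mphi' : {mfun (measurableTypeR R * measurableTypeR R)%type >->
                   (measurableTypeR R * measurableTypeR R)%type} :=
  HB.pack phi (isMeasurableFun.Build _ _ _ _ _ mphi).
apply/esym; apply: (@product_measure_unique _ _ _ _ _ leb leb (pushforward leb2 mphi')) => //.
move=> B C mB mC.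
transitivity (leb2 (((fun t : R => x0 + k * t) @^-1` B) `*` ((fun t : R => y0 + l * t) @^-1` C))); first by [].
have mB' : measurable ((fun t : R => x0 + k * t) @^-1` B).
  by rewrite -[X in measurable X]setTI; exact: (measurable_affine x0 k).
have mC' : measurable ((fun t : R => y0 + l * t) @^-1` C).
  by rewrite -[X in measurable X]setTI; exact: (measurable_affine y0 l).
rewrite product_measure1E//.
by congr (_ * _)%E; exact: leb_reflection.
Qed.

Lemma integrable_plane_reflection x0 y0 (k l : R) (f : R * R -> R) :
  k = 1 \/ k = -1 -> l = 1 \/ l = -1 ->
  leb2.-integrable setT (EFin \o f) ->
  leb2.-integrable setT (EFin \o (fun p => f (plane_reflection x0 y0 k l p))).
Proof.
move=> kE lE; exact: (@integrable_preserving _ (measurableTypeR R * measurableTypeR R)%type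
  R leb2 _ (measurable_plane_reflection x0 y0 k l) (leb2_plane_reflection x0 y0 kE lE)).
Qed.

Lemma Rintegral_plane_reflection x0 y0 (k l : R) (f : R * R -> R) :
  k = 1 \/ k = -1 -> l = 1 \/ l = -1 ->
  leb2.-integrable setT (EFin \o f) ->
  \int[leb2]_p f (plane_reflection x0 y0 k l p) = \int[leb2]_p f p.
Proof.
move=> kE lE; exact: (@Rintegral_preserving _ (measurableTypeR R * measurableTypeR R)%type
  R leb2 _ (measurable_plane_reflection x0 y0 k l) (leb2_plane_reflection x0 y0 kE lE)).
Qed.

Lemma ae_plane_reflection x0 y0 (k l : R) (P : R * R -> Prop) :
  k = 1 \/ k = -1 -> l = 1 \/ l = -1 ->
  {ae leb2, forall p, P p} -> {ae leb2, forall p, P (plane_reflection x0 y0 k l p)}.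
Proof.
move=> kE lE; exact: (@ae_preserving _ (measurableTypeR R * measurableTypeR R)%type
  R leb2 _ (measurable_plane_reflection x0 y0 k l) (leb2_plane_reflection x0 y0 kE lE)).
Qed.

Lemma measurable_inv : measurable_fun setT (fun t : R => t^-1).
Proof.
have -> : [set: R] = [set~ 0] `|` [set 0] by rewrite setUC setUv.
apply/measurable_funU => //; first exact: measurableC.
split.
  apply: open_continuous_measurable_fun; first by rewrite openC; exact: closed_eq.
  move=> x; rewrite inE/= => /eqP x0; exact: inv_continuous.
move=> _ B mB.
have [B0|B0] := pselect (B (0^-1 : R)).
  rewrite (_ : _ `&` _ = [set 0])//; apply/seteqP; split => [x []//|x /= ->].
  by split.
by rewrite (_ : _ `&` _ = set0)//; apply/seteqP; split => [x [/= -> //]|//].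
Qed.

End Lebesgue1D.

(** * The Dirichlet kernel *)

Section Calculus.
Variable R : realType.
Local Notation leb := (@lebesgue_measure R).

Lemma continuous_integrable (f : R -> R) (a b : R) : continuous f ->
  leb.-integrable `[a, b] (EFin \o f).
Proof.
move=> cf; apply: continuous_compact_integrable; first exact: segment_compact.
exact: continuous_subspaceT.
Qed.

Lemma is_derive_continuous (F f : R -> R) :
  (forall x : R, is_derive x 1 F (f x)) -> continuous F.
Proof.
move=> dF x; apply: differentiable_continuous; apply/derivable1_diffP.
by have := dF x.
Qed.

Lemma is_derive_lipschitz (F f : R -> R) (L x y : R) :
  (forall x : R, is_derive x 1 F (f x)) ->
  (forall t, t \in `]Num.min x y, Num.max x y[ -> `|f t| <= L) ->
  `|F x - F y| <= L * `|x - y|.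
Proof.
move=> dF; have cF := is_derive_continuous dF.
wlog xy : x y / x <= y.
  move=> H fL; case: (leP x y) => [|/ltW] xy; first exact: H.
  by rewrite distrC (distrC x); apply: H => //; rewrite minC maxC.
rewrite min_l// max_r//; case: ltgtP xy => // [xy _ fL|-> _ _]; last first.
  by rewrite !subrr normr0 mulr0.
have [c cxy FE] := MVT xy (fun t _ => dF t) (continuous_subspaceT cF).
rewrite distrC FE normrM (distrC x); apply: ler_wpM2r => //; exact: fL.
Qed.

Lemma Rintegral_derive (F f : R -> R) (a b : R) : a <= b ->
  (forall x : R, is_derive x 1 F (f x)) -> continuous f ->
  \int[leb]_(x in `[a, b]) f x = F b - F a.
Proof.
move=> ab dF cf; have cF := is_derive_continuous dF.
case: ltgtP ab => // [ab _|-> _]; last first.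
  by rewrite set_itv1 Rintegral_set1 subrr.
rewrite /Rintegral (@continuous_FTC2 _ _ F)//=.
- exact: continuous_subspaceT.
- split.
  + by move=> x _; have := dF x.
  + exact/cvg_at_right_filter/cF.
  + exact/cvg_at_left_filter/cF.
- by move=> x _; rewrite derive1E; case: (dF x).
Qed.

(** The Dirichlet kernel of the line.  Its value at t = 0 is 0 and not M, because
    0^-1 = 0; a single point does not matter to the integrals. *)
Definition sinc_kernel (M t : R) : R := sin (M * t) / t.

Lemma continuous_sinM M : continuous (fun t : R => sin (M * t)).
Proof.
move=> t; apply: continuous_comp; last exact: continuous_sin.
by apply: cvgM; [exact: cvg_cst|exact: cvg_id].
Qed.

Lemma continuous_cosM M : continuous (fun t : R => cos (M * t)).
Proof.
move=> t; apply: continuous_comp; last exact: continuous_cos.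
by apply: cvgM; [exact: cvg_cst|exact: cvg_id].
Qed.

Lemma measurable_sinc_kernel M : measurable_fun setT (sinc_kernel M).
Proof.
apply: measurable_funM; last exact: measurable_inv.
by apply: continuous_measurable_fun; exact: continuous_sinM.
Qed.

Lemma sin_le_norm (x : R) : `|sin x| <= `|x|.
Proof.
have := @is_derive_lipschitz sin cos 1 x 0 (fun t => is_derive_sin t).
by rewrite sin0 !subr0 mul1r; apply => t _; rewrite ler_norml cos_geN1 cos_le1.
Qed.

Lemma sinc_kernel_bound M t : `|sinc_kernel M t| <= `|M|.
Proof.
rewrite /sinc_kernel; have [->|t0] := eqVneq t 0.
  by rewrite invr0 mulr0 normr0.
by rewrite normf_div ler_pdivrMr ?normr_gt0// -normrM sin_le_norm.
Qed.

Lemma sinc_kernelN M t : sinc_kernel M (- t) = sinc_kernel M t.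
Proof. by rewrite /sinc_kernel mulrN sinN invrN mulrNN. Qed.

(** This is where Dirichlet kernels come from: averaging the exponential over
    [-M, M] leaves its cosine part. *)
Lemma integral_cosM (M c : R) : 0 <= M -> c != 0 ->
  \int[leb]_(u in `[- M, M]) cos (u * c) = 2 * sinc_kernel M c.
Proof.
move=> M0 c0; pose F (u : R) := sin (u * c) / c.
have dF (x : R) : is_derive x 1 F (cos (x * c)).
  by apply: is_derive_eq; rewrite /GRing.scale/=; field.
rewrite (Rintegral_derive _ dF).
- by rewrite /F mulNr sinN /sinc_kernel; field.
- lra.
- by move=> x; under eq_fun do rewrite mulrC; exact: continuous_cosM.
Qed.

Lemma integral_sinM (M c : R) : 0 <= M ->
  \int[leb]_(u in `[- M, M]) sin (u * c) = 0.
Proof.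
move=> M0; have [->|c0] := eqVneq c 0.
  under eq_Rintegral do rewrite mulr0 sin0.
  by rewrite Rintegral_cst// mul0r.
pose F (u : R) := - (cos (u * c) / c).
have dF (x : R) : is_derive x 1 F (sin (x * c)).
  by apply: is_derive_eq; rewrite /GRing.scale/=; field.
rewrite (Rintegral_derive _ dF).
- by rewrite /F mulNr cosN subrr.
- lra.
- by move=> x; under eq_fun do rewrite mulrC; exact: continuous_sinM.
Qed.

End Calculus.

(** * Tonelli's theorem, Laplace integrals, integration on the line and on the plane *)

Section Tonelli.
Context d1 d2 (T1 : measurableType d1) (T2 : measurableType d2) (R : realType).
Variable m1 : {sigma_finite_measure set T1 -> \bar R}.
Variable m2 : {sigma_finite_measure set T2 -> \bar R}.
Variables (D1 : set T1) (D2 : set T2) (f : T1 * T2 -> R).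
Hypotheses (mD1 : measurable D1) (mD2 : measurable D2).
Hypothesis mf : measurable_fun setT f.

Let g := (EFin \o f) \_ (D1 `*` D2).

Let mg : measurable_fun setT g.
Proof.
apply/(measurable_restrictT _ _).1; first exact: measurableX.
by apply: measurable_funTS; exact/measurable_EFinP.
Qed.

Lemma integrable_rectangle12 :
  (\int[m1]_(x in D1) \int[m2]_(y in D2) `|f (x, y)|%:E < +oo)%E ->
  (m1 \x m2)%E.-integrable (D1 `*` D2) (EFin \o f).
Proof.
move=> fi; apply/(integrable_mkcond _ _).2; first exact: measurableX.
apply/(integrable12ltyP m1 m2 mg); apply: le_lt_trans fi.
rewrite [leRHS]integral_mkcond le_eqVlt; apply/orP; left; apply/eqP.
apply: eq_integral => x _; rewrite patchE; case: ifPn => [/set_mem D1x|D1x].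
  rewrite [RHS]integral_mkcond; apply: eq_integral => y _.
  rewrite /g !patchE; case: (boolP (y \in D2)) => [/set_mem D2y|/negP D2y].
    by rewrite mem_set.
  by rewrite memNset ?abse0// => -[_ /= /mem_set].
apply: integral0_eq => y _; rewrite /g patchE memNset ?abse0// => -[/= /mem_set].
by rewrite (negbTE D1x).
Qed.

Lemma integrable_rectangle21 :
  (\int[m2]_(y in D2) \int[m1]_(x in D1) `|f (x, y)|%:E < +oo)%E ->
  (m1 \x m2)%E.-integrable (D1 `*` D2) (EFin \o f).
Proof.
move=> fi; apply/(integrable_mkcond _ _).2; first exact: measurableX.
apply/(integrable21ltyP m1 m2 mg); apply: le_lt_trans fi.
rewrite [leRHS]integral_mkcond le_eqVlt; apply/orP; left; apply/eqP.
apply: eq_integral => y _; rewrite patchE; case: ifPn => [/set_mem D2y|D2y].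
  rewrite [RHS]integral_mkcond; apply: eq_integral => x _.
  rewrite /g !patchE; case: (boolP (x \in D1)) => [/set_mem D1x|/negP D1x].
    by rewrite mem_set.
  by rewrite memNset ?abse0// => -[/= /mem_set].
apply: integral0_eq => x _; rewrite /g patchE memNset ?abse0// => -[_ /= /mem_set].
by rewrite (negbTE D2y).
Qed.

End Tonelli.

Section ProductIntegrand.
Context d1 d2 (T1 : measurableType d1) (T2 : measurableType d2) (R : realType).
Variable m1 : {sigma_finite_measure set T1 -> \bar R}.
Variable m2 : {sigma_finite_measure set T2 -> \bar R}.

Lemma integrable_tensor (D1 : set T1) (D2 : set T2) (f : T1 -> R) (g : T2 -> R) :
  measurable D1 -> measurable D2 ->
  measurable_fun setT f -> measurable_fun setT g ->
  m1.-integrable D1 (EFin \o f) -> m2.-integrable D2 (EFin \o g) ->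
  (m1 \x m2)%E.-integrable (D1 `*` D2) (EFin \o (fun p => f p.1 * g p.2)).
Proof.
move=> mD1 mD2 mf mg /integrableP[_ fi] /integrableP[_ gi].
apply: integrable_rectangle12 => //.
  by apply: measurable_funM; [exact: (measurableT_comp mf measurable_fst)
                             |exact: (measurableT_comp mg measurable_snd)].
under eq_integral => x _.
  under eq_integral do rewrite /= normrM EFinM.
  rewrite ge0_integralZl_EFin//; last first.
    apply/measurable_EFinP; apply: measurableT_comp => //.
    exact: measurable_funTS.
  over.
rewrite ge0_integralZr//.
- by rewrite lte_mul_pinfty// ?integral_ge0// ge0_fin_numE// integral_ge0.
- apply/measurable_EFinP; apply: measurableT_comp => //.
  exact: measurable_funTS.
- exact: integral_ge0.
Qed.

End ProductIntegrand.

Section Dirichlet.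
Variable R : realType.
Local Notation leb := (@lebesgue_measure R).

Lemma integral0y_expRN (a : R) : 0 < a ->
  (\int[leb]_(y in `[0%R, +oo[) (expR (- a * y))%:E = (a^-1)%:E)%E.
Proof.
move=> a0; pose F y := - (expR (- a * y) / a).
have dF (x : R) : is_derive x 1 F (expR (- a * x)).
  by apply: is_derive_eq; rewrite /GRing.scale/=; field; lra.
have cF := is_derive_continuous dF.
have cE : continuous (fun y : R => expR (- a * y)).
  move=> t; apply: continuous_comp; last exact: continuous_expR.
  by apply: cvgM; [exact: cvg_cst|exact: cvg_id].
have F0 : F x @[x --> +oo] --> 0.
  rewrite (_ : 0 = - (0 / a)); last by rewrite mul0r oppr0.
  apply: cvgN; apply: cvgM; last exact: cvg_cst.
  under eq_fun do rewrite mulNr.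
  apply: (cvg_comp (fun x => a * x) (fun x => expR (- x))); last exact: cvgr_expR.
  exact: gt0_cvgMry.
rewrite (ge0_continuous_FTC2y (fun x _ => expR_ge0 _) (continuous_subspaceT cE) F0
  (fun x _ => @ex_derive _ _ _ _ _ _ _ (dF x)) (cvg_at_right_filter (cF 0))).
  by rewrite /F mulr0 expR0 sub0e -EFinN opprK mul1r.
by move=> x _; rewrite derive1E; case: (dF x).
Qed.

Lemma integral0y_cauchy (M : R) : 0 < M ->
  (\int[leb]_(y in `[0%R, +oo[) (M / (M ^+ 2 + y ^+ 2))%:E = (pi / 2)%:E)%E.
Proof.
move=> M0; pose F y := atan (y / M).
have M2 (y : R) : 0 < M ^+ 2 + y ^+ 2 by rewrite ltr_pwDl ?sqr_ge0// exprn_gt0.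
have dF (x : R) : is_derive x 1 F (M / (M ^+ 2 + x ^+ 2)).
  apply: is_derive_eq; rewrite /GRing.scale/=; field.
  by rewrite !lt0r_neq0// M2.
have cF := is_derive_continuous dF.
have cE : continuous (fun y : R => M / (M ^+ 2 + y ^+ 2)).
  move=> t; apply: cvgM; first exact: cvg_cst.
  apply: cvgV; first by rewrite lt0r_neq0// M2.
  by apply: cvgD; [exact: cvg_cst|exact: exprn_continuous].
have F0 : F x @[x --> +oo] --> pi / 2.
  apply: (cvg_comp (fun x => x / M) atan); last exact: cvgy_atan.
  by apply: gt0_cvgMly => //; rewrite invr_gt0.
have f0 (x : R) : 0 <= x -> 0 <= M / (M ^+ 2 + x ^+ 2) by move=> _; rewrite divr_ge0// ltW.
rewrite (ge0_continuous_FTC2y f0 (continuous_subspaceT cE) F0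
  (fun x _ => @ex_derive _ _ _ _ _ _ _ (dF x)) (cvg_at_right_filter (cF 0))).
  by rewrite /F mul0r atan0 sube0.
by move=> x _; rewrite derive1E; case: (dF x).
Qed.

Lemma integral_damped_sin (M y A : R) : 0 < M -> 0 <= A ->
  \int[leb]_(t in `[0, A]) (expR (- t * y) * sin (M * t)) =
  (M - expR (- A * y) * (M * cos (M * A) + y * sin (M * A))) / (M ^+ 2 + y ^+ 2).
Proof.
move=> M0 A0.
have M2 : 0 < M ^+ 2 + y ^+ 2 by rewrite ltr_pwDl ?sqr_ge0// exprn_gt0.
pose F t := - (expR (- t * y) * (M * cos (M * t) + y * sin (M * t)) / (M ^+ 2 + y ^+ 2)).
have dF (x : R) : is_derive x 1 F (expR (- x * y) * sin (M * x)).
  apply: is_derive_eq; rewrite /GRing.scale/=; field.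
  by rewrite lt0r_neq0// M2.
rewrite (Rintegral_derive A0 dF).
  rewrite /F !mulr0 oppr0 mul0r expR0 cos0 sin0; field.
  by rewrite lt0r_neq0// M2.
move=> t; apply: cvgM; last exact: continuous_sinM.
apply: continuous_comp; last exact: continuous_expR.
by apply: cvgM; [apply: cvgN; exact: cvg_id|exact: cvg_cst].
Qed.

End Dirichlet.

(** The statements above at the Lebesgue measures of the line and of the plane;
    here the Borel sigma-algebra on R is fixed once and for all. *)
Section PlaneFubini.
Variable R : realType.
Local Notation leb := (@lebesgue_measure R).
Local Notation leb2 := (leb \x leb)%E.
Local Notation mR := (measurableTypeR R).

Section rectangle.
Variables (D1 D2 : set R) (f : R * R -> R).
Hypotheses (mD1 : measurable D1) (mD2 : measurable D2).
Hypothesis fi : leb2.-integrable (D1 `*` D2) (EFin \o f).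

Lemma plane_Rintegral12 : \int[leb2]_(p in D1 `*` D2) f p =
  \int[leb]_(x in D1) \int[leb]_(y in D2) f (x, y).
Proof. exact: (@Rintegral12 _ _ mR mR R leb leb D1 D2 f mD1 mD2 fi). Qed.

Lemma plane_Rintegral21 : \int[leb2]_(p in D1 `*` D2) f p =
  \int[leb]_(y in D2) \int[leb]_(x in D1) f (x, y).
Proof. exact: (@Rintegral21 _ _ mR mR R leb leb D1 D2 f mD1 mD2 fi). Qed.

Lemma plane_integrable_Rintegral1 :
  leb.-integrable D1 (EFin \o (fun x => \int[leb]_(y in D2) f (x, y))).
Proof. exact: (@integrable_Rintegral1 _ _ mR mR R leb leb D1 D2 f mD1 mD2 fi). Qed.

Lemma plane_integrable_Rintegral2 :
  leb.-integrable D2 (EFin \o (fun y => \int[leb]_(x in D1) f (x, y))).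
Proof. exact: (@integrable_Rintegral2 _ _ mR mR R leb leb D1 D2 f mD1 mD2 fi). Qed.

Lemma plane_ae_integrable_section1 :
  {ae leb, forall x, D1 x -> leb.-integrable D2 (EFin \o (fun y => f (x, y)))}.
Proof. exact: (@ae_integrable_section1 _ _ mR mR R leb leb D1 D2 f mD1 mD2 fi). Qed.

End rectangle.

Lemma plane_ae_product1 (P : R * R -> Prop) : {ae leb2, forall p, P p} ->
  {ae leb, forall x, {ae leb, forall y, P (x, y)}}.
Proof. exact: (@ae_product1 _ _ mR mR R leb leb P). Qed.

Lemma plane_ae_product2 (P : R * R -> Prop) : {ae leb2, forall p, P p} ->
  {ae leb, forall y, {ae leb, forall x, P (x, y)}}.
Proof. exact: (@ae_product2 _ _ mR mR R leb leb P). Qed.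

Lemma line_ae_imply (P Q : R -> Prop) :
  (forall x, P x -> Q x) -> {ae leb, forall x, P x} -> {ae leb, forall x, Q x}.
Proof. exact: (@ae_imply _ mR R leb). Qed.

Lemma line_ae_imply2 (P Q S : R -> Prop) :
  (forall x, P x -> Q x -> S x) -> {ae leb, forall x, P x} ->
  {ae leb, forall x, Q x} -> {ae leb, forall x, S x}.
Proof. exact: (@ae_imply2 _ mR R leb). Qed.

Lemma plane_ae_imply2 (P Q S : R * R -> Prop) :
  (forall x, P x -> Q x -> S x) -> {ae leb2, forall x, P x} ->
  {ae leb2, forall x, Q x} -> {ae leb2, forall x, S x}.
Proof. exact: (@ae_imply2 _ (mR * mR)%type R leb2). Qed.

Lemma plane_ae_imply (P Q : R * R -> Prop) :
  (forall x, P x -> Q x) -> {ae leb2, forall x, P x} -> {ae leb2, forall x, Q x}.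
Proof. exact: (@ae_imply _ (mR * mR)%type R leb2). Qed.

Lemma line_integrableS (D E : set R) (f : R -> R) : measurable E -> measurable D ->
  D `<=` E -> leb.-integrable E (EFin \o f) -> leb.-integrable D (EFin \o f).
Proof. exact: (@integrableS _ mR R leb E D (EFin \o f)). Qed.

Lemma plane_integrableS (D E : set (R * R)) (f : R * R -> R) :
  measurable E -> measurable D ->
  D `<=` E -> leb2.-integrable E (EFin \o f) -> leb2.-integrable D (EFin \o f).
Proof. exact: (@integrableS _ (mR * mR)%type R leb2 E D (EFin \o f)). Qed.

Lemma plane_integrable_tensor (D1 D2 : set R) (f g : R -> R) :
  measurable D1 -> measurable D2 ->
  measurable_fun setT f -> measurable_fun setT g ->
  leb.-integrable D1 (EFin \o f) -> leb.-integrable D2 (EFin \o g) ->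
  leb2.-integrable (D1 `*` D2) (EFin \o (fun p => f p.1 * g p.2)).
Proof. exact: (@integrable_tensor _ _ mR mR R leb leb). Qed.

Lemma plane_integrable_bounded_mul (D : set (R * R)) (h f : R * R -> R) (B : R) :
  measurable D -> measurable_fun D h -> (forall x, D x -> `|h x| <= B) ->
  leb2.-integrable D (EFin \o f) -> leb2.-integrable D (EFin \o (fun x => h x * f x)).
Proof. exact: (@integrable_bounded_mul _ (mR * mR)%type R leb2). Qed.

Lemma line_integrable_bounded_mul (D : set R) (h f : R -> R) (B : R) :
  measurable D -> measurable_fun D h -> (forall x, D x -> `|h x| <= B) ->
  leb.-integrable D (EFin \o f) -> leb.-integrable D (EFin \o (fun x => h x * f x)).
Proof. exact: (@integrable_bounded_mul _ mR R leb). Qed.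

Lemma line_bounded_integrable (D : set R) (f : R -> R) (B : R) :
  measurable D -> (leb D < +oo)%E -> measurable_fun D f ->
  (forall x, D x -> `|f x| <= B) -> leb.-integrable D (EFin \o f).
Proof. exact: (@bounded_integrable _ mR R leb). Qed.

Lemma line_le_norm_weight (D : set R) (h f : R -> R) (B : R) :
  measurable D -> measurable_fun D h -> (forall x, D x -> `|h x| <= B) ->
  leb.-integrable D (EFin \o f) ->
  `|\int[leb]_(x in D) (h x * f x)| <= B * \int[leb]_(x in D) `|f x|.
Proof. exact: (@le_norm_Rintegral_weight _ mR R leb). Qed.

Lemma plane_integrable_rectangle12 (D1 D2 : set R) (f : R * R -> R) :
  measurable D1 -> measurable D2 -> measurable_fun setT f ->
  (\int[leb]_(x in D1) \int[leb]_(y in D2) `|f (x, y)|%:E < +oo)%E ->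
  leb2.-integrable (D1 `*` D2) (EFin \o f).
Proof. exact: (@integrable_rectangle12 _ _ mR mR R leb leb). Qed.

Lemma plane_integrable_rectangle21 (D1 D2 : set R) (f : R * R -> R) :
  measurable D1 -> measurable D2 -> measurable_fun setT f ->
  (\int[leb]_(y in D2) \int[leb]_(x in D1) `|f (x, y)|%:E < +oo)%E ->
  leb2.-integrable (D1 `*` D2) (EFin \o f).
Proof. exact: (@integrable_rectangle21 _ _ mR mR R leb leb). Qed.

Lemma line_integrableB (D : set R) (f g : R -> R) : measurable D ->
  leb.-integrable D (EFin \o f) -> leb.-integrable D (EFin \o g) ->
  leb.-integrable D (EFin \o (fun x => f x - g x)).
Proof. by move=> mD fi gi; exact: (@integrableB _ mR R leb D mD (EFin \o f) (EFin \o g) fi gi). Qed.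

Lemma line_integrableZ (D : set R) (k : R) (f : R -> R) : measurable D ->
  leb.-integrable D (EFin \o f) -> leb.-integrable D (EFin \o (fun x => k * f x)).
Proof. by move=> mD; exact: (@integrableZl _ mR R leb D mD k (EFin \o f)). Qed.

Lemma line_eq_integrable (D : set R) (f g : R -> R) : measurable D ->
  (forall x, D x -> f x = g x) ->
  leb.-integrable D (EFin \o f) -> leb.-integrable D (EFin \o g).
Proof.
move=> mD fg; apply: (@eq_integrable _ mR R leb D mD) => x /set_mem Dx /=.
by rewrite fg.
Qed.

Lemma plane_integrableD (D : set (R * R)) (f g : (R * R) -> R) : measurable D ->
  leb2.-integrable D (EFin \o f) -> leb2.-integrable D (EFin \o g) ->
  leb2.-integrable D (EFin \o (fun x => f x + g x)).
Proof. by move=> mD fi gi; exact: (@integrableD _ (mR * mR)%type R leb2 D mD (EFin \o f) (EFin \o g) fi gi). Qed.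

Lemma plane_integrableB (D : set (R * R)) (f g : (R * R) -> R) : measurable D ->
  leb2.-integrable D (EFin \o f) -> leb2.-integrable D (EFin \o g) ->
  leb2.-integrable D (EFin \o (fun x => f x - g x)).
Proof. by move=> mD fi gi; exact: (@integrableB _ (mR * mR)%type R leb2 D mD (EFin \o f) (EFin \o g) fi gi). Qed.

Lemma plane_eq_integrable (D : set (R * R)) (f g : (R * R) -> R) : measurable D ->
  (forall x, D x -> f x = g x) ->
  leb2.-integrable D (EFin \o f) -> leb2.-integrable D (EFin \o g).
Proof.
move=> mD fg; apply: (@eq_integrable _ (mR * mR)%type R leb2 D mD) => x /set_mem Dx /=.
by rewrite fg.
Qed.

Lemma plane_RintegralD (D : set (R * R)) (f g : (R * R) -> R) : measurable D ->
  leb2.-integrable D (EFin \o f) -> leb2.-integrable D (EFin \o g) ->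
  \int[leb2]_(x in D) (f x + g x) = \int[leb2]_(x in D) f x + \int[leb2]_(x in D) g x.
Proof. exact: (@RintegralD _ (mR * mR)%type R leb2 D). Qed.

End PlaneFubini.

(** * The Dirichlet integral *)

Section DirichletIntegral.
Variable R : realType.
Local Notation leb := (@lebesgue_measure R).
Local Notation leb2 := (leb \x leb)%E.

Lemma ge0_integrable_value d (T : measurableType d) (m : {measure set T -> \bar R})
    (D : set T) (f : T -> R) (l : R) : measurable D -> measurable_fun D f ->
  (forall x, D x -> 0 <= f x) -> (\int[m]_(x in D) (f x)%:E = l%:E)%E ->
  m.-integrable D (EFin \o f).
Proof.
move=> mD mf f0 fl; apply/integrableP; split; first exact/measurable_EFinP.
under eq_integral => x /set_mem Dx do rewrite gee0_abs ?lee_fin ?f0//.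
by rewrite fl ltry.
Qed.

Lemma continuous_expRM (a : R) : continuous (fun y : R => expR (a * y)).
Proof.
by move=> t; apply: continuous_comp; [exact: mulrl_continuous|exact: continuous_expR].
Qed.

Lemma sinc_kernel_integrable M (D : set R) : measurable D -> (leb D < +oo)%E ->
  leb.-integrable D (EFin \o sinc_kernel M).
Proof.
move=> mD Dfin; apply: measurable_bounded_integrable => //.
  by apply: measurable_funTS; exact: measurable_sinc_kernel.
exists `|M|; split; first exact: num_real.
by move=> x Mx t _ /=; rewrite (le_trans (sinc_kernel_bound _ _))// ltW.
Qed.

Let f M (p : R * R) := expR (- p.1 * p.2) * sin (M * p.1).

Let mf M : measurable_fun setT (f M).
Proof.
apply: measurable_funM.
  apply: measurableT_comp => //; apply: measurable_funM => //.
  exact: measurableT_comp.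
have ms : measurable_fun setT (fun t : R => sin (M * t)).
  by apply: continuous_measurable_fun; exact: continuous_sinM.
exact: (measurableT_comp ms measurable_fst).
Qed.

(** The value at A of the primitive of e^(-t y) sin (M t) in t, up to sign. *)
Let remainder (M A y : R) : R :=
  expR (- A * y) * (M * cos (M * A) + y * sin (M * A)) / (M ^+ 2 + y ^+ 2).

Let remainder_bound M A y : 0 < M -> 0 <= y ->
  `|remainder M A y| <= 2 / M * expR (- A * y).
Proof.
move=> M0 y0; have M2 : 0 < M ^+ 2 + y ^+ 2 by rewrite ltr_pwDl ?sqr_ge0// exprn_gt0.
rewrite /remainder -mulrA normrM (ger0_norm (expR_ge0 _)) mulrC ler_wpM2r ?expR_ge0//.
rewrite normf_div (gtr0_norm M2) ler_pdivrMr//.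
apply: (@le_trans _ _ (M + y)).
  rewrite (le_trans (ler_normD _ _))// !normrM lerD//.
    by rewrite (gtr0_norm M0) ler_piMr ?(ltW M0)// ler_norml cos_geN1 cos_le1.
  by rewrite (ger0_norm y0) ler_piMr// ler_norml sin_geN1 sin_le1.
(* M (M + y) <= 2 (M^2 + y^2) *)
rewrite mulrAC ler_pdivlMr//; nra.
Qed.

(** Write 1/t as the integral of e^(-t y) over y >= 0 and exchange the integrals:
    the integral in t is elementary and equals M / (M^2 + y^2) minus [remainder].
    The first term integrates to pi/2 and the second is at most
    (2/M) e^(-A y), of integral 2 / (M A). *)
Lemma sinc_integral_estimate M A : 0 < M -> 0 < A ->
  `|\int[leb]_(t in `]0, A]) sinc_kernel M t - pi / 2| <= 2 / (M * A).
Proof.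
move=> M0 A0; have M2 (y : R) : 0 < M ^+ 2 + y ^+ 2.
  by rewrite ltr_pwDl ?sqr_ge0// exprn_gt0.
have expi (t : R) : 0 < t -> leb.-integrable `[0, +oo[ (EFin \o (fun y => expR (- t * y))).
  move=> t0; apply: (ge0_integrable_value (l := t^-1)) => //.
  - apply: measurable_funTS; apply: continuous_measurable_fun.
    exact: continuous_expRM.
  - by rewrite integral0y_expRN.
have fi : leb2.-integrable (`]0, A] `*` `[0, +oo[) (EFin \o f M).
  apply: integrable_rectangle12 => //; first exact: mf.
  apply: (@le_lt_trans _ _ (\int[leb]_(t in `]0%R, A]) `|sinc_kernel M t|%:E)%E).
    rewrite le_eqVlt; apply/orP; left; apply/eqP; apply: eq_integral => t.
    rewrite inE/= in_itv/= => /andP[t0 _].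
    under eq_integral do rewrite /f /= normrM (ger0_norm (expR_ge0 _)) EFinM.
    rewrite ge0_integralZr//.
    - rewrite integral0y_expRN// -EFinM /sinc_kernel normrM (gtr0_norm (x := t^-1)) 1?mulrC//.
      by rewrite invr_gt0.
    - apply: measurable_funTS; apply/measurable_EFinP; apply: continuous_measurable_fun.
      exact: continuous_expRM.
  have Afin : (leb `]0%R, A] < +oo)%E.
    by rewrite lebesgue_measure_itv/= lte_fin A0 -EFinB ltry.
  by have /integrableP[] := sinc_kernel_integrable M (measurable_itv _) Afin.
have <- : \int[leb]_(y in `[0, +oo[) (M / (M ^+ 2 + y ^+ 2)) = pi / 2.
  by rewrite /Rintegral integral0y_cauchy.
have -> : \int[leb]_(t in `]0, A]) sinc_kernel M t =
    \int[leb]_(t in `]0, A]) \int[leb]_(y in `[0, +oo[) f M (t, y).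
  apply: eq_Rintegral => t; rewrite inE/= in_itv/= => /andP[t0 _].
  rewrite /f/= RintegralZr//; last exact: expi.
  by rewrite /Rintegral integral0y_expRN//= /sinc_kernel mulrC.
rewrite -Rintegral12// Rintegral21//.
have cauchyi : leb.-integrable `[0, +oo[ (EFin \o (fun y => M / (M ^+ 2 + y ^+ 2))).
  apply: (ge0_integrable_value (l := pi / 2)) => //.
  - apply: measurable_funTS; apply: continuous_measurable_fun => t.
    apply: cvgM; first exact: cvg_cst.
    apply: cvgV; first by rewrite lt0r_neq0// M2.
    by apply: cvgD; [exact: cvg_cst|exact: exprn_continuous].
  - by move=> x _; rewrite divr_ge0// ltW.
  - by rewrite integral0y_cauchy.
have innerE y : \int[leb]_(t in `]0, A]) f M (t, y) =
    M / (M ^+ 2 + y ^+ 2) - remainder M A y.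
  have cfy : continuous (fun t => f M (t, y)).
    move=> t; apply: cvgM; last exact: continuous_sinM.
    apply: continuous_comp; last exact: continuous_expR.
    by apply: cvgM; [apply: cvgN; exact: cvg_id|exact: cvg_cst].
  rewrite Rintegral_itv_obnd_cbnd.
    rewrite /f/= integral_damped_sin ?(ltW A0)// /remainder; field.
    by rewrite lt0r_neq0.
  apply: integrableS (@continuous_integrable R _ 0 A cfy) => //.
  by apply: subset_itvr; rewrite bnd_simp.
under eq_Rintegral do rewrite innerE.
have remi : leb.-integrable `[0, +oo[ (EFin \o remainder M A).
  apply: (le_integrable _ _ _ (integrableZl _ (2 / M) (expi A A0))) => //.
    apply/measurable_EFinP; apply: measurable_funTS; apply: continuous_measurable_fun.
    move=> t; apply: cvgM.
      apply: cvgM; first exact: continuous_expRM.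
      by apply: cvgD; [exact: cvg_cst|apply: cvgM; [exact: cvg_id|exact: cvg_cst]].
    apply: cvgV; first by rewrite lt0r_neq0// M2.
    by apply: cvgD; [exact: cvg_cst|exact: exprn_continuous].
  move=> y /=; rewrite in_itv/= andbT => y0.
  rewrite lee_fin (le_trans (remainder_bound _ M0 y0))//.
  by rewrite ler_norm.
rewrite RintegralB// addrAC subrr add0r normrN.
apply: (le_trans (le_normr_Rintegral _ remi)) => //.
apply: (@le_trans _ _ (\int[leb]_(y in `[0, +oo[) (2 / M * expR (- A * y)))).
  apply: le_Rintegral => //.
  - exact: integrable_norm.
  - exact: (integrableZl _ (2 / M) (expi A A0)).
  - move=> y /=; rewrite in_itv/= andbT => y0; exact: remainder_bound.
rewrite RintegralZl//; last exact: expi.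
by rewrite /Rintegral integral0y_expRN//= invfM mulrA.
Qed.

End DirichletIntegral.

(** * Bounds on integrals of the Dirichlet kernel; shift by half a period *)

Section SincBounds.
Variable R : realType.
Local Notation leb := (@lebesgue_measure R).

Lemma leb_itv_lty (a b : R) (x y : bool) :
  (leb [set` Interval (BSide x a) (BSide y b)] < +oo)%E.
Proof. by rewrite lebesgue_measure_itv/=; case: ifP => _; rewrite -?EFinB ltry. Qed.

Lemma fine_leb_itv (a b : R) (x y : bool) : a <= b ->
  fine (leb [set` Interval (BSide x a) (BSide y b)]) = b - a.
Proof.
move=> ab; rewrite lebesgue_measure_itv/= lte_fin.
by case: ltP => [_//|ba]; apply/esym/eqP; rewrite subr_eq0 eq_le ab ba.
Qed.

Lemma Rintegral_cst_oc (a b r : R) : a <= b ->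
  \int[leb]_(_ in `]a, b]) r = r * (b - a).
Proof.
by move=> ab; rewrite Rintegral_cst//; congr (_ * _); exact: fine_leb_itv.
Qed.

(** If M A <= 1 the kernel is at most M on an interval of length A; otherwise the
    integral is at distance at most 2 from pi/2 < 2. *)
Lemma sinc_integral0_bound M A : 0 < M -> 0 <= A ->
  `|\int[leb]_(t in `]0, A]) sinc_kernel M t| <= 4.
Proof.
move=> M0; rewrite le_eqVlt => /predU1P[<-|A0].
  by rewrite set_itv_ge ?bnd_simp// Rintegral_set0 normr0.
have ki := sinc_kernel_integrable M (measurable_itv _) (leb_itv_lty 0 A false false).
have [MA|MA] := leP (M * A) 1.
  apply: (le_trans (le_normr_Rintegral _ ki)) => //.
  apply: (@le_trans _ _ (\int[leb]_(t in `]0, A]) M)).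
    apply: le_Rintegral => //; first exact: integrable_norm.
      by apply: (bounded_integrable (B := `|M|)) => //; exact: leb_itv_lty.
    by move=> x _; rewrite (le_trans (sinc_kernel_bound _ _))// gtr0_norm.
  rewrite Rintegral_cst_oc ?ltW// subr0; lra.
have := sinc_integral_estimate M0 A0.
have : 2 / (M * A) <= 2 by rewrite ler_pdivrMr ?mulr_gt0//; lra.
have := @pi_ge0 R; have := @pihalf_lt2 R.
move=> pi2 pi0 h1 /ler_normlP[h2 h3]; rewrite ler_norml; apply/andP; split; lra.
Qed.

Lemma sinc_integralB M a b : 0 <= a -> a <= b ->
  \int[leb]_(t in `]a, b]) sinc_kernel M t =
  \int[leb]_(t in `]0, b]) sinc_kernel M t - \int[leb]_(t in `]0, a]) sinc_kernel M t.
Proof.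
move=> a0 ab; rewrite Rintegral_itvB ?bnd_simp//.
exact: sinc_kernel_integrable (measurable_itv _) (leb_itv_lty 0 b false false).
Qed.

Lemma sinc_integral_bound M a b : 0 < M -> 0 <= a -> a <= b ->
  `|\int[leb]_(t in `]a, b]) sinc_kernel M t| <= 8.
Proof.
move=> M0 a0 ab; rewrite sinc_integralB// (le_trans (ler_normB _ _))//.
have := sinc_integral0_bound M0 a0.
have := sinc_integral0_bound M0 (le_trans a0 ab); lra.
Qed.

Lemma sinc_integral_tail_bound M d a b : 0 < M -> 0 < d -> d <= a -> a <= b ->
  `|\int[leb]_(t in `]a, b]) sinc_kernel M t| <= 4 / (M * d).
Proof.
move=> M0 d0 da ab; have a0 : 0 < a by lra. have b0 : 0 < b by lra.
rewrite sinc_integralB// ?(ltW a0)//.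
have := sinc_integral_estimate M0 a0; have := sinc_integral_estimate M0 b0.
have H c : d <= c -> 2 / (M * c) <= 2 / (M * d).
  by move=> dc; rewrite ler_pM2l// lef_pV2 ?posrE ?mulr_gt0 ?ler_pM2l//; lra.
have := H _ da; have := H _ (le_trans da ab).
move=> ? ? /ler_normlP[? ?] /ler_normlP[? ?].
by rewrite ler_norml; apply/andP; split; lra.
Qed.

End SincBounds.

Section RiemannLebesgue.
Variable R : realType.
Local Notation leb := (@lebesgue_measure R).

Lemma integrable_sinM (f : R -> R) (D : set R) M : measurable D ->
  leb.-integrable D (EFin \o f) ->
  leb.-integrable D (EFin \o (fun t => sin (M * t) * f t)).
Proof.
move=> mD fi; apply: (integrable_bounded_mul (B := 1)) => //.
  by apply: measurable_funTS; apply: continuous_measurable_fun; exact: continuous_sinM.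
by move=> x _; rewrite ler_norml sin_geN1 sin_le1.
Qed.

(** Shifting by pi/M changes the sign of sin (M t); hence twice the integral is
    the integral of the sine against f - f (pi/M + .). *)
Lemma RL_shift (f : R -> R) M : 0 < M -> leb.-integrable setT (EFin \o f) ->
  `|\int[leb]_t (sin (M * t) * f t)| <= \int[leb]_t `|f t - f (pi / M + t)|.
Proof.
move=> M0 fi; pose tau (t : R) := pi / M + 1 * t.
have gi := integrable_sinM M measurableT fi.
have fti : leb.-integrable setT (EFin \o (fun t => f (tau t))).
  exact: (integrable_reflection _ (or_introl (erefl 1)) fi).
have sE : \int[leb]_t (sin (M * t) * f t) = - \int[leb]_t (sin (M * t) * f (tau t)).
  rewrite -(Rintegral_reflection (pi / M) (or_introl (erefl 1)) gi).
  rewrite -mulN1r -RintegralZl//; last exact: (integrable_sinM M measurableT fti).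
  apply: eq_Rintegral => t _.
  rewrite mulrDr [M * (pi / M)]mulrCA divff ?lt0r_neq0// mulr1 mul1r addrC.
  by rewrite sinDpi /tau mul1r mulN1r mulNr addrC.
have : 2 * \int[leb]_t (sin (M * t) * f t) = \int[leb]_t (sin (M * t) * (f t - f (tau t))).
  under [RHS]eq_Rintegral do rewrite mulrBr.
  rewrite RintegralB//; last exact: (integrable_sinM M measurableT fti).
  by rewrite -sE; ring.
have di : leb.-integrable setT (EFin \o (fun t => f t - f (tau t))).
  exact: (integrableB measurableT fi fti).
have di' := integrable_norm di.
move=> H; have : `|2 * \int[leb]_t (sin (M * t) * f t)| <= \int[leb]_t `|f t - f (pi / M + t)|.
  rewrite H; apply: (le_trans (le_normr_Rintegral _ (integrable_sinM M measurableT di))) => //.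
  have -> : \int[leb]_t `|f t - f (pi / M + t)| = \int[leb]_t `|f t - f (tau t)|.
    by apply: eq_Rintegral => t _; rewrite /tau mul1r.
  apply: le_Rintegral => //; first exact: (integrable_norm (integrable_sinM M measurableT di)).
  by move=> t _; rewrite normrM ler_piMl// ler_norml sin_geN1 sin_le1.
rewrite normrM ger0_norm//; have := normr_ge0 (\int[leb]_t (sin (M * t) * f t)); lra.
Qed.

End RiemannLebesgue.

(** * The Riemann-Lebesgue lemma on the line *)

Section RiemannLebesgue2.
Variable R : realType.
Local Notation leb := (@lebesgue_measure R).

Lemma patch_itv_translate (g : R -> R) (a b t : R) (h : R^nat) : continuous g ->
  t != a -> t != b -> h n @[n --> \oo] --> 0 ->
  (g \_ `[a, b]) (h n + t) @[n --> \oo] --> (g \_ `[a, b]) t.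
Proof.
move=> cg ta tb h0.
have ht : h n + t @[n --> \oo] --> t.
  by rewrite -[X in _ --> X]add0r; apply: cvgD => //; exact: cvg_cst.
have [tab|tab] := boolP (t \in `]a, b[).
  have nt : \forall n \near \oo, h n + t \in `]a, b[.
    exact: (ht _ (near_in_itvoo tab)).
  have -> : (g \_ `[a, b]) t = g t.
    by rewrite patchE mem_set//=; exact: subset_itv_oo_cc tab.
  apply: cvg_trans (cvg_comp _ _ ht (cg t)).
  apply: near_eq_cvg; near=> n.
  have nab : h n + t \in `]a, b[ by near: n.
  by rewrite patchE mem_set//=; exact: subset_itv_oo_cc nab.
have tout : t < a \/ b < t.
  move: tab; rewrite in_itv/= negb_and -!leNgt => /orP[|] H; [left|right];
    by rewrite lt_neqAle H ?ta// eq_sym tb.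
have -> : (g \_ `[a, b]) t = 0.
  rewrite patchE memNset//= in_itv/= => /andP[]; case: tout; lra.
apply: cvg_near_cst.
case: tout => tout.
  have nt : \forall n \near \oo, h n + t < a.
    by move/cvgrPdist_lt : ht => /(_ (a - t)); rewrite subr_gt0 => /(_ tout);
       apply: filterS => n; rewrite ltr_norml => /andP[]; lra.
  near=> n; have nab : h n + t < a by near: n.
  by rewrite patchE memNset//= in_itv/= => /andP[]; lra.
have nt : \forall n \near \oo, b < h n + t.
  by move/cvgrPdist_lt : ht => /(_ (t - b)); rewrite subr_gt0 => /(_ tout);
     apply: filterS => n; rewrite ltr_norml => /andP[]; lra.
near=> n; have nab : b < h n + t by near: n.
by rewrite patchE memNset//= in_itv/= => /andP[]; lra.
Unshelve. all: by end_near. Qed.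

(** By [RL_shift] the integral is at most the L^1 distance of the restriction of g
    to its translate by pi / u_n; this tends to 0 by dominated convergence, because
    the restriction is continuous off the two end points. *)
Lemma RL_continuous (g : R -> R) (a b : R) (u : R^nat) : a <= b -> continuous g ->
  u n @[n --> \oo] --> +oo ->
  \int[leb]_t (sin (u n * t) * (g \_ `[a, b]) t) @[n --> \oo] --> 0.
Proof.
move=> ab cg uoo; set G := g \_ `[a, b].
have [B B0 GB] : exists2 B, 0 <= B & forall t, `|G t| <= B.
  have [c _ cM] := EVT_max ab (continuous_subspaceT (fun t => cvg_norm (cg t))).
  exists `|g c| => // t; rewrite /G patchE; case: ifPn => [/set_mem tab|_].
    exact: cM.
  by rewrite normr0.
have mG : measurable_fun setT G.
  apply/(measurable_restrictT _ _).1 => //.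
  by apply: measurable_funTS; exact: continuous_measurable_fun.
have Gi : leb.-integrable setT (EFin \o G).
  rewrite (_ : _ \o _ = (EFin \o g) \_ `[a, b]); last first.
    by apply/funext => t; rewrite /G !patchE/= /G patchE; case: ifP.
  apply/(integrable_mkcond _ _).1 => //; exact: continuous_integrable.
(* u_n >= 1 only for large n; v_n >= 1 keeps every translate within [a - pi, b + pi] *)
pose v n := Num.max (u n) 1.
have voo : v n @[n --> \oo] --> +oo.
  apply/cvgryPge => A; move/cvgryPge : uoo => /(_ A); apply: filterS => n un.
  by rewrite /v le_max un.
have v1 n : 1 <= v n by rewrite /v le_max lexx orbT.
have v0 n : 0 < v n by rewrite (lt_le_trans ltr01).
have h0 : pi / v n @[n --> \oo] --> 0.
  rewrite -(mulr0 pi); apply: cvgM; first exact: cvg_cst.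
  apply/gtr0_cvgV0; first by near=> n; exact: v0.
  exact: voo.
suff L : \int[leb]_t `|G t - G (pi / v n + t)| @[n --> \oo] --> 0.
  apply/cvgr0Pnorm_lt => e e0.
  move/cvgr0Pnorm_lt : L => /(_ e e0) L.
  move/cvgryPge : uoo => /(_ 1) uoo.
  near=> n.
  have un1 : 1 <= u n by near: n.
  have vu : v n = u n by rewrite /v max_l.
  apply: le_lt_trans (RL_shift (lt_le_trans ltr01 un1) Gi) _.
  rewrite -vu; apply: le_lt_trans (ler_norm _) _; near: n; exact: L.
pose D := `[a - pi, b + pi]%classic.
have hpi n : 0 <= pi / v n <= pi.
  rewrite divr_ge0 ?pi_ge0 ?(ltW (v0 n))//= ler_pdivrMr//.
  by rewrite ler_peMr// pi_ge0.
have mGn n : measurable_fun setT (fun t => `|G t - G (pi / v n + t)|).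
  apply: measurableT_comp => //; apply: measurable_funB => //.
  have m1 := measurable_affine (pi / v n) 1.
  have := measurableT_comp mG m1; apply: eq_measurable_fun => t _ /=.
  by rewrite mul1r.
have Gout t : t \notin D -> G t = 0.
  move=> tD; rewrite /G patchE memNset//= => tab; move/negP: tD; apply.
  apply/mem_set; rewrite /D/=; move: tab; rewrite !in_itv/= => /andP[? ?].
  by have := @pi_ge0 R => ?; apply/andP; split; lra.
have Gout' n t : t \notin D -> G (pi / v n + t) = 0.
  move=> tD; rewrite /G patchE memNset//= => tab; move/negP: tD; apply.
  apply/mem_set; rewrite /D/=; move: tab; rewrite !in_itv/= => /andP[? ?].
  by have /andP[? ?] := hpi n; apply/andP; split; lra.
have cv : {ae leb, forall t, setT t ->
    (`|G t - G (pi / v n + t)|)%:E @[n --> \oo] --> 0%:E}.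
  exists [set a; b]; split => //.
    by apply: measurableU; exact: measurable_set1.
    apply: countable_lebesgue_measure0; apply: finite_set_countable.
    by rewrite finite_setU; split; exact: finite_set1.
  move=> t /= H; apply: contrapT => /not_orP[/eqP ta /eqP tb]; apply: H => _.
  apply/fine_cvgP; split; first by near=> n.
  rewrite -[X in _ --> X](@normr0 _ R) -[in X in _ --> X](subrr (G t)).
  apply: cvg_norm; apply: cvgB; first exact: cvg_cst.
  exact: patch_itv_translate.
have Di : leb.-integrable setT (EFin \o (cst (2 * B) \_ D)).
  rewrite (_ : _ \o _ = (EFin \o cst (2 * B)) \_ D); last first.
    by apply/funext => t; rewrite /= !patchE; case: ifP.
  apply/(integrable_mkcond _ _).1; first exact: measurable_itv.
  apply: (bounded_integrable (B := `|2 * B|)) => //; first exact: measurable_itv.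
  exact: leb_itv_lty.
have bd : {ae leb, forall t n, setT t ->
    (`|(`|G t - G (pi / v n + t)|)%:E| <= (EFin \o (cst (2 * B)%R \_ D)) t)%E}.
  apply: aeW => t n _; rewrite lee_fin normr_id patchE; case: ifPn => tD.
    have := ler_normB (G t) (G (pi / v n + t)); have := GB t.
    by have := GB (pi / v n + t); rewrite /=; lra.
  by rewrite Gout// Gout'// subrr normr0.
have [_ _ /=] := @dominated_convergence _ (measurableTypeR R) R leb setT measurableT
   (fun n t => (`|G t - G (pi / v n + t)|)%:E) (cst 0%E) _
   (fun n => (measurable_EFinP _ _).2 (mGn n)) (measurable_cst _) cv Di bd.
by rewrite integral0 => /fine_cvg.
Unshelve. all: by end_near. Qed.

(** Functions that are continuous on a bounded interval and 0 outside are dense in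
    L^1, and |sin| <= 1 makes the integrals depend on f in a Lipschitz way for the
    L^1 norm, uniformly in M. *)
Theorem Riemann_Lebesgue (f : R -> R) : leb.-integrable setT (EFin \o f) ->
  \int[leb]_t (sin (M * t) * f t) @[M --> +oo] --> 0.
Proof.
move=> fi; apply/cvg_pinftyP => u uoo.
have /measurable_EFinP mf := measurable_int _ fi.
apply/cvgr0Pnorm_lt => e e0; have e3 : 0 < e / 3 by lra.
have [n tn] : exists n : nat, \int[leb]_t `|f t - (f \_ `[- n%:R, n%:R]) t| < e / 3.
  have mfn (n : nat) : measurable_fun setT (f \_ `[- n%:R, n%:R] : R -> R).
    by apply/(measurable_restrictT _ _).1 => //; exact: measurable_funTS.
  have cv : {ae leb, forall t, setT t ->
      (`|f t - (f \_ `[- n%:R, n%:R]) t|)%:E @[n --> \oo] --> 0%:E}.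
    apply: aeW => t _; apply: cvg_near_cst; near=> n.
    rewrite patchE mem_set ?subrr ?normr0//= in_itv/= -ler_norml.
    by near: n; exact: nbhs_infty_ger.
  have bd : {ae leb, forall t (n : nat), setT t ->
      (`|(`|f t - (f \_ `[- n%:R, n%:R]) t|)%:E| <= (abse \o (EFin \o f)) t)%E}.
    apply: aeW => t n _; rewrite lee_fin normr_id patchE; case: ifP => _.
      by rewrite subrr normr0.
    by rewrite subr0.
  have [_ _ /=] := @dominated_convergence _ (measurableTypeR R) R leb setT measurableT
   (fun n t => (`|f t - (f \_ `[- n%:R, n%:R]) t|)%:E) (cst 0%E) _
   (fun n => (measurable_EFinP _ _).2 (measurableT_comp (@normr_measurable R setT)
      (measurable_funB mf (mfn n)))) (measurable_cst _) cv
   (integrable_abse fi) bd.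
  rewrite integral0 => /fine_cvg /= /cvgr0Pnorm_lt /(_ _ e3)[n _ /(_ n (leqnn n))] H.
  by exists n; apply: le_lt_trans (ler_norm _) H.
have nn : - n%:R <= n%:R :> R by rewrite ge0_cp// oppr_le0.
have fni : leb.-integrable `[- n%:R, n%:R] (EFin \o f) by exact: integrableS fi.
have [g [gc gi gn]] := approximation_continuous_integrable (measurable_itv _)
  (leb_itv_lty (- n%:R) n%:R true false) fni.
have [k gk] : exists k : nat, \int[leb]_(t in `[- n%:R, n%:R]) `|f t - g k t| < e / 3.
  have /fine_cvg/cvgr0Pnorm_lt /(_ _ e3)[k _ /(_ k (leqnn k)) H] := gn.
  by exists k; apply: le_lt_trans (ler_norm _) H.
have /cvgr0Pnorm_lt/(_ _ e3) RL := RL_continuous nn (gc k) uoo.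
near=> m.
have RLm : `|\int[leb]_t (sin (u m * t) * ((g k) \_ `[- n%:R, n%:R]) t)| < e / 3 by near: m.
set fn := f \_ `[- n%:R, n%:R]; set gn' := (g k) \_ `[- n%:R, n%:R].
have fni' : leb.-integrable setT (EFin \o fn).
  rewrite (_ : _ \o _ = (EFin \o f) \_ `[- n%:R, n%:R]); last first.
    by apply/funext => t; rewrite /= /fn !patchE; case: ifP.
  exact/(integrable_mkcond _ _).1.
have gni' : leb.-integrable setT (EFin \o gn').
  rewrite (_ : _ \o _ = (EFin \o g k) \_ `[- n%:R, n%:R]); last first.
    by apply/funext => t; rewrite /= /gn' !patchE; case: ifP.
  exact/(integrable_mkcond _ _).1.
have d1 : leb.-integrable setT (EFin \o (fun t => f t - fn t)).
  exact: (integrableB measurableT fi fni').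
have d2 : leb.-integrable setT (EFin \o (fun t => fn t - gn' t)).
  exact: (integrableB measurableT fni' gni').
have ms : measurable_fun setT (fun t : R => sin (u m * t)).
  by apply: continuous_measurable_fun; exact: continuous_sinM.
have sb t : setT t -> `|sin (u m * t)| <= 1 by rewrite ler_norml sin_geN1 sin_le1.
have E1 := @le_norm_Rintegral_weight _ (measurableTypeR R) R leb setT _ _ 1 measurableT ms sb d1.
have E2 := @le_norm_Rintegral_weight _ (measurableTypeR R) R leb setT _ _ 1 measurableT ms sb d2.
have -> : \int[leb]_t (sin (u m * t) * f t) =
    \int[leb]_t (sin (u m * t) * (f t - fn t)) +
    \int[leb]_t (sin (u m * t) * (fn t - gn' t)) +
    \int[leb]_t (sin (u m * t) * gn' t).
  have sd1 := integrable_sinM (u m) measurableT d1.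
  have sd2 := integrable_sinM (u m) measurableT d2.
  have sd3 := integrable_sinM (u m) measurableT gni'.
  rewrite -RintegralD// -RintegralD//; last exact: (integrableD measurableT sd1 sd2).
  by apply: eq_Rintegral => t _; ring.
have E3 : \int[leb]_t `|fn t - gn' t| < e / 3.
  apply: le_lt_trans gk; rewrite [leRHS]Rintegral_mkcond le_eqVlt; apply/orP; left.
  apply/eqP; apply: eq_Rintegral => t _; rewrite /fn /gn' !patchE.
  by case: ifP => // _; rewrite subrr normr0.
rewrite !mul1r in E1 E2.
have eE : e / 3 + e / 3 + e / 3 = e by field.
rewrite -[ltRHS]eE; apply: (le_lt_trans (ler_normD _ _)).
apply: ltrD => //; apply: (le_lt_trans (ler_normD _ _)); apply: ltrD.
  exact: le_lt_trans E1 tn.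
exact: le_lt_trans E2 E3.
Unshelve. all: by end_near. Qed.

End RiemannLebesgue2.

(** * Integrals against monotone weights *)

Section MonotoneWeights.
Variable R : realType.
Local Notation leb := (@lebesgue_measure R).
Local Notation leb2 := (leb \x leb)%E.

(** An initial segment of ]a, b] is ]a, x] or ]a, x[, and the end point is
    negligible. *)
Lemma Rintegral_initial_segment (k : R -> R) (a b C : R) (J : set R) :
  a <= b -> leb.-integrable `]a, b] (EFin \o k) ->
  (forall x, a <= x -> x <= b -> `|\int[leb]_(s in `]a, x]) k s| <= C) ->
  J `<=` `]a, b] -> (forall x y, J y -> a < x -> x <= y -> J x) ->
  `|\int[leb]_(s in J) k s| <= C.
Proof.
move=> ab ki kC Jab Jinit.
have [->|/set0P J0] := eqVneq J set0.
  have := kC a (lexx a) ab.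
  by rewrite set_itv_ge ?bnd_simp// !Rintegral_set0.
have Jbnd y : J y -> a < y <= b by move=> /Jab; rewrite /= in_itv.
have Jsup : has_sup J.
  by split => //; exists b => y /Jbnd /andP[].
pose x := sup J.
have Jx y : J y -> y <= x by move=> Jy; exact: sup_upper_bound.
have ax : a < x.
  by have [y Jy] := J0; apply: lt_le_trans (Jx _ Jy); have /andP[] := Jbnd _ Jy.
have xb : x <= b by apply: ge_sup => // y /Jbnd /andP[].
have Jlt y : a < y -> y < x -> J y.
  move=> ay yx; have xy0 : 0 < x - y by rewrite subr_gt0.
  have [z Jz] := sup_adherent xy0 Jsup.
  by rewrite -/x opprB addrC subrK => yz; apply: Jinit Jz ay (ltW yz).
have [Jxx|Jxx] := pselect (J x).
  have -> : J = `]a, x]%classic.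
    apply/seteqP; split => y /=; rewrite in_itv/=.
      by move=> Jy; rewrite (Jx _ Jy) andbT; have /andP[] := Jbnd _ Jy.
    by move=> /andP[ay]; rewrite le_eqVlt => /predU1P[->//|]; exact: Jlt.
  exact: kC (ltW ax) xb.
have -> : J = `]a, x[%classic.
  apply/seteqP; split => y /=; rewrite in_itv/=.
    move=> Jy; rewrite [y < x]lt_neqAle (Jx _ Jy) andbT; have /andP[-> _]/= := Jbnd _ Jy.
    by apply/eqP => yx; apply: Jxx; rewrite -yx.
  by move=> /andP[ay]; exact: Jlt.
rewrite Rintegral_itv_bndo_bndc; first exact: kC (ltW ax) xb.
apply: integrableS ki => //; apply: subset_itv; rewrite ?bnd_simp//.
Qed.

(** A form of the second mean value theorem: the primitive of k is bounded, while
    the integral of |k| may be large.  By layers, g b - g s is the integral over l in [0, K] of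
    the indicator of l < g b - g s, and for each l the set of such s is an initial
    segment of ]a, b] because g is nondecreasing. *)
Lemma monotone_weight_bound (k g : R -> R) (a b C K : R) :
  a < b -> measurable_fun setT k -> leb.-integrable `]a, b] (EFin \o k) ->
  (forall x, a <= x -> x <= b -> `|\int[leb]_(s in `]a, x]) k s| <= C) ->
  (forall x y, a < x -> x <= y -> y <= b -> g x <= g y) ->
  (forall x, a < x -> x <= b -> g b - g x <= K) ->
  leb.-integrable `]a, b] (EFin \o (fun s => k s * g s)) /\
  `|\int[leb]_(s in `]a, b]) (k s * g s)| <= C * (`|g b| + K).
Proof.
move=> ab mk ki kC gnd gK.
have K0 : 0 <= K by have := gK _ ab (lexx b); rewrite subrr.
pose D := `]a, b]%classic : set R.
have mD : measurable D by exact: measurable_itv.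
pose e : R -> R := (fun s => g b - g s) \_ D.
have eE s : D s -> e s = g b - g s by move=> Ds; rewrite /e patchE mem_set.
have e_ge0 s : 0 <= e s.
  rewrite /e patchE; case: ifPn => // /set_mem; rewrite /D/= in_itv/= => /andP[as_ sb].
  by rewrite subr_ge0 gnd.
have e_leK s : e s <= K.
  rewrite /e patchE; case: ifPn => // /set_mem; rewrite /D/= in_itv/= => /andP[as_ sb].
  exact: gK.
have mg : measurable_fun D g.
  (* a nondecreasing extension of g to the line *)
  pose h x := if x <= a then g b - K else if x <= b then g x else g b.
  have hnd : nondecreasing_fun h.
    move=> x y xy; rewrite /h; case: (leP x a) => xa.
      case: (leP y a) => ya; first by [].
      case: (leP y b) => yb; last by lra.
      by have := gK _ ya yb; lra.
    have ya : a < y by exact: lt_le_trans xy.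
    rewrite (lt_geF ya); case: (leP x b) => xb.
      by case: (leP y b) => yb; [exact: gnd|exact: gnd].
    by rewrite (lt_geF (lt_le_trans xb xy)).
  apply: (eq_measurable_fun h) (nondecreasing_measurable mD hnd).
  by move=> x /set_mem; rewrite /D/= in_itv/= => /andP[ax xb]; rewrite /h (lt_geF ax) xb.
have me : measurable_fun setT e.
  apply/(measurable_restrictT _ _).1 => //.
  by apply: measurable_funB.
pose A := [set p : R * R | p.2 < e p.1].
have mA : measurable A.
  have mh : measurable_fun setT (fun p : R * R => e p.1 - p.2).
    apply: measurable_funB => //; exact: (measurableT_comp me measurable_fst).
  have := mh measurableT `]0, +oo[%classic (measurable_itv _).
  rewrite setTI (_ : _ @^-1` _ = A)//; apply/seteqP; split => p;
  by rewrite /A/= in_itv/= andbT subr_gt0.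
have k1i : leb2.-integrable (D `*` `[0, K]) (EFin \o (fun p => k p.1 * cst 1 p.2)).
  apply: plane_integrable_tensor => //.
  apply: (line_bounded_integrable (B := 1)) => //; first exact: leb_itv_lty.
  by move=> x _; rewrite normr1.
have Fi : leb2.-integrable (D `*` `[0, K]) (EFin \o (fun p => \1_A p * (k p.1 * cst 1 p.2))).
  apply: (plane_integrable_bounded_mul (B := 1)) => //; first exact: measurableX.
  by move=> p _; rewrite indicE; case: (_ \in _); rewrite ?normr1 ?normr0.
have keE : \int[leb]_(s in D) (k s * e s) =
    \int[leb]_(l in `[0, K]) \int[leb]_(s in D) (\1_A (s, l) * (k s * cst 1 l)).
  rewrite -(plane_Rintegral21 mD (measurable_itv _) Fi) (plane_Rintegral12 mD (measurable_itv _) Fi).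
  apply: eq_Rintegral => s _.
  under [RHS]eq_Rintegral do rewrite /= mulr1.
  have AE l : \1_A (s, l) = \1_(`]-oo, (e s)[%classic) l :> R.
    by rewrite !indicE; congr (_%:R); apply/idP/idP => /set_mem H; apply/mem_set;
       move: H; rewrite /A/= in_itv.
  under [RHS]eq_Rintegral do rewrite AE.
  rewrite [RHS]RintegralZr//; last first.
    apply: (line_bounded_integrable (B := 1)) => //; first exact: leb_itv_lty.
    by move=> x _; rewrite indicE; case: (_ \in _); rewrite ?normr1 ?normr0.
  rewrite mulrC; congr (_ * _).
  rewrite /Rintegral integral_indic//.
  have -> : `]-oo, (e s)[ `&` `[0, K] = `[0, (e s)[%classic.
    apply/seteqP; split => l /=; rewrite !in_itv/=.
      by move=> [-> /andP[-> _]].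
    move=> /andP[l0 ls]; split => //; rewrite l0/=; have := e_leK s; lra.
  by rewrite -[LHS]subr0; apply/esym; apply: (fine_leb_itv true true); exact: e_ge0.
have innerC l : `[0, K]%classic l -> `|\int[leb]_(s in D) (\1_A (s, l) * (k s * cst 1 l))| <= C.
  rewrite /= in_itv/= => /andP[l0 _].
  pose J := [set s | D s /\ l < e s].
  have -> : \int[leb]_(s in D) (\1_A (s, l) * (k s * cst 1 l)) = \int[leb]_(s in J) k s.
    rewrite [LHS]Rintegral_mkcond [RHS]Rintegral_mkcond; apply: eq_Rintegral => s _.
    rewrite !patchE; case: ifPn => [sD|sD]; last first.
      by rewrite memNset// => -[/mem_set]; rewrite (negbTE sD).
    rewrite indicE /= mulr1; case: (boolP (s \in J)) => [/set_mem[_ ls]|/negP sJ].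
      by rewrite mem_set// mul1r.
    rewrite memNset ?mul0r// => As; apply: sJ; apply/mem_set; split => //.
    exact/set_mem.
  apply: (Rintegral_initial_segment (ltW ab) ki kC) => [s []//|x y [Dy ly] ax xy].
  have yb : y <= b by move: Dy; rewrite /D/= in_itv/= => /andP[].
  have Dx : D x by rewrite /D/= in_itv/= ax (le_trans xy).
  split => //; apply: lt_le_trans ly _; rewrite !eE// lerD2l lerN2.
  exact: gnd.
have keC : `|\int[leb]_(s in D) (k s * e s)| <= C * K.
  rewrite keE; have ii := plane_integrable_Rintegral2 mD (measurable_itv _) Fi.
  apply: (le_trans (le_normr_Rintegral _ ii)) => //.
  apply: (@le_trans _ _ (\int[leb]_(l in `[0, K]) C)).
    apply: le_Rintegral => //; first exact: integrable_norm ii.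
    by apply: (line_bounded_integrable (B := `|C|)) => //; exact: leb_itv_lty.
  by rewrite Rintegral_cst// -[in leRHS](subr0 K) (fine_leb_itv true false K0).
have kei : leb.-integrable D (EFin \o (fun s => k s * e s)).
  rewrite (_ : (fun s => k s * e s) = (fun s => e s * k s)); last first.
    by apply/funext => s; rewrite mulrC.
  apply: (line_integrable_bounded_mul (B := K)) => //; first exact: measurable_funTS.
  by move=> s _; rewrite ger0_norm.
have gbi : leb.-integrable D (EFin \o (fun s => k s * g b)).
  by apply: (line_eq_integrable mD _ (line_integrableZ (g b) mD ki)) => s _; rewrite mulrC.
have kgE : {in D, forall s, k s * g s = k s * g b - k s * e s}.
  by move=> s /set_mem Ds; rewrite eE//; ring.
split.
  apply: (line_eq_integrable mD _ (line_integrableB mD gbi kei)) => s Ds.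
  by rewrite kgE//; exact/mem_set.
have -> : \int[leb]_(s in D) (k s * g s) = \int[leb]_(s in D) (k s * g b - k s * e s).
  by apply: eq_Rintegral => s sD; exact: kgE.
rewrite RintegralB// (le_trans (ler_normB _ _))// RintegralZr// normrM mulrDr lerD//.
by rewrite ler_wpM2r// kC// ltW.
Qed.

End MonotoneWeights.

(** * Bounded variation on an interval *)

Section Refinement.
Variable R : realType.
Implicit Types (a b : R) (s t : seq R).

Lemma lt_path_le_last a s x : path <%O a s -> x \in s -> x <= last a s.
Proof.
elim: s a => // y s IH a /= /andP[ay ys]; rewrite inE => /predU1P[->|]; last exact: IH.
case: s ys {IH} => // z s ys; have := ys => /= /andP[yz zs].
have /lt_path_min/allP/(_ (last z s)) := ys; rewrite /= mem_last => /(_ isT).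
exact: ltW.
Qed.

Lemma lt_sorted_subseq s t : sorted <%O s -> sorted <%O t -> {subset s <= t} ->
  subseq s t.
Proof.
move=> ss st sub; have -> : s = [seq x <- t | x \in s].
  apply: lt_sorted_eq => //; first exact: (sorted_filter lt_trans).
  move=> x; rewrite mem_filter; case: (boolP (x \in s)) => //= xs.
  by rewrite sub.
exact: filter_subseq.
Qed.

(** Variation over nets grows under refinement; hence bounds may be compared on one
    net that contains two given ones. *)
Lemma itv_partition_common_refinement a b s t : a < b ->
  itv_partition a b s -> itv_partition a b t ->
  exists r, [/\ itv_partition a b r, subseq s r & subseq t r].
Proof.
move=> ab [sa /eqP sb] [ta /eqP tb].
pose r := sort <=%O (undup (s ++ t)).
have rE x : (x \in r) = (x \in s) || (x \in t) by rewrite mem_sort mem_undup mem_cat.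
have sr : sorted <%O r by rewrite sort_lt_sorted undup_uniq.
have := sa; rewrite lt_path_sortedE => /andP[sa' ss].
have := ta; rewrite lt_path_sortedE => /andP[ta' st].
have ra : path <%O a r.
  rewrite lt_path_sortedE sr andbT; apply/allP => x; rewrite rE => /orP[|] xs.
    exact: (allP sa').
  exact: (allP ta').
have bs : b \in s.
  by have := mem_last a s; rewrite sb inE => /predU1P[ba|//]; move: ab; rewrite ba ltxx.
exists r; split.
- split => //; rewrite eq_le; apply/andP; split; last first.
    by apply: lt_path_le_last => //; rewrite rE bs.
  have := mem_last a r; rewrite inE => /predU1P[->|]; first exact: ltW.
  rewrite rE => /orP[|] H; first by rewrite -[leRHS]sb; exact: lt_path_le_last.
  by rewrite -[leRHS]tb; exact: lt_path_le_last.
- by apply: lt_sorted_subseq => // x xs; rewrite rE xs.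
- by apply: lt_sorted_subseq => // x xs; rewrite rE xs orbT.
Qed.

End Refinement.

Section DominatedVariation.
Variable R : realType.
Implicit Types (a b K L : R) (f g U W : R -> R).

(** U plays the part of the variation function of f.  Any such U will do, so that
    sums and products never require the computation of a variation. *)
Definition increments_le a b f U :=
  forall x y, a <= x -> x <= y -> y <= b -> `|f y - f x| <= U y - U x.

(** A bound on the norm of bounded variation, with one constant for its two parts. *)
Definition bv_le a b f K :=
  (forall t, a <= t -> t <= b -> `|f t| <= K) /\
  exists2 U, increments_le a b f U & U b - U a <= K.

Lemma increments_le_mono a b f U x y : increments_le a b f U ->
  a <= x -> x <= y -> y <= b -> U x <= U y.
Proof. by move=> fU ax xy yb; rewrite -subr_ge0 (le_trans _ (fU _ _ ax xy yb)). Qed.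

Lemma bv_le_weaken a b f K L : bv_le a b f K -> K <= L -> bv_le a b f L.
Proof.
move=> [fK [U fU UK]] KL; split.
  by move=> t at_ tb; rewrite (le_trans _ KL) ?fK.
by exists U => //; exact: le_trans KL.
Qed.

Lemma bv_leD a b f g K L : bv_le a b f K -> bv_le a b g L ->
  bv_le a b (fun t => f t + g t) (K + L).
Proof.
move=> [fK [U fU UK]] [gL [V gV VL]]; split.
  by move=> t at_ tb; rewrite (le_trans (ler_normD _ _))// lerD ?fK ?gL.
exists (fun t => U t + V t); last by lra.
move=> x y ax xy yb; have := fU _ _ ax xy yb; have := gV _ _ ax xy yb.
have -> : f y + g y - (f x + g x) = (f y - f x) + (g y - g x) by ring.
have := ler_normD (f y - f x) (g y - g x); lra.
Qed.

(** Leibniz rule: B times the variation of f plus K times the variation of p. *)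
Lemma bv_leM a b f p K B L : a <= b ->
  (forall t, a <= t -> t <= b -> `|p t| <= B) ->
  (forall x y, a <= x -> x <= y -> y <= b -> `|p y - p x| <= L * (y - x)) ->
  bv_le a b f K -> bv_le a b (fun t => p t * f t) ((B + L * (b - a)) * K).
Proof.
move=> ab pB pL [fK [U fU UK]].
have K0 : 0 <= K by rewrite (le_trans _ (fK a (lexx a) ab)).
have B0 : 0 <= B by rewrite (le_trans _ (pB a (lexx a) ab)).
have Lab : 0 <= L * (b - a) by rewrite (le_trans _ (pL a b (lexx a) ab (lexx b))).
split.
  move=> t at_ tb; rewrite normrM (@le_trans _ _ (B * K))//.
    by rewrite ler_pM ?fK ?pB.
  by rewrite ler_wpM2r// lerDl.
exists (fun t => B * U t + L * K * t).
  move=> x y ax xy yb.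
  have -> : p y * f y - p x * f x = p y * (f y - f x) + (p y - p x) * f x by ring.
  rewrite (le_trans (ler_normD _ _))// !normrM.
  have h1 : `|p y| * `|f y - f x| <= B * (U y - U x).
    by rewrite ler_pM ?pB ?fU// (le_trans ax).
  have h2 : `|p y - p x| * `|f x| <= L * (y - x) * K.
    by rewrite ler_pM ?pL ?fK// (le_trans xy).
  lra.
have : B * (U b - U a) <= B * K by rewrite ler_wpM2l.
lra.
Qed.

Lemma bv_leZ a b f K c : a <= b -> bv_le a b f K -> bv_le a b (fun t => c * f t) (`|c| * K).
Proof.
move=> ab fK; rewrite -[X in X * K]addr0 -(mul0r (b - a)).
apply: bv_leM => //.
by move=> x y _ xy _; rewrite subrr normr0 mul0r.
Qed.

Lemma bv_le_reflection a b a' b' c k f K : a' <= b' -> k = 1 \/ k = -1 ->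
  (forall t, a' <= t -> t <= b' -> a <= c + k * t <= b) ->
  bv_le a b f K -> bv_le a' b' (fun t => f (c + k * t)) K.
Proof.
move=> ab' kE kab [fK [U fU UK]]; split.
  by move=> t at_ tb; have /andP[? ?] := kab _ at_ tb; exact: fK.
have /andP[a1 b1] := kab _ (lexx a') ab'; have /andP[a2 b2] := kab _ ab' (lexx b').
exists (fun t => k * U (c + k * t)).
  move=> x y ax xy yb.
  have /andP[ax1 xb1] := kab _ ax (le_trans xy yb).
  have /andP[ay1 yb1] := kab _ (le_trans ax xy) yb.
  case: kE => kE; subst k; rewrite ?mul1r ?mulN1r in ax1 xb1 ay1 yb1 *.
    by apply: fU => //; rewrite lerD2l.
  have H : c - y <= c - x by rewrite lerD2l lerN2.
  by rewrite distrC; have := fU _ _ ay1 H xb1; rewrite /=; lra.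
apply: le_trans UK.
case: kE => kE; subst k; rewrite ?mul1r ?mulN1r in a1 b1 a2 b2 *.
  have := increments_le_mono fU a2 b2 (lexx b).
  have := increments_le_mono fU (lexx a) a1 b1; lra.
have := increments_le_mono fU a1 b1 (lexx b).
have := increments_le_mono fU (lexx a) a2 b2; lra.
Qed.

Lemma increments_le_of_variation a b f K : a < b ->
  (forall s, itv_partition a b s -> variation a b f s <= K) ->
  exists2 U, increments_le a b f U & U b - U a <= K.
Proof.
move=> ab fK; have fBV : bounded_variation a b f by exists K => _ [s abs <-]; exact: fK.
have fin x : a <= x -> x <= b -> total_variation a x f \is a fin_num.
  by move=> ax xb; apply/bounded_variationP => //; exact: bounded_variationl fBV.
exists (fun x => fine (total_variation a x f)).
  move=> x y ax xy yb; have fx := fin _ ax (le_trans xy yb).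
  have fy := fin _ (le_trans ax xy) yb.
  rewrite -lee_fin EFinB !fineK// (total_variationD f ax xy) addeAC subee// add0e.
  exact: total_variation_ge.
rewrite total_variationxx/= subr0 -lee_fin fineK ?fin ?(ltW ab)//.
by apply: ge_ereal_sup => _ [_ [s abs <-] <-]; rewrite lee_fin; exact: fK.
Qed.

End DominatedVariation.

(** * Bounded variation on a rectangle, section by section *)

Section StripVariation.
Variable R : realType.
Implicit Types (h g : R * R -> R).

(** The form in which bounded variation of h on a rectangle is used: as s increases
    the section h (s, .) moves, in the norm of bounded variation, no faster than W.
    This is stable under products with functions of one variable, and an integral
    of h in t inherits bounded variation in s, governed by W for all kernels at
    once. *)
Definition strip_bv (a1 b1 a2 b2 : R) h := exists W : R -> R, exists K : R,
  (forall x y, a1 <= x -> x <= y -> y <= b1 ->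
     bv_le a2 b2 (fun t => h (y, t) - h (x, t)) (W y - W x)) /\
  (forall x, a1 <= x -> x <= b1 -> bv_le a2 b2 (fun t => h (x, t)) K).

Lemma bv_le_ext (a b K : R) (f g : R -> R) : f =1 g -> bv_le a b f K -> bv_le a b g K.
Proof. by move=> /funext ->. Qed.

Lemma strip_bvD a1 b1 a2 b2 h g : strip_bv a1 b1 a2 b2 h -> strip_bv a1 b1 a2 b2 g ->
  strip_bv a1 b1 a2 b2 (fun p => h p + g p).
Proof.
move=> [W [K [hW hK]]] [V [L [gV gL]]]; exists (fun x => W x + V x), (K + L); split.
  move=> x y ax xy yb.
  apply: (@bv_le_weaken _ _ _ _ (W y - W x + (V y - V x))); last by lra.
  apply: bv_le_ext (bv_leD (hW x y ax xy yb) (gV x y ax xy yb)) => t; ring.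
by move=> x ax xb; exact: bv_leD (hK _ ax xb) (gL _ ax xb).
Qed.

Lemma strip_bvMr a1 b1 a2 b2 h (p : R -> R) (B L : R) : a2 <= b2 ->
  (forall t, a2 <= t -> t <= b2 -> `|p t| <= B) ->
  (forall x y, a2 <= x -> x <= y -> y <= b2 -> `|p y - p x| <= L * (y - x)) ->
  strip_bv a1 b1 a2 b2 h -> strip_bv a1 b1 a2 b2 (fun q => p q.2 * h q).
Proof.
move=> ab pB pL [W [K [hW hK]]].
pose C := B + L * (b2 - a2); exists (fun x => C * W x), (C * K); split.
  move=> x y ax xy yb; rewrite -mulrBr.
  apply: bv_le_ext (bv_leM ab pB pL (hW x y ax xy yb)) => t /=; ring.
by move=> x ax xb; exact: bv_leM ab pB pL (hK _ ax xb).
Qed.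

Lemma strip_bvMl a1 b1 a2 b2 h (p : R -> R) (B L : R) : a1 <= b1 -> a2 <= b2 ->
  (forall t, a1 <= t -> t <= b1 -> `|p t| <= B) ->
  (forall x y, a1 <= x -> x <= y -> y <= b1 -> `|p y - p x| <= L * (y - x)) ->
  strip_bv a1 b1 a2 b2 h -> strip_bv a1 b1 a2 b2 (fun q => p q.1 * h q).
Proof.
move=> ab1 ab pB pL [W [K [hW hK]]].
have nneg f M : bv_le a2 b2 f M -> 0 <= M.
  by move=> [fM _]; rewrite (le_trans _ (fM a2 (lexx _) ab)).
have K0 : 0 <= K by exact: nneg (hK _ (lexx a1) ab1).
exists (fun x => B * W x + L * K * x), (B * K); split.
  move=> x y ax xy yb.
  have H1 := bv_leZ (p y) ab (hW x y ax xy yb).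
  have H2 := bv_leZ (p y - p x) ab (hK x ax (le_trans xy yb)).
  apply: (@bv_le_weaken _ _ _ _ (`|p y| * (W y - W x) + `|p y - p x| * K)).
    apply: bv_le_ext (bv_leD H1 H2) => t /=; ring.
  have : `|p y| * (W y - W x) <= B * (W y - W x).
    by rewrite ler_wpM2r ?pB ?(le_trans ax)//; exact: nneg (hW _ _ ax xy yb).
  have : `|p y - p x| * K <= L * (y - x) * K by rewrite ler_wpM2r ?pL.
  lra.
move=> x ax xb; apply: bv_le_weaken (bv_leZ (p x) ab (hK _ ax xb)) _.
by rewrite ler_wpM2r ?pB.
Qed.

Lemma strip_bv_reflection a1 b1 a2 b2 a1' b1' a2' b2' c1 c2 k1 k2 h :
  a1' <= b1' -> a2' <= b2' -> k1 = 1 \/ k1 = -1 -> k2 = 1 \/ k2 = -1 ->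
  (forall t, a1' <= t -> t <= b1' -> a1 <= c1 + k1 * t <= b1) ->
  (forall t, a2' <= t -> t <= b2' -> a2 <= c2 + k2 * t <= b2) ->
  strip_bv a1 b1 a2 b2 h ->
  strip_bv a1' b1' a2' b2' (fun p => h (c1 + k1 * p.1, c2 + k2 * p.2)).
Proof.
move=> ab1 ab2 k1E k2E kab1 kab2 [W [K [hW hK]]].
exists (fun x => k1 * W (c1 + k1 * x)), K; split; last first.
  move=> x ax xb; have /andP[? ?] := kab1 _ ax xb.
  have Hx : bv_le a2 b2 (fun t => h (c1 + k1 * x, t)) K by exact: hK.
  exact: (bv_le_reflection ab2 k2E kab2 Hx).
move=> x y ax xy yb.
have /andP[ax1 xb1] := kab1 _ ax (le_trans xy yb).
have /andP[ay1 yb1] := kab1 _ (le_trans ax xy) yb.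
have H : bv_le a2 b2 (fun t => h (c1 + k1 * y, t) - h (c1 + k1 * x, t))
    (k1 * W (c1 + k1 * y) - k1 * W (c1 + k1 * x)).
  case: k1E => kE; subst k1; rewrite ?mul1r ?mulN1r in ax1 xb1 ay1 yb1 *.
    by apply: hW => //; rewrite lerD2l.
  have H : c1 - y <= c1 - x by rewrite lerD2l lerN2.
  have ab2' : a2 <= b2.
    by have /andP[? ?] := kab2 _ (lexx _) ab2; exact: (@le_trans _ _ (c2 + k2 * a2')).
  apply: bv_le_weaken; last first.
    have -> : - W (c1 - y) - - W (c1 - x) = `|-1 : R| * (W (c1 - x) - W (c1 - y)).
      by rewrite normrN1; ring.
    exact: lexx.
  apply: bv_le_ext (bv_leZ (-1) ab2' (hW _ _ ay1 H xb1)) => t /=; ring.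
exact: (bv_le_reflection ab2 k2E kab2 H).
Qed.

Lemma nondecreasing_at_right_limit (W : R -> R) (a b : R) : a < b ->
  (forall x y, a <= x -> x <= y -> y <= b -> W x <= W y) ->
  forall e, 0 < e -> exists2 d, a < d <= b & forall x, a < x -> x <= d -> W d - W x <= e.
Proof.
move=> ab Wnd e e0.
pose S := [set W x | x in `]a, b]].
have Sinf : has_inf S.
  split; first by exists (W b), b => //=; rewrite in_itv/= ab lexx.
  exists (W a) => _ [x + <-]; rewrite /= in_itv/= => /andP[ax xb]; apply: Wnd => //; exact: ltW.
have [_ [d + <-] Wd] := inf_adherent e0 Sinf; rewrite /= in_itv/= => /andP[ad db].
exists d; first by rewrite ad db.
move=> x ax xd; have : inf S <= W x.
  apply: inf_lbound; first by case: Sinf.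
  by exists x => //=; rewrite in_itv/= ax (le_trans xd).
by move: Wd; lra.
Qed.

Lemma strip_bv_mono a1 b1 a2 b2 h W : a2 <= b2 ->
  (forall x y, a1 <= x -> x <= y -> y <= b1 ->
     bv_le a2 b2 (fun t => h (y, t) - h (x, t)) (W y - W x)) ->
  forall x y, a1 <= x -> x <= y -> y <= b1 -> W x <= W y.
Proof.
move=> ab hW x y ax xy yb; have [H _] := hW x y ax xy yb.
by rewrite -subr_ge0 (le_trans _ (H a2 (lexx _) ab)).
Qed.

(** h (x, t) is within W d - W x of h (d, t), uniformly in t, and W has a right
    limit at 0; and h (d, .) has a right limit at 0, being of bounded variation. *)
Lemma strip_bv_corner_limit b1 b2 h : 0 < b1 -> 0 < b2 ->
  strip_bv 0 b1 0 b2 h ->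
  exists l : R, h @ filter_prod (0 : R)^'+ (0 : R)^'+ --> l.
Proof.
move=> b10 b20 [W [K [hW hK]]].
have Wnd := strip_bv_mono (ltW b20) hW.
apply/cvg_ex; apply/cauchy_cvgP; apply: cauchy_exP => e e0.
have e4 : 0 < e / 4 by lra.
have [d /andP[d0 db] Wd] := nondecreasing_at_right_limit b10 Wnd e4.
have [_ [U hU UK]] := hK d (ltW d0) db.
have Und x y : 0 <= x -> x <= y -> y <= b2 -> U x <= U y by exact: increments_le_mono hU.
have [c /andP[c0 cb] Uc] := nondecreasing_at_right_limit b20 Und e4.
have hd x t : 0 < x -> x <= d -> 0 <= t -> t <= b2 -> `|h (d, t) - h (x, t)| <= e / 4.
  move=> x0 xd t0 tb; have [H _] := hW x d (ltW x0) xd db.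
  exact: le_trans (H t t0 tb) (Wd x x0 xd).
have ht t : 0 < t -> t <= c -> `|h (d, c) - h (d, t)| <= e / 4.
  by move=> t0 tc; exact: le_trans (hU t c (ltW t0) tc cb) (Uc t t0 tc).
have key x t : 0 < x -> x <= d -> 0 < t -> t <= c -> `|h (d, c) - h (x, t)| <= e / 4 + e / 4.
  move=> x0 xd t0 tc; have := ht t t0 tc; have := hd x t x0 xd (ltW t0) (le_trans tc cb).
  have := ler_normD (h (d, c) - h (d, t)) (h (d, t) - h (x, t)).
  by rewrite subrKA; lra.
have right_itv (r : R) : 0 < r -> (0 : R)^'+ `]0, r[%classic.
  move=> r0; near=> z; rewrite /= in_itv/=; apply/andP; split; near: z.
    exact: nbhs_right_gt.
  exact: nbhs_right_lt.
exists (h (d, c)); exists (`]0, d[%classic, `]0, c[%classic) => /=.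
  by split; apply: right_itv.
move=> [x t] /= [] /=; rewrite !in_itv/= => /andP[x0 xd] /andP[t0 tc].
have := key x t x0 (ltW xd) t0 (ltW tc).
by rewrite -ball_normE /ball_ /=; lra.
Unshelve. all: by end_near. Qed.

End StripVariation.

(** * From nets to sections *)

Section VitaliVariation.
Variable R : realType.
Implicit Types (h : R * R -> R).

Lemma increments_le_osc (a b : R) (f U : R -> R) x y : increments_le a b f U ->
  a <= x <= b -> a <= y <= b -> `|f x - f y| <= U b - U a.
Proof.
move=> fU; wlog xy : x y / y <= x.
  move=> H xab yab; case: (leP y x) => [|/ltW] xy; first exact: H.
  by rewrite distrC; exact: H.
move=> /andP[ax xb] /andP[ay yb]; apply: le_trans (fU _ _ ay xy xb) _.
have := increments_le_mono fU ax xb (lexx b).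
have := increments_le_mono fU (lexx a) ay yb; lra.
Qed.

Lemma variation2E a1 b1 a2 b2 h s t : variation2 a1 b1 a2 b2 h s t =
  \sum_(0 <= i < size s) variation a2 b2
    (fun z => h (nth b1 (a1 :: s) i.+1, z) - h (nth b1 (a1 :: s) i, z)) t.
Proof.
apply: eq_bigr => i _; apply: eq_bigr => j _; congr (`|_|) => /=; ring.
Qed.

Lemma variation2_rcons a1 x y a2 b2 h s t : itv_partition a1 x s ->
  variation2 a1 y a2 b2 h (rcons s y) t =
  variation2 a1 x a2 b2 h s t + variation a2 b2 (fun z => h (y, z) - h (x, z)) t.
Proof.
move=> sx; rewrite !variation2E size_rcons big_nat_recr//=; congr (_ + _).
  rewrite !big_nat; apply: eq_bigr => i /andP[_ si].
  rewrite -rcons_cons !nth_rcons /= si ltnS (ltnW si).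
  rewrite (set_nth_default x)//; congr (variation _ _ _ _); apply/funext => z.
  by rewrite (set_nth_default x)//= ltnS ltnW.
rewrite -rcons_cons !nth_rcons /= ltnn eqxx ltnSn.
congr (variation _ _ _ _); apply/funext => z; congr (_ - h (_, _)).
by rewrite (itv_partition_nth_size _ sx).
Qed.

Lemma variation2_subseq a1 b1 a2 b2 h s t t' : itv_partition a2 b2 t ->
  itv_partition a2 b2 t' -> subseq t t' ->
  variation2 a1 b1 a2 b2 h s t <= variation2 a1 b1 a2 b2 h s t'.
Proof.
move=> pt pt' tt'; rewrite !variation2E; apply: ler_sum => i _.
exact: variation_subseq.
Qed.

(** W x is the variation of h over the nets of [a1, x] x [a2, b2] plus the
    variation over [a1, x] of one section h (., v).  The first controls the
    variation in t of the difference of two sections, the second its value at v,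
    and both together its supremum. *)
Theorem BVF_strip_bv a1 b1 a2 b2 h : a1 < b1 -> a2 < b2 -> BVF a1 b1 a2 b2 h ->
  strip_bv a1 b1 a2 b2 h.
Proof.
move=> ab1 ab2 [[V hV] [u uab [Ku hu]] [v vab [Kv hv]]].
(* the sums over the nets of [a1, x] x [a2, b2]; W1 x is their supremum *)
pose E x := [set r | exists s t, [/\ itv_partition a1 x s, itv_partition a2 b2 t &
  r = variation2 a1 x a2 b2 h s t]].
pose W1 x := sup (E x).
have p2 : itv_partition a2 b2 [:: b2] by exact: itv_partition1.
have Esup x : a1 <= x -> x <= b1 -> has_sup (E x).
  move=> ax xb; split.
    move: ax; rewrite le_eqVlt => /predU1P[<-|ax].
      by exists (variation2 a1 a1 a2 b2 h [::] [:: b2]), [::], [:: b2].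
    exists (variation2 a1 x a2 b2 h [:: x] [:: b2]), [:: x], [:: b2]; split => //.
    exact: itv_partition1.
  exists V => _ [s [t [sx tb ->]]].
  move: xb; rewrite [x <= _]le_eqVlt => /predU1P[xb|xb]; first by subst x; exact: hV.
  apply: (@le_trans _ _ (variation2 a1 b1 a2 b2 h (rcons s b1) t)).
    by rewrite (variation2_rcons _ _ _ _ _ sx) lerDl variation_ge0.
  apply: hV => //; rewrite -cats1; apply: itv_partition_cat sx _.
  exact: itv_partition1.
have W1D x y t : a1 <= x -> x < y -> y <= b1 -> itv_partition a2 b2 t ->
    variation a2 b2 (fun z => h (y, z) - h (x, z)) t <= W1 y - W1 x.
  move=> ax xy yb pt; have Ex := Esup x ax (le_trans (ltW xy) yb).
  have Ey := Esup y (le_trans ax (ltW xy)) yb.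
  rewrite lerBrDr -lerBrDl; apply: ge_sup; first by case: Ex.
  move=> _ [s [t' [sx pt' ->]]]; rewrite lerBrDl addrC.
  have [r [pr tr t'r]] := itv_partition_common_refinement ab2 pt pt'.
  apply: (@le_trans _ _ (variation2 a1 y a2 b2 h (rcons s y) r)).
    rewrite (variation2_rcons _ _ _ _ _ sx) lerD//.
      exact: variation2_subseq.
    exact: variation_subseq.
  apply: sup_upper_bound => //; exists (rcons s y), r; split => //.
  by rewrite -cats1; apply: itv_partition_cat sx _; exact: itv_partition1.
have [|U1 hU1 _] := @increments_le_of_variation _ a1 b1 (fun s => h (s, v)) Kv ab1.
  by move=> s ps; apply: hv; exact: variations_variation.
have [|U2 hU2 hU2K] := @increments_le_of_variation _ a2 b2 (fun t => h (u, t)) Ku ab2.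
  by move=> s ps; apply: hu; exact: variations_variation.
pose W x := W1 x + U1 x.
move: uab vab; rewrite !in_itv/= => uab vab.
have HW x y : a1 <= x -> x <= y -> y <= b1 ->
    bv_le a2 b2 (fun t => h (y, t) - h (x, t)) (W y - W x).
  move=> ax; rewrite le_eqVlt => /predU1P[<-|xy] yb.
    rewrite subrr; split; first by move=> t _ _; rewrite subrr normr0.
    exists (fun _ => 0); last by rewrite subrr.
    by move=> p q _ _ _; rewrite /= !subrr normr0.
  have [U DU UK] := increments_le_of_variation ab2 (fun t pt => W1D x y t ax xy yb pt).
  have h1 := hU1 x y ax (ltW xy) yb.
  have h0 := normr_ge0 (h (y, v) - h (x, v)).
  split; last by exists U => //; rewrite /W; lra.
  move=> t at_ tb; have tab : a2 <= t <= b2 by rewrite at_ tb.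
  have := increments_le_osc DU tab vab; rewrite /= => h2.
  have := ler_normD (h (y, t) - h (x, t) - (h (y, v) - h (x, v))) (h (y, v) - h (x, v)).
  rewrite subrK /W; lra.
have Wnd := strip_bv_mono (ltW ab2) HW.
pose K0 := `|h (u, a2)| + (U2 b2 - U2 a2).
have HK0 : bv_le a2 b2 (fun t => h (u, t)) K0.
  split; last by exists U2 => //; rewrite /K0; have := normr_ge0 (h (u, a2)); lra.
  move=> t at_ tb; have tab : a2 <= t <= b2 by rewrite at_ tb.
  have aab : a2 <= a2 <= b2 by rewrite lexx ltW.
  have := increments_le_osc hU2 tab aab; rewrite /= => h2.
  have := ler_normD (h (u, t) - h (u, a2)) (h (u, a2)).
  by rewrite subrK /K0; lra.
exists W, (K0 + (W b1 - W a1)); split => // x ax xb.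
move: uab => /andP[au ub]; have [xu|/ltW ux] := leP x u.
  apply: (@bv_le_weaken _ _ _ _ (K0 + `|-1| * (W u - W x))).
    apply: bv_le_ext (bv_leD HK0 (bv_leZ (-1) (ltW ab2) (HW x u ax xu ub))) => t /=; ring.
  rewrite normrN1 mul1r lerD2l; have := Wnd _ _ au ub (lexx b1).
  by have := Wnd _ _ (lexx a1) ax xb; lra.
apply: (@bv_le_weaken _ _ _ _ (K0 + (W x - W u))).
  apply: bv_le_ext (bv_leD HK0 (HW u x au ux xb)) => t /=; ring.
rewrite lerD2l; have := Wnd _ _ ax xb (lexx b1).
by have := Wnd _ _ (lexx a1) au ub; lra.
Qed.

End VitaliVariation.

(** * Jordan's theorem at a corner *)

Section LocalJordan.
Variable R : realType.
Local Notation leb := (@lebesgue_measure R).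

(** f is the difference of the nondecreasing functions W - W b and W - W b - f, of
    oscillation at most K and 2 K. *)
Lemma dominated_weight_bound (k f W : R -> R) (a b C K : R) :
  a < b -> measurable_fun setT k -> leb.-integrable `]a, b] (EFin \o k) ->
  (forall x, a <= x -> x <= b -> `|\int[leb]_(s in `]a, x]) k s| <= C) ->
  (forall x y, a < x -> x <= y -> y <= b -> `|f y - f x| <= W y - W x) ->
  (forall x, a < x -> x <= b -> W b - W x <= K) ->
  leb.-integrable `]a, b] (EFin \o (fun s => k s * f s)) /\
  `|\int[leb]_(s in `]a, b]) (k s * f s)| <= C * (`|f b| + 3 * K).
Proof.
move=> ab mk ki kC fW WK.
have [||i1 B1] := @monotone_weight_bound R k (fun s => W s - W b) a b C K ab mk ki kC.
- move=> x y ax xy yb; rewrite lerB//; have := fW _ _ ax xy yb.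
  by have := normr_ge0 (f y - f x); lra.
- by move=> x ax xb; rewrite opprB addrA subrK WK.
- have [||i2 B2] := @monotone_weight_bound R k (fun s => W s - W b - f s) a b C (2 * K) ab mk ki kC.
  + move=> x y ax xy yb; have := fW _ _ ax xy yb; have := ler_norm (f y - f x); lra.
  + move=> x ax xb; have := fW _ _ ax xb (lexx b); have := WK x ax xb.
    have := ler_norm (- (f b - f x)); rewrite normrN; lra.
  + have mD : measurable (`]a, b]%classic : set R) by exact: measurable_itv.
    have E : (fun s => k s * f s) = (fun s => k s * (W s - W b) - k s * (W s - W b - f s)).
      by apply/funext => s; ring.
    rewrite E; split; first exact: (line_integrableB mD i1 i2).
    rewrite RintegralB// (le_trans (ler_normB _ _))//.
    move: B1 B2; rewrite subrr normr0 sub0r normrN => B1 B2; lra.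
Qed.

Lemma sinc_weight_bound M (f W : R -> R) (b K : R) : 0 < M -> 0 < b ->
  (forall x y, 0 < x -> x <= y -> y <= b -> `|f y - f x| <= W y - W x) ->
  (forall x, 0 < x -> x <= b -> W b - W x <= K) ->
  leb.-integrable `]0, b] (EFin \o (fun s => sinc_kernel M s * f s)) /\
  `|\int[leb]_(s in `]0, b]) (sinc_kernel M s * f s)| <= 8 * (`|f b| + 3 * K).
Proof.
move=> M0 b0 fW WK; apply: (dominated_weight_bound (W := W)) => //.
- exact: measurable_sinc_kernel.
- exact: sinc_kernel_integrable (measurable_itv _) (leb_itv_lty 0 b false false).
- by move=> x x0 _; exact: sinc_integral_bound.
Qed.

(** On ]0, d] the value f d replaces f up to the oscillation eta, at the price
    24 eta, and the Dirichlet integral replaces its limit pi/2 up to 2 / (M d); on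
    ]d, b] the integrals of the kernel are at most 4 / (M d). *)
Lemma jordan_estimate M (f W : R -> R) (b d eta : R) : 0 < M -> 0 < d -> d <= b ->
  increments_le 0 b f W ->
  (forall x, 0 < x -> x <= d -> W d - W x <= eta) ->
  `|\int[leb]_(s in `]0, b]) (sinc_kernel M s * f s) - pi / 2 * f d| <=
  24 * eta + (2 * `|f d| + 4 * (`|f b| + 3 * (W b - W d))) / (M * d).
Proof.
move=> M0 d0 db fW Weta; have b0 : 0 < b by lra.
have Wnd x y : 0 <= x -> x <= y -> y <= b -> W x <= W y by exact: increments_le_mono fW.
have ki : leb.-integrable `]0, d] (EFin \o sinc_kernel M).
  exact: sinc_kernel_integrable (measurable_itv _) (leb_itv_lty 0 d false false).
have fi : leb.-integrable `]0, b] (EFin \o (fun s => sinc_kernel M s * f s)).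
  have [||//] := @sinc_weight_bound M f W b (W b - W 0) M0 b0.
    by move=> x y x0 xy yb; apply: fW => //; exact: ltW.
  by move=> x x0 xb; rewrite lerB// Wnd// ltW.
have mid := @measurable_itv R (Interval (BRight 0) (BRight d)).
have fid : leb.-integrable `]0, d] (EFin \o (fun s => sinc_kernel M s * f s)).
  by apply: integrableS fi => //; apply: subset_itvl; rewrite bnd_simp.
have -> : \int[leb]_(s in `]0, b]) (sinc_kernel M s * f s) =
    \int[leb]_(s in `]0, d]) (sinc_kernel M s * f s) +
    \int[leb]_(s in `]d, b]) (sinc_kernel M s * f s).
  by rewrite -(@Rintegral_itvB R _ (BRight 0) (BRight b) d)// ?bnd_simp ?(ltW d0)//; ring.
have far : `|\int[leb]_(s in `]d, b]) (sinc_kernel M s * f s)| <=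
    4 / (M * d) * (`|f b| + 3 * (W b - W d)).
  move: db; rewrite le_eqVlt => /predU1P[<-|db].
    rewrite set_itv_ge ?bnd_simp// Rintegral_set0 normr0 subrr mulr0 addr0.
    by rewrite mulr_ge0// divr_ge0// mulr_ge0// ltW.
  have [|||||_ //] := @dominated_weight_bound (sinc_kernel M) f W d b (4 / (M * d)) (W b - W d) db.
  - exact: measurable_sinc_kernel.
  - exact: sinc_kernel_integrable (measurable_itv _) (leb_itv_lty d b false false).
  - by move=> x dx _; exact: sinc_integral_tail_bound.
  - by move=> x y dx xy yb; apply: fW => //; rewrite ltW// (lt_trans d0).
  - by move=> x dx xb; rewrite lerB// Wnd// ?(ltW dx)// ltW.
have near0 : `|\int[leb]_(s in `]0, d]) (sinc_kernel M s * (f s - f d))| <= 24 * eta.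
  have [|_] := @sinc_weight_bound M (fun s => f s - f d) W d eta M0 d0 _ Weta.
    move=> x y x0 xy yd; rewrite opprB addrA subrK.
    by apply: fW => //; [exact: ltW|exact: le_trans db].
  by rewrite subrr normr0 add0r mulrA -natrM.
have E : \int[leb]_(s in `]0, d]) (sinc_kernel M s * f s) =
    \int[leb]_(s in `]0, d]) (sinc_kernel M s * (f s - f d)) +
    (\int[leb]_(s in `]0, d]) sinc_kernel M s) * f d.
  rewrite -RintegralZr// -RintegralD//.
  - by apply: eq_Rintegral => s _; ring.
  - apply: (line_eq_integrable mid _ (line_integrableB mid fid (line_integrableZ (f d) mid ki))).
    by move=> s _; ring.
  - apply: (line_eq_integrable mid _ (line_integrableZ (f d) mid ki)).
    by move=> s _; ring.
rewrite E; set I0 := \int[leb]_(s in `]0, d]) (_ * (_ - _)); set S := \int[leb]_(s in `]0, d]) sinc_kernel M s.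
set F := \int[leb]_(s in `]d, b]) (sinc_kernel M s * f s).
have -> : I0 + S * f d + F - pi / 2 * f d = I0 + (S - pi / 2) * f d + F by ring.
have Sb : `|(S - pi / 2) * f d| <= 2 / (M * d) * `|f d|.
  by rewrite normrM ler_wpM2r// sinc_integral_estimate.
have -> : 24 * eta + (2 * `|f d| + 4 * (`|f b| + 3 * (W b - W d))) / (M * d) =
  24 * eta + 2 / (M * d) * `|f d| + 4 / (M * d) * (`|f b| + 3 * (W b - W d)) by ring.
rewrite (le_trans (ler_normD _ _))// lerD//.
by rewrite (le_trans (ler_normD _ _))// lerD.
Qed.

(** The inner integral [Phi N] has its increments bounded by those of 32 W whatever
    N is, because the increments of h in s are bounded by those of W in the norm of
    bounded variation.  Hence [jordan_estimate] in s holds uniformly in N, and it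
    remains to apply it to h (d, .) in t at one fixed d: the double limit exists
    without any relation between M and N. *)
Theorem double_jordan (h : R * R -> R) (b1 b2 l : R) : 0 < b1 -> 0 < b2 ->
  strip_bv 0 b1 0 b2 h ->
  h @ filter_prod (0 : R)^'+ (0 : R)^'+ --> l ->
  (fun MN : R * R => \int[leb]_(s in `]0, b1]) (sinc_kernel MN.1 s *
     \int[leb]_(t in `]0, b2]) (sinc_kernel MN.2 t * h (s, t))))
   @ filter_prod (+oo : set_system R) (+oo : set_system R) --> (pi / 2) ^+ 2 * l.
Proof.
move=> b10 b20 [W [K [hW hK]]] hl.
pose Phi N s := \int[leb]_(t in `]0, b2]) (sinc_kernel N t * h (s, t)).
have Wnd := strip_bv_mono (ltW b20) hW.
have bvb N (f : R -> R) L : 0 < N -> bv_le 0 b2 f L ->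
    leb.-integrable `]0, b2] (EFin \o (fun t => sinc_kernel N t * f t)) /\
    `|\int[leb]_(t in `]0, b2]) (sinc_kernel N t * f t)| <= 32 * L.
  move=> N0 [fL [U fU UL]].
  have [||i B] := @sinc_weight_bound N f U b2 L N0 b20.
  - by move=> x y x0 xy yb; apply: fU => //; exact: ltW.
  - move=> x x0 xb; apply: le_trans UL; rewrite lerB//.
    exact: (increments_le_mono fU (lexx 0) (ltW x0) xb).
  - split => //; have := fL b2 (ltW b20) (lexx b2); lra.
have PhiW N : 0 < N -> increments_le 0 b1 (Phi N) (fun x => 32 * W x).
  move=> N0 x y x0 xy yb.
  have [ix _] := bvb N _ _ N0 (hK x x0 (le_trans xy yb)).
  have [iy _] := bvb N _ _ N0 (hK y (le_trans x0 xy) yb).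
  have [_ B] := bvb N _ _ N0 (hW x y x0 xy yb).
  rewrite /Phi -RintegralB// -mulrBr; apply: le_trans B.
  rewrite le_eqVlt; apply/orP; left; apply/eqP.
  by congr (`|_|); apply: eq_Rintegral => t _; rewrite mulrBr.
have PhiK N x : 0 < N -> 0 <= x -> x <= b1 -> `|Phi N x| <= 32 * K.
  by move=> N0 x0 xb; have [_] := bvb N _ _ N0 (hK x x0 xb).
apply/cvgrPdist_le => e e0.
pose eta := e / 4000; have eta0 : 0 < eta by rewrite /eta; lra.
have [d /andP[d0 db] Wd] := nondecreasing_at_right_limit b10 Wnd eta0.
have [_ [U hU UK]] := hK d (ltW d0) db.
have Und x y : 0 <= x -> x <= y -> y <= b2 -> U x <= U y by exact: increments_le_mono hU.
have [c /andP[c0 cb] Uc] := nondecreasing_at_right_limit b20 Und eta0.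
have hdc : `|h (d, c) - l| <= 3 * eta.
  have right_itv (r : R) : 0 < r -> (0 : R)^'+ `]0, r[%classic.
    move=> r0; near=> z; rewrite /= in_itv/=; apply/andP; split; near: z.
      exact: nbhs_right_gt.
    exact: nbhs_right_lt.
  have P1 : filter_prod (0 : R)^'+ (0 : R)^'+ (`]0, d[%classic `*` `]0, c[%classic).
    by exists (`]0, d[%classic, `]0, c[%classic) => //=; split; apply: right_itv.
  move/cvgrPdist_lt : hl => /(_ _ eta0) P2.
  have [[x t] [/= [] /= + + hxt]] := filter_ex (filterI P1 P2).
  rewrite !in_itv/= => /andP[x0 xd] /andP[t0 tc].
  have tb : t <= b2 by rewrite (le_trans (ltW tc)).
  have [H _] := hW x d (ltW x0) (ltW xd) db.
  have h1 := le_trans (H t (ltW t0) tb) (Wd x x0 (ltW xd)).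
  have h2 := le_trans (hU t c (ltW t0) (ltW tc) cb) (Uc t t0 (ltW tc)).
  have := ler_normD (h (d, c) - h (d, t)) (h (d, t) - h (x, t) + (h (x, t) - l)).
  have := ler_normD (h (d, t) - h (x, t)) (h (x, t) - l).
  rewrite !subrKA (distrC (h (x, t))); move: h1 h2 hxt; lra.
(* c1 / M and c2 / N bound the terms of order 1/M and 1/N in the two uses of
   jordan_estimate; c1 is free of N *)
pose c1 := (64 * K + 4 * (32 * K + 96 * (W b1 - W d))) / d.
pose c2 := (2 * `|h (d, c)| + 4 * (`|h (d, b2)| + 3 * (U b2 - U c))) / c.
have right_inv (r : R) : \forall M \near +oo, r / M <= e / 8.
  near=> M; have M0 : 0 < M by near: M; apply: nbhs_pinfty_gt; exact: num_real.
  rewrite ler_pdivrMr// -ler_pdivrMl; last lra.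
  by near: M; apply: nbhs_pinfty_ge; exact: num_real.
exists ([set M | 0 < M /\ c1 / M <= e / 8], [set N | 0 < N /\ c2 / N <= e / 8]).
  have pos0 : \forall M \near +oo, (0 : R) < M by apply: nbhs_pinfty_gt; exact: num_real.
  by split; apply: filterI => //; exact: right_inv.
move=> [M N] [/= [M0 Mc] [N0 Nc]].
have E1 : `|\int[leb]_(s in `]0, b1]) (sinc_kernel M s * Phi N s) - pi / 2 * Phi N d|
    <= 24 * (32 * eta) + c1 / M.
  apply: (le_trans (jordan_estimate M0 d0 db (PhiW N N0) _ (eta := 32 * eta))).
    by move=> x x0 xd; rewrite -mulrBr ler_pM2l// Wd.
  rewrite lerD2l /c1 -!mulrA -invfM (mulrC d) ler_wpM2r//.
    by rewrite invr_ge0 mulr_ge0// ltW.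
  have := PhiK N d N0 (ltW d0) db; have := PhiK N b1 N0 (ltW b10) (lexx b1); lra.
have E2 : `|Phi N d - pi / 2 * h (d, c)| <= 24 * eta + c2 / N.
  apply: (le_trans (jordan_estimate N0 c0 cb hU Uc)).
  by rewrite lerD2l /c2 -!mulrA -invfM (mulrC c).
have pi0 := @pi_ge0 R; have pi2 := @pihalf_lt2 R.
set J := \int[leb]_(s in _) _ in E1 *.
set p := pi / 2 in E1 E2 pi2 *.
have p0 : 0 <= p by rewrite /p; lra.
rewrite distrC.
have -> : J - p ^+ 2 * l = (J - p * Phi N d) + p * (Phi N d - p * h (d, c)) +
   p ^+ 2 * (h (d, c) - l) by ring.
have E3 : `|p * (Phi N d - p * h (d, c))| <= 2 * (24 * eta + c2 / N).
  by rewrite normrM ler_pM// ger0_norm// ltW.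
have E4 : `|p ^+ 2 * (h (d, c) - l)| <= 4 * (3 * eta).
  rewrite normrM ler_pM// ger0_norm ?sqr_ge0// expr2 (_ : 4 = 2 * 2); last ring.
  by rewrite ler_pM// ltW.
have T1 := ler_normD (J - p * Phi N d + p * (Phi N d - p * h (d, c))) (p ^+ 2 * (h (d, c) - l)).
have T2 := ler_normD (J - p * Phi N d) (p * (Phi N d - p * h (d, c))).
have etaE : 4000 * eta = e by rewrite /eta; field.
lra.
Unshelve. all: by end_near. Qed.

End LocalJordan.

(** * The Riemann-Lebesgue lemma on the plane, and folding at a point *)

Section PlaneRiemannLebesgue.
Variable R : realType.
Local Notation leb := (@lebesgue_measure R).
Local Notation leb2 := (leb \x leb)%E.
Local Notation mR := (measurableTypeR R).

Lemma sin_le1_norm (x : R) : `|sin x| <= 1.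
Proof. by rewrite ler_norml sin_geN1 sin_le1. Qed.

Lemma measurable_sinM1 M : measurable_fun setT (fun p : R * R => sin (M * p.1)).
Proof.
have ms : measurable_fun setT (fun t : R => sin (M * t)).
  by apply: continuous_measurable_fun; exact: continuous_sinM.
exact: (measurableT_comp ms measurable_fst).
Qed.

Lemma measurable_sinM2 M : measurable_fun setT (fun p : R * R => sin (M * p.2)).
Proof.
have ms : measurable_fun setT (fun t : R => sin (M * t)).
  by apply: continuous_measurable_fun; exact: continuous_sinM.
exact: (measurableT_comp ms measurable_snd).
Qed.

Lemma patch_EFin (T : Type) (f : T -> R) (D : set T) :
  EFin \o (f \_ D) = (EFin \o f) \_ D.
Proof. by apply/funext => p; rewrite /= !patchE; case: ifP. Qed.

(** For almost every s the inner integral tends to 0 by the lemma on the line, and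
    it is dominated by the integral of |F (s, .)|. *)
Lemma inner_RL (F : R * R -> R) : leb2.-integrable setT (EFin \o F) ->
  \int[leb]_s `|\int[leb]_t (sin (N * t) * F (s, t))| @[N --> +oo] --> 0.
Proof.
move=> Fi; apply/cvg_pinftyP => u uoo.
have Fi' : leb2.-integrable (setT `*` setT) (EFin \o F) by rewrite setXTT.
have sFi n : leb2.-integrable (setT `*` setT) (EFin \o (fun p => sin (u n * p.2) * F p)).
  apply: (plane_integrable_bounded_mul (B := 1)) => //; first exact: measurableX.
    exact: measurable_funTS (measurable_sinM2 _).
  by move=> p _; exact: sin_le1_norm.
have ii n := plane_integrable_Rintegral1 measurableT measurableT (sFi n).
have ni : leb2.-integrable (setT `*` setT) (EFin \o (fun p => `|F p|)).
  exact: integrable_norm Fi'.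
have gi := plane_integrable_Rintegral1 measurableT measurableT ni.
have cv : {ae leb, forall s, setT s ->
   (`|\int[leb]_t (sin (u n * t) * F (s, t))|)%:E @[n --> \oo] --> 0%:E}.
  apply: line_ae_imply (plane_ae_integrable_section1 measurableT measurableT Fi') => s /(_ I) si _.
  apply/fine_cvgP; split; first by near=> n.
  rewrite -[X in _ --> X](@normr0 _ R); apply: cvg_norm.
  by move/Riemann_Lebesgue/cvg_pinftyP : si; exact.
have bd : {ae leb, forall s n, setT s ->
   (`|(`|(\int[leb]_t (sin (u n * t) * F (s, t)))%R|)%:E| <=
   (EFin \o (fun s => (\int[leb]_t `|F (s, t)|)%R)) s)%E}.
  apply: line_ae_imply (plane_ae_integrable_section1 measurableT measurableT Fi') => s /(_ I) si n _.
  rewrite lee_fin normr_id -[leRHS]mul1r; apply: line_le_norm_weight => //.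
    by apply: continuous_measurable_fun; exact: continuous_sinM.
  by move=> t _; exact: sin_le1_norm.
have [_ _ /=] := @dominated_convergence _ mR R leb setT measurableT
   (fun n s => (`|\int[leb]_t (sin (u n * t) * F (s, t))|)%:E) (cst 0%E) _
   (fun n => (measurable_EFinP _ _).2 (measurableT_comp (@normr_measurable R setT)
      ((measurable_EFinP _ _).1 (measurable_int _ (ii n))))) (measurable_cst _) cv gi bd.
by rewrite integral0 => /fine_cvg.
Unshelve. all: by end_near. Qed.

(** The integral over s is at most that of the modulus of the integral over t,
    whatever M is; so [inner_RL] gives the limit in N uniformly in M. *)
Theorem plane_Riemann_Lebesgue (F : R * R -> R) (D : set (R * R)) : measurable D ->
  leb2.-integrable D (EFin \o F) ->
  (fun MN : R * R => \int[leb2]_(p in D) (sin (MN.1 * p.1) * sin (MN.2 * p.2) * F p))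
    @ filter_prod (+oo : set_system R) (+oo : set_system R) --> (0 : R).
Proof.
move=> mD FD; pose G := F \_ D.
have Gi : leb2.-integrable setT (EFin \o G).
  by rewrite /G patch_EFin; exact/(integrable_mkcond _ _).1.
have Gi' : leb2.-integrable (setT `*` setT) (EFin \o G) by rewrite setXTT.
have sGi N : leb2.-integrable (setT `*` setT) (EFin \o (fun p => sin (N * p.2) * G p)).
  apply: (plane_integrable_bounded_mul (B := 1)) => //; first exact: measurableX.
    exact: measurable_funTS (measurable_sinM2 _).
  by move=> p _; exact: sin_le1_norm.
have ssGi M N : leb2.-integrable (setT `*` setT)
    (EFin \o (fun p => sin (M * p.1) * (sin (N * p.2) * G p))).
  apply: (plane_integrable_bounded_mul (B := 1)) => //; first exact: measurableX.
    exact: measurable_funTS (measurable_sinM1 _).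
  by move=> p _; exact: sin_le1_norm.
have key M N : `|\int[leb2]_(p in D) (sin (M * p.1) * sin (N * p.2) * F p)| <=
    \int[leb]_s `|\int[leb]_t (sin (N * t) * G (s, t))|.
  have -> : \int[leb2]_(p in D) (sin (M * p.1) * sin (N * p.2) * F p) =
      \int[leb2]_(p in setT `*` setT) (sin (M * p.1) * (sin (N * p.2) * G p)).
    rewrite setXTT Rintegral_mkcond; apply: eq_Rintegral => p _.
    by rewrite /G !patchE; case: ifP => _; rewrite ?mulr0// mulrA.
  rewrite (plane_Rintegral12 measurableT measurableT (ssGi M N))/=.
  have ii := plane_integrable_Rintegral1 measurableT measurableT (sGi N).
  have -> : \int[leb]_s \int[leb]_t (sin (M * s) * (sin (N * t) * G (s, t))) =
      \int[leb]_s (sin (M * s) * \int[leb]_t (sin (N * t) * G (s, t))).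
    apply: (@ae_eq_lower_Rintegral _ mR R leb) => //.
    apply: line_ae_imply (plane_ae_integrable_section1 measurableT measurableT (sGi N)).
    by move=> s /(_ I) si _; rewrite RintegralZl.
  rewrite -[leRHS]mul1r; apply: line_le_norm_weight => //.
    by apply: continuous_measurable_fun; exact: continuous_sinM.
  by move=> t _; exact: sin_le1_norm.
apply/cvgr0Pnorm_lt => e e0.
have /cvgr0Pnorm_lt/(_ _ e0) H := inner_RL Gi.
exists (setT, [set N | `|\int[leb]_s `|\int[leb]_t (sin (N * t) * G (s, t))| | < e]).
  by split => //; exact: filterT.
move=> [M N] [/= _ HN]; apply: le_lt_trans (key M N) (le_lt_trans (ler_norm _) HN).
Qed.

End PlaneRiemannLebesgue.

Section Folding.
Variable R : realType.
Local Notation leb := (@lebesgue_measure R).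
Local Notation leb2 := (leb \x leb)%E.
Local Notation Q := (`]0, +oo[%classic `*` `]0, +oo[%classic).

Lemma leb2_cross0 (x0 y0 : R) : leb2.-negligible [set p | p.1 = x0 \/ p.2 = y0].
Proof.
have H1 : leb2 ([set x0] `*` [set: R]) = 0%E.
  rewrite product_measure1E//; transitivity (0 * leb [set: R])%E; last by rewrite mul0e.
  by congr (_ * _)%E; exact: lebesgue_measure_set1.
have H2 : leb2 ([set: R] `*` [set y0]) = 0%E.
  rewrite product_measure1E//; transitivity (leb [set: R] * 0)%E; last by rewrite mule0.
  by congr (_ * _)%E; exact: lebesgue_measure_set1.
have N1 : leb2.-negligible ([set x0] `*` [set: R]).
  by exists ([set x0] `*` [set: R]); split => //; exact: measurableX.
have N2 : leb2.-negligible ([set: R] `*` [set y0]).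
  by exists ([set: R] `*` [set y0]); split => //; exact: measurableX.
apply: negligibleS (negligibleU N1 N2).
by move=> [x y] /= [->|->]; [left|right].
Qed.

Lemma Rintegral_fold (x0 y0 : R) (F : R * R -> R) : leb2.-integrable setT (EFin \o F) ->
  \int[leb2]_p F p = \int[leb2]_(p in Q)
    (F (x0 - p.1, y0 - p.2) + F (x0 + p.1, y0 + p.2) +
     F (x0 - p.1, y0 + p.2) + F (x0 + p.1, y0 - p.2)).
Proof.
move=> Fi.
pose S k l : set (R * R) := [set p | 0 < k * (p.1 - x0) /\ 0 < l * (p.2 - y0)].
have mQ : measurable (Q : set (R * R)) by apply: measurableX.
have mS k l : measurable (S k l).
  have m1 : measurable_fun setT (fun p : R * R => k * (p.1 - x0)).
    by apply: measurable_funM => //; apply: measurable_funB.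
  have m2 : measurable_fun setT (fun p : R * R => l * (p.2 - y0)).
    by apply: measurable_funM => //; apply: measurable_funB.
  have := measurableI _ _ (m1 measurableT `]0, +oo[%classic (measurable_itv _))
    (m2 measurableT `]0, +oo[%classic (measurable_itv _)).
  rewrite !setTI (_ : _ `&` _ = S k l)//; apply/seteqP.
  by split => p; rewrite /S/= !in_itv/= !andbT.
have FS k l : leb2.-integrable setT (EFin \o (F \_ (S k l))).
  rewrite patch_EFin; apply/(integrable_mkcond _ _).1; first exact: mS.
  exact: (plane_integrableS measurableT (mS k l) _ Fi).
have FQ k l : (k = 1 \/ k = -1) -> (l = 1 \/ l = -1) ->
    leb2.-integrable Q (EFin \o (fun p => F (x0 + k * p.1, y0 + l * p.2))) /\
    \int[leb2]_p (F \_ (S k l)) p = \int[leb2]_(p in Q) F (x0 + k * p.1, y0 + l * p.2).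
  move=> kE lE; split.
    exact: (plane_integrableS measurableT mQ _ (integrable_plane_reflection x0 y0 kE lE Fi)).
  rewrite -(Rintegral_plane_reflection x0 y0 kE lE (FS k l)) [RHS]Rintegral_mkcond.
  apply: eq_Rintegral => p _; rewrite !patchE /plane_reflection/=.
  have kk : k * k = 1 by case: kE => ->; rewrite ?mulrNN mul1r.
  have ll : l * l = 1 by case: lE => ->; rewrite ?mulrNN mul1r.
  congr (if _ then _ else _); apply/idP/idP => /set_mem H; apply/mem_set; move: H;
  by rewrite /S/= !in_itv/= !andbT ![_ + _ * _]addrC !addrK !mulrA kk ll !mul1r.
have [i1 E1] := FQ (-1) (-1) (or_intror erefl) (or_intror erefl).
have [i2 E2] := FQ 1 1 (or_introl erefl) (or_introl erefl).
have [i3 E3] := FQ (-1) 1 (or_intror erefl) (or_introl erefl).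
have [i4 E4] := FQ 1 (-1) (or_introl erefl) (or_intror erefl).
transitivity (\int[leb2]_p ((F \_ (S (-1) (-1))) p + (F \_ (S 1 1)) p +
   (F \_ (S (-1) 1)) p + (F \_ (S 1 (-1))) p)).
  apply: ae_eq_lower_Rintegral => //.
  apply: (negligibleS _ (leb2_cross0 x0 y0)) => p /= H.
  apply: contrapT => /not_orP[/eqP px /eqP py]; apply: H => _.
  have nS k l : ~ (0 < k * (p.1 - x0) /\ 0 < l * (p.2 - y0)) -> (F \_ (S k l)) p = 0.
    by move=> H; rewrite patchE memNset.
  have yS k l : (0 < k * (p.1 - x0) /\ 0 < l * (p.2 - y0)) -> (F \_ (S k l)) p = F p.
    by move=> H; rewrite patchE mem_set.
  case: (ltgtP p.1 x0) px => // px _; case: (ltgtP p.2 y0) py => // py _.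
  - rewrite (yS (-1) (-1)); last by clear -px py; split; lra.
    rewrite (nS (-1) 1); last by clear -px py; case; lra.
    rewrite (nS 1 (-1)); last by clear -px py; case; lra.
    rewrite (nS 1 1); last by clear -px py; case; lra.
    by rewrite ?(add0r, addr0).
  - rewrite (yS (-1) 1); last by clear -px py; split; lra.
    rewrite (nS (-1) (-1)); last by clear -px py; case; lra.
    rewrite (nS 1 (-1)); last by clear -px py; case; lra.
    rewrite (nS 1 1); last by clear -px py; case; lra.
    by rewrite ?(add0r, addr0).
  - rewrite (yS 1 (-1)); last by clear -px py; split; lra.
    rewrite (nS (-1) (-1)); last by clear -px py; case; lra.
    rewrite (nS (-1) 1); last by clear -px py; case; lra.
    rewrite (nS 1 1); last by clear -px py; case; lra.
    by rewrite ?(add0r, addr0).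
  - rewrite (yS 1 1); last by clear -px py; split; lra.
    rewrite (nS (-1) (-1)); last by clear -px py; case; lra.
    rewrite (nS (-1) 1); last by clear -px py; case; lra.
    rewrite (nS 1 (-1)); last by clear -px py; case; lra.
    by rewrite ?(add0r, addr0).
have j1 := plane_integrableD measurableT (FS (-1) (-1)) (FS 1 1).
have j2 := plane_integrableD measurableT j1 (FS (-1) 1).
rewrite (plane_RintegralD measurableT j2 (FS 1 (-1))) (plane_RintegralD measurableT j1 (FS (-1) 1)).
rewrite (plane_RintegralD measurableT (FS (-1) (-1)) (FS 1 1)) E1 E2 E3 E4.
have k1 := plane_integrableD mQ i1 i2.
have k2 := plane_integrableD mQ k1 i3.
rewrite -(plane_RintegralD mQ i1 i2) -(plane_RintegralD mQ k1 i3) -(plane_RintegralD mQ k2 i4).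
by apply: eq_Rintegral => p _; rewrite !mulN1r !mul1r.
Qed.

End Folding.

(** * The three outer parts of a quadrant *)

Section QuadrantParts.
Variable R : realType.
Local Notation leb := (@lebesgue_measure R).
Local Notation leb2 := (leb \x leb)%E.
Local Notation mR := (measurableTypeR R).
Local Notation oo2 := (filter_prod (+oo : set_system R) (+oo : set_system R)).

Definition sinc2 (MN p : R * R) : R := sinc_kernel MN.1 p.1 * sinc_kernel MN.2 p.2.

Lemma measurable_sinc2 MN : measurable_fun setT (sinc2 MN).
Proof.
by apply: measurable_funM; [exact: (measurableT_comp (measurable_sinc_kernel _) measurable_fst)
                           |exact: (measurableT_comp (measurable_sinc_kernel _) measurable_snd)].
Qed.

Lemma sinc2_bound MN p : `|sinc2 MN p| <= `|MN.1| * `|MN.2|.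
Proof. by rewrite normrM ler_pM// sinc_kernel_bound. Qed.

Lemma sinc2_integrable MN (D : set (R * R)) (h : R * R -> R) : measurable D ->
  leb2.-integrable D (EFin \o h) ->
  leb2.-integrable D (EFin \o (fun p => sinc2 MN p * h p)).
Proof.
move=> mD; apply: plane_integrable_bounded_mul => //.
  by apply: measurable_funTS; exact: measurable_sinc2.
by move=> p _; exact: sinc2_bound.
Qed.

Lemma measurable_inv1 : measurable_fun setT (fun p : R * R => p.1^-1).
Proof. exact: (measurableT_comp (@measurable_inv R) measurable_fst). Qed.

Lemma measurable_inv2 : measurable_fun setT (fun p : R * R => p.2^-1).
Proof. exact: (measurableT_comp (@measurable_inv R) measurable_snd). Qed.

Lemma RL_on (f : R -> R) (D : set R) : measurable D -> leb.-integrable D (EFin \o f) ->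
  \int[leb]_(t in D) (sin (M * t) * f t) @[M --> +oo] --> 0.
Proof.
move=> mD fi.
have fi' : leb.-integrable setT (EFin \o (f \_ D)).
  by rewrite patch_EFin; exact/(integrable_mkcond _ _).1.
apply: cvg_trans (Riemann_Lebesgue fi'); apply: near_eq_cvg; near=> M.
rewrite [RHS]Rintegral_mkcond; apply: eq_Rintegral => t _.
by rewrite !patchE; case: ifP => _; rewrite ?mulr0.
Unshelve. all: by end_near. Qed.

Lemma itv_lower_bound (e t : R) : t \in `]e, +oo[ -> 0 < e -> `|t^-1| <= e^-1.
Proof.
rewrite in_itv/= andbT => et e0; have t0 : 0 < t by exact: lt_trans et.
rewrite ger0_norm; last by rewrite invr_ge0 ltW.
by rewrite lef_pV2 ?posrE// ltW.
Qed.

Lemma far_corner_cvg (e1 e2 : R) (h : R * R -> R) : 0 < e1 -> 0 < e2 ->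
  let D := `]e1, +oo[%classic `*` `]e2, +oo[%classic in
  leb2.-integrable D (EFin \o h) ->
  (fun MN : R * R => \int[leb2]_(p in D) (sinc2 MN p * h p)) @ oo2 --> (0 : R).
Proof.
move=> e10 e20 D hi; have mD : measurable D by exact: measurableX.
have Fi : leb2.-integrable D (EFin \o (fun p => p.1^-1 * (p.2^-1 * h p))).
  apply: (plane_integrable_bounded_mul (B := e1^-1)) => //.
    by apply: measurable_funTS; exact: measurable_inv1.
    by move=> p [p1 _]; exact: itv_lower_bound.
  apply: (plane_integrable_bounded_mul (B := e2^-1)) => //.
    by apply: measurable_funTS; exact: measurable_inv2.
  by move=> p [_ p2]; exact: itv_lower_bound.
apply: cvg_trans (plane_Riemann_Lebesgue mD Fi); apply: near_eq_cvg; near=> MN.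
by apply: eq_Rintegral => p _; rewrite /sinc2 /sinc_kernel; ring.
Unshelve. all: by end_near. Qed.

Lemma Rintegral_tensor (D1 D2 : set R) (f g : R -> R) : measurable D1 -> measurable D2 ->
  measurable_fun setT f -> measurable_fun setT g ->
  leb.-integrable D1 (EFin \o f) -> leb.-integrable D2 (EFin \o g) ->
  \int[leb2]_(p in D1 `*` D2) (f p.1 * g p.2) =
  \int[leb]_(x in D1) f x * \int[leb]_(y in D2) g y.
Proof.
move=> mD1 mD2 mf mg fi gi.
rewrite (plane_Rintegral12 mD1 mD2 (plane_integrable_tensor mD1 mD2 mf mg fi gi))/=.
rewrite -RintegralZr//; apply: eq_Rintegral => x _.
by rewrite RintegralZl.
Qed.

Lemma cvg_bounded_mul0 (f g : R * R -> R) (B : R) :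
  (\forall p \near oo2, `|f p| <= B) -> g @ oo2 --> (0 : R) ->
  (fun p => f p * g p) @ oo2 --> (0 : R).
Proof.
move=> fB g0; apply/cvgr0Pnorm_lt => e e0.
have B1 : 0 < `|B| + 1 by rewrite ltr_wpDl.
have eB : 0 < e / (`|B| + 1) by rewrite divr_gt0.
move/cvgr0Pnorm_lt : g0 => /(_ _ eB) g0.
near=> p.
have fp : `|f p| <= B by near: p.
have gp : `|g p| < e / (`|B| + 1) by near: p.
rewrite normrM; apply: (@le_lt_trans _ _ ((`|B| + 1) * `|g p|)).
  by rewrite ler_wpM2r// (le_trans fp)// (le_trans (ler_norm _))// lerDl.
by rewrite mulrC -ltr_pdivlMr.
Unshelve. all: by end_near. Qed.

Lemma sinc_integral0_near_bound (e : R) : 0 <= e ->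
  \forall MN \near oo2, `|\int[leb]_(s in `]0, e]) sinc_kernel MN.1 s| <= 4.
Proof.
move=> e0; exists ([set M | 0 < M], setT).
  by split; [apply: nbhs_pinfty_gt; exact: num_real|exact: filterT].
by move=> [M N] [/= M0 _]; exact: sinc_integral0_bound.
Qed.

Lemma sinc_integral0_near_bound2 (e : R) : 0 <= e ->
  \forall MN \near oo2, `|\int[leb]_(s in `]0, e]) sinc_kernel MN.2 s| <= 4.
Proof.
move=> e0; exists (setT, [set M | 0 < M]).
  by split; [exact: filterT|apply: nbhs_pinfty_gt; exact: num_real].
by move=> [M N] [_ /= M0]; exact: sinc_integral0_bound.
Qed.

Lemma integrable_divr (e : R) (g : R -> R) : 0 < e -> leb.-integrable setT (EFin \o g) ->
  leb.-integrable `]e, +oo[ (EFin \o (fun t => t^-1 * g t)).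
Proof.
move=> e0 gi; apply: (line_integrable_bounded_mul (B := e^-1)) => //.
- by apply: measurable_funTS; exact: measurable_inv.
- by move=> t te; exact: itv_lower_bound.
- exact: line_integrableS gi.
Qed.

Section strips.
Variables (e1 e2 : R) (H H' : R * R -> R).
Hypotheses (e10 : 0 < e1) (e20 : 0 < e2).
Hypothesis mH' : measurable_fun setT H'.
Hypothesis HH' : {ae leb2, forall p, H p = H' p}.

Section strip1.
Variables (a : R) (g : R -> R) (G : R -> R -> R).
Hypotheses (mg : measurable_fun setT g) (gi : leb.-integrable setT (EFin \o g)).
Hypothesis Hg : {ae leb, forall t, H (a, t) = g t}.
Hypothesis HG : forall s t, `|s^-1 * (H (s, t) - H (a, t))| <= G s t.
Hypothesis Gfin :
  (\int[leb]_(t in `[e2, +oo[) \int[leb]_(s in `[0%R, e1]) (G s t)%:E < +oo)%E.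

(** For almost every t the Borel functions H' and g agree with H and H (a, .) at
    almost every s, so that the bound of the class LC passes to them. *)
Lemma strip1_quotient_integrable :
  leb2.-integrable (`[0, e1]%classic `*` `[e2, +oo[%classic)
    (EFin \o (fun p => p.1^-1 * (H' p - g p.2))).
Proof.
have G0 s t : 0 <= G s t by exact: le_trans (HG s t).
apply: plane_integrable_rectangle21 => //.
  apply: measurable_funM; first exact: measurable_inv1.
  by apply: measurable_funB => //; exact: (measurableT_comp mg measurable_snd).
apply: le_lt_trans Gfin.
apply: (@ge0_ae_le_lower_integral _ mR R leb) => //.
- by move=> t _; apply: integral_ge0.
- by move=> t _; apply: integral_ge0 => s _; rewrite lee_fin.
have Hs := plane_ae_product2 HH'.
apply: line_ae_imply2 Hg Hs => t Hgt Hst _.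
apply: (@ge0_ae_le_lower_integral _ mR R leb) => //.
- by move=> s _; rewrite lee_fin.
apply: line_ae_imply Hst => s Est _; rewrite lee_fin -Est -Hgt; exact: HG.
Qed.

(** Write H' (s, t) = (H' (s, t) - g t) + g t.  The quotient of the first term by
    s t is integrable, and the Riemann-Lebesgue lemma on the plane applies; the
    second gives a product of two integrals, of which the one in s is at most 4 and
    the one in t tends to 0. *)
Lemma strip1_cvg :
  let D := `]0, e1]%classic `*` `]e2, +oo[%classic in
  leb2.-integrable D (EFin \o H') ->
  (fun MN : R * R => \int[leb2]_(p in D) (sinc2 MN p * H' p)) @ oo2 --> (0 : R).
Proof.
move=> D Hi.
have m1 := @measurable_itv R (Interval (BRight 0) (BRight e1)).
have m2 := @measurable_itv R (Interval (BRight e2) (BInfty _ false)).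
have mD : measurable D by exact: measurableX.
pose F p := p.2^-1 * (p.1^-1 * (H' p - g p.2)).
have Fi : leb2.-integrable D (EFin \o F).
  apply: (plane_integrable_bounded_mul (B := e2^-1)) => //.
    by apply: measurable_funTS; exact: measurable_inv2.
    by move=> p [_ p2]; exact: itv_lower_bound.
  apply: plane_integrableS strip1_quotient_integrable => //; first exact: measurableX.
  move=> p [/= p1 p2]; split => /=.
    by apply: subset_itvr p1; rewrite bnd_simp.
  by apply: subset_itvr p2; rewrite bnd_simp.
have gi2 : leb.-integrable `]e2, +oo[ (EFin \o g) by exact: line_integrableS gi.
have kgi N : leb.-integrable `]e2, +oo[ (EFin \o (fun t => sinc_kernel N t * g t)).
  apply: (line_integrable_bounded_mul (B := `|N|)) => //.
    by apply: measurable_funTS; exact: measurable_sinc_kernel.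
  by move=> t _; exact: sinc_kernel_bound.
have ki M : leb.-integrable `]0, e1] (EFin \o sinc_kernel M).
  exact: sinc_kernel_integrable m1 (leb_itv_lty 0 e1 false false).
have mkg N : measurable_fun setT (fun t => sinc_kernel N t * g t).
  by apply: measurable_funM => //; exact: measurable_sinc_kernel.
have split_ MN : \int[leb2]_(p in D) (sinc2 MN p * H' p) =
    \int[leb2]_(p in D) (sin (MN.1 * p.1) * sin (MN.2 * p.2) * F p) +
    (\int[leb]_(s in `]0, e1]) sinc_kernel MN.1 s) *
    (\int[leb]_(t in `]e2, +oo[) (sin (MN.2 * t) * (t^-1 * g t))).
  have -> : \int[leb]_(t in `]e2, +oo[) (sin (MN.2 * t) * (t^-1 * g t)) =
      \int[leb]_(t in `]e2, +oo[) (sinc_kernel MN.2 t * g t).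
    by apply: eq_Rintegral => t _; rewrite mulrA.
  rewrite -(Rintegral_tensor m1 m2 (measurable_sinc_kernel MN.1) (mkg MN.2) (ki _) (kgi _)).
  have ti := plane_integrable_tensor m1 m2 (measurable_sinc_kernel MN.1) (mkg MN.2) (ki _) (kgi _).
  rewrite -plane_RintegralD//.
    by apply: eq_Rintegral => p _; rewrite /F /sinc2 /sinc_kernel; ring.
  apply: (plane_eq_integrable mD _ (plane_integrableB mD (sinc2_integrable MN mD Hi) ti)).
  by move=> p _; rewrite /F /sinc2 /sinc_kernel; ring.
rewrite (_ : (fun MN : R * R => _) = (fun MN =>
    \int[leb2]_(p in D) (sin (MN.1 * p.1) * sin (MN.2 * p.2) * F p) +
    (\int[leb]_(s in `]0, e1]) sinc_kernel MN.1 s) *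
    (\int[leb]_(t in `]e2, +oo[) (sin (MN.2 * t) * (t^-1 * g t))))); last exact/funext.
rewrite -[X in _ --> X](addr0 (0 : R)); apply: cvgD; first exact: plane_Riemann_Lebesgue.
apply: cvg_bounded_mul0 (sinc_integral0_near_bound (ltW e10)) _.
apply: (cvg_comp (fun MN : R * R => MN.2)
  (fun N => \int[leb]_(t in `]e2, +oo[) (sin (N * t) * (t^-1 * g t)))); first exact: cvg_snd.
by apply: RL_on => //; exact: integrable_divr.
Qed.

End strip1.

Section strip2.
Variables (b : R) (g : R -> R) (G : R -> R -> R).
Hypotheses (mg : measurable_fun setT g) (gi : leb.-integrable setT (EFin \o g)).
Hypothesis Hg : {ae leb, forall s, H (s, b) = g s}.
Hypothesis HG : forall s t, `|t^-1 * (H (s, t) - H (s, b))| <= G s t.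
Hypothesis Gfin :
  (\int[leb]_(s in `[e1, +oo[) \int[leb]_(t in `[0%R, e2]) (G s t)%:E < +oo)%E.

Lemma strip2_quotient_integrable :
  leb2.-integrable (`[e1, +oo[%classic `*` `[0, e2]%classic)
    (EFin \o (fun p => p.2^-1 * (H' p - g p.1))).
Proof.
have G0 s t : 0 <= G s t by exact: le_trans (HG s t).
apply: plane_integrable_rectangle12 => //.
  apply: measurable_funM; first exact: measurable_inv2.
  by apply: measurable_funB => //; exact: (measurableT_comp mg measurable_fst).
apply: le_lt_trans Gfin.
apply: (@ge0_ae_le_lower_integral _ mR R leb) => //.
- by move=> t _; apply: integral_ge0.
- by move=> t _; apply: integral_ge0 => s _; rewrite lee_fin.
have Hs := plane_ae_product1 HH'.
apply: line_ae_imply2 Hg Hs => s Hgt Hst _.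
apply: (@ge0_ae_le_lower_integral _ mR R leb) => //.
- by move=> t _; rewrite lee_fin.
apply: line_ae_imply Hst => t Est _; rewrite lee_fin -Est -Hgt; exact: HG.
Qed.

Lemma strip2_cvg :
  let D := `]e1, +oo[%classic `*` `]0, e2]%classic in
  leb2.-integrable D (EFin \o H') ->
  (fun MN : R * R => \int[leb2]_(p in D) (sinc2 MN p * H' p)) @ oo2 --> (0 : R).
Proof.
move=> D Hi.
have m1 := @measurable_itv R (Interval (BRight e1) (BInfty _ false)).
have m2 := @measurable_itv R (Interval (BRight 0) (BRight e2)).
have mD : measurable D by exact: measurableX.
pose F p := p.1^-1 * (p.2^-1 * (H' p - g p.1)).
have Fi : leb2.-integrable D (EFin \o F).
  apply: (plane_integrable_bounded_mul (B := e1^-1)) => //.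
    by apply: measurable_funTS; exact: measurable_inv1.
    by move=> p [p1 _]; exact: itv_lower_bound.
  apply: plane_integrableS strip2_quotient_integrable => //; first exact: measurableX.
  move=> p [/= p1 p2]; split => /=.
    by apply: subset_itvr p1; rewrite bnd_simp.
  by apply: subset_itvr p2; rewrite bnd_simp.
have gi2 : leb.-integrable `]e1, +oo[ (EFin \o g) by exact: line_integrableS gi.
have kgi N : leb.-integrable `]e1, +oo[ (EFin \o (fun t => sinc_kernel N t * g t)).
  apply: (line_integrable_bounded_mul (B := `|N|)) => //.
    by apply: measurable_funTS; exact: measurable_sinc_kernel.
  by move=> t _; exact: sinc_kernel_bound.
have ki M : leb.-integrable `]0, e2] (EFin \o sinc_kernel M).
  exact: sinc_kernel_integrable m2 (leb_itv_lty 0 e2 false false).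
have mkg N : measurable_fun setT (fun t => sinc_kernel N t * g t).
  by apply: measurable_funM => //; exact: measurable_sinc_kernel.
have split_ MN : \int[leb2]_(p in D) (sinc2 MN p * H' p) =
    \int[leb2]_(p in D) (sin (MN.1 * p.1) * sin (MN.2 * p.2) * F p) +
    (\int[leb]_(t in `]0, e2]) sinc_kernel MN.2 t) *
    (\int[leb]_(s in `]e1, +oo[) (sin (MN.1 * s) * (s^-1 * g s))).
  have -> : \int[leb]_(t in `]e1, +oo[) (sin (MN.1 * t) * (t^-1 * g t)) =
      \int[leb]_(t in `]e1, +oo[) (sinc_kernel MN.1 t * g t).
    by apply: eq_Rintegral => t _; rewrite mulrA.
  rewrite [X in _ + X]mulrC.
  rewrite -(Rintegral_tensor m1 m2 (mkg MN.1) (measurable_sinc_kernel MN.2) (kgi _) (ki _)).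
  have ti := plane_integrable_tensor m1 m2 (mkg MN.1) (measurable_sinc_kernel MN.2) (kgi _) (ki _).
  rewrite -plane_RintegralD//.
    by apply: eq_Rintegral => p _; rewrite /F /sinc2 /sinc_kernel; ring.
  apply: (plane_eq_integrable mD _ (plane_integrableB mD (sinc2_integrable MN mD Hi) ti)).
  by move=> p _; rewrite /F /sinc2 /sinc_kernel; ring.
rewrite (_ : (fun MN : R * R => _) = (fun MN =>
    \int[leb2]_(p in D) (sin (MN.1 * p.1) * sin (MN.2 * p.2) * F p) +
    (\int[leb]_(t in `]0, e2]) sinc_kernel MN.2 t) *
    (\int[leb]_(s in `]e1, +oo[) (sin (MN.1 * s) * (s^-1 * g s))))); last exact/funext.
rewrite -[X in _ --> X](addr0 (0 : R)); apply: cvgD; first exact: plane_Riemann_Lebesgue.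
apply: cvg_bounded_mul0 (sinc_integral0_near_bound2 (ltW e20)) _.
apply: (cvg_comp (fun MN : R * R => MN.1)
  (fun N => \int[leb]_(t in `]e1, +oo[) (sin (N * t) * (t^-1 * g t)))); first exact: cvg_fst.
by apply: RL_on => //; exact: integrable_divr.
Qed.

End strip2.
End strips.

End QuadrantParts.

(** * The Dirichlet limit at a point of the plane *)

Definition integrable_version d (T : measurableType d) (R : realType)
    (m : {measure set T -> \bar R}) (f : T -> R) := exists g : T -> R,
  [/\ measurable_fun setT g, m.-integrable setT (EFin \o g) & {ae m, forall t, f t = g t}].

Section PlaneInversion.
Variable R : realType.
Local Notation leb := (@lebesgue_measure R).
Local Notation leb2 := (leb \x leb)%E.
Local Notation mR := (measurableTypeR R).
Local Notation oo2 := (filter_prod (+oo : set_system R) (+oo : set_system R)).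
Local Notation Q := ((`]0, +oo[%classic : set R) `*` (`]0, +oo[%classic : set R)).

Lemma plane_Rintegral_setU (A B : set (R * R)) (f : R * R -> R) :
  measurable A -> measurable B -> A `&` B = set0 ->
  leb2.-integrable (A `|` B) (EFin \o f) ->
  \int[leb2]_(p in A `|` B) f p = \int[leb2]_(p in A) f p + \int[leb2]_(p in B) f p.
Proof.
move=> mA mB AB fi; apply: (@Rintegral_setU _ (mR * mR)%type R leb2) => //.
exact/disj_set2P.
Qed.

(** The class LC for one component.  In the application G is the modulus of the
    quaternion quotient, so that only an upper integral of the quotient of the
    component is known to be finite. *)
Definition strip_tame (e1 e2 : R) (H : R * R -> R) := exists a b,
  [/\ integrable_version leb (fun t => H (a, t)),
      integrable_version leb (fun s => H (s, b)),
      exists2 G : R -> R -> R, (forall s t, `|s^-1 * (H (s, t) - H (a, t))| <= G s t) &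
       (\int[leb]_(t in `[e2, +oo[) \int[leb]_(s in `[0%R, e1]) (G s t)%:E < +oo)%E &
      exists2 G : R -> R -> R, (forall s t, `|t^-1 * (H (s, t) - H (s, b))| <= G s t) &
       (\int[leb]_(s in `[e1, +oo[) \int[leb]_(t in `[0%R, e2]) (G s t)%:E < +oo)%E].

(** Of the four rectangles cut by s = e1 and t = e2 only the one at the corner
    contributes in the limit. *)
Lemma quadrant_dirichlet (e1 e2 L : R) (H H' : R * R -> R) : 0 < e1 -> 0 < e2 ->
  measurable_fun setT H' -> {ae leb2, forall p, H p = H' p} ->
  leb2.-integrable Q (EFin \o H') ->
  strip_bv 0 e1 0 e2 H -> H @ filter_prod (0 : R)^'+ (0 : R)^'+ --> L ->
  strip_tame e1 e2 H ->
  (fun MN => \int[leb2]_(p in Q) (sinc2 MN p * H' p)) @ oo2 --> (pi / 2) ^+ 2 * L.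
Proof.
move=> e10 e20 mH' HH' Hi bvH HL [a [b [[ga [mga gai Hga]] [gb [mgb gbi Hgb]]
  [Ga HGa Gafin] [Gb HGb Gbfin]]]].
pose A1 := `]0, e1]%classic : set R. pose B1 := `]e1, +oo[%classic : set R.
pose A2 := `]0, e2]%classic : set R. pose B2 := `]e2, +oo[%classic : set R.
have mA1 : measurable A1 by exact: measurable_itv.
have mA2 : measurable A2 by exact: measurable_itv.
have mB1 : measurable B1 by exact: measurable_itv.
have mB2 : measurable B2 by exact: measurable_itv.
have U1 : `]0, +oo[%classic = A1 `|` B1.
  by apply: (@itv_bndbnd_setU _ _ _ (BRight e1)); rewrite bnd_simp ?ltW.
have U2 : `]0, +oo[%classic = A2 `|` B2.
  by apply: (@itv_bndbnd_setU _ _ _ (BRight e2)); rewrite bnd_simp ?ltW.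
have I1 : A1 `&` B1 = set0.
  by apply/seteqP; split => // x []; rewrite /A1 /B1 /= !in_itv/= andbT => /andP[_ xe] /(le_lt_trans xe); rewrite ltxx.
have I2 : A2 `&` B2 = set0.
  by apply/seteqP; split => // x []; rewrite /A2 /B2 /= !in_itv/= andbT => /andP[_ xe] /(le_lt_trans xe); rewrite ltxx.
have QE : Q = (A1 `*` A2 `|` A1 `*` B2) `|` (B1 `*` A2 `|` B1 `*` B2).
  rewrite {1}U1 U2; apply/seteqP; split => [[x y] /= [[x1|x1] [y1|y1]]|[x y] /=].
  - by left; left.
  - by left; right.
  - by right; left.
  - by right; right.
  - by move=> [[[? ?]|[? ?]]|[[? ?]|[? ?]]]; split; (by left) || (by right).
have m11 : measurable (A1 `*` A2) by exact: measurableX.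
have m12 : measurable (A1 `*` B2) by exact: measurableX.
have m21 : measurable (B1 `*` A2) by exact: measurableX.
have m22 : measurable (B1 `*` B2) by exact: measurableX.
have mQ : measurable (Q : set (R * R)) by exact: measurableX.
have sub D : measurable D -> D `<=` Q -> leb2.-integrable D (EFin \o H').
  by move=> mD DQ; exact: plane_integrableS mQ mD DQ Hi.
have s1 : A1 `*` A2 `|` A1 `*` B2 `<=` Q by rewrite QE; left.
have s2 : B1 `*` A2 `|` B1 `*` B2 `<=` Q by rewrite QE; right.
have mU1 : measurable (A1 `*` A2 `|` A1 `*` B2) by exact: measurableU.
have mU2 : measurable (B1 `*` A2 `|` B1 `*` B2) by exact: measurableU.
have i11 : leb2.-integrable (A1 `*` A2) (EFin \o H') by apply: sub => // p ?; apply: s1; left.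
have i12 : leb2.-integrable (A1 `*` B2) (EFin \o H') by apply: sub => // p ?; apply: s1; right.
have i21 : leb2.-integrable (B1 `*` A2) (EFin \o H') by apply: sub => // p ?; apply: s2; left.
have i22 : leb2.-integrable (B1 `*` B2) (EFin \o H') by apply: sub => // p ?; apply: s2; right.
have splitE MN : \int[leb2]_(p in Q) (sinc2 MN p * H' p) =
    (\int[leb2]_(p in A1 `*` A2) (sinc2 MN p * H' p) +
     \int[leb2]_(p in A1 `*` B2) (sinc2 MN p * H' p)) +
    (\int[leb2]_(p in B1 `*` A2) (sinc2 MN p * H' p) +
     \int[leb2]_(p in B1 `*` B2) (sinc2 MN p * H' p)).
  have iQ := sinc2_integrable MN mQ Hi.
  rewrite QE plane_Rintegral_setU//; last 2 first.
  - apply/seteqP; split => // -[x y] /= [[[xA _]|[xA _]] [[xB _]|[xB _]]];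
    by have : (A1 `&` B1) x by []; rewrite I1.
  - by rewrite -QE.
  rewrite plane_Rintegral_setU//; last 2 first.
  - apply/seteqP; split => // -[x y] /= [[_ yA] [_ yB]].
    by have : (A2 `&` B2) y by []; rewrite I2.
  - exact: sinc2_integrable (sub _ mU1 s1).
  rewrite plane_Rintegral_setU//.
  - apply/seteqP; split => // -[x y] /= [[_ yA] [_ yB]].
    by have : (A2 `&` B2) y by []; rewrite I2.
  - exact: sinc2_integrable (sub _ mU2 s2).
have centralE MN : \int[leb2]_(p in A1 `*` A2) (sinc2 MN p * H' p) =
    \int[leb]_(s in A1) (sinc_kernel MN.1 s *
      \int[leb]_(t in A2) (sinc_kernel MN.2 t * H (s, t))).
  rewrite (plane_Rintegral12 mA1 mA2 (sinc2_integrable MN m11 i11)).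
  apply: (@ae_eq_lower_Rintegral _ mR R leb) => //.
  have ki : leb2.-integrable (A1 `*` A2) (EFin \o (fun p => sinc_kernel MN.2 p.2 * H' p)).
    apply: (plane_integrable_bounded_mul (B := `|MN.2|)) => //.
      apply: measurable_funTS.
      exact: (measurableT_comp (measurable_sinc_kernel _) measurable_snd).
    by move=> p _; exact: sinc_kernel_bound.
  apply: line_ae_imply2 (plane_ae_integrable_section1 mA1 mA2 ki) (plane_ae_product1 HH').
  move=> s si HHs sA1; have {}si := si sA1.
  transitivity (\int[leb]_(t in A2) (sinc_kernel MN.1 s * (sinc_kernel MN.2 t * H' (s, t)))).
    by apply: eq_Rintegral => t _; rewrite /sinc2/= mulrA.
  rewrite RintegralZl//; congr (_ * _).
  apply: (@ae_eq_lower_Rintegral _ mR R leb) => //.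
  by apply: line_ae_imply HHs => t -> _.
rewrite (_ : (fun MN => _) = (fun MN => (\int[leb]_(s in A1) (sinc_kernel MN.1 s *
      \int[leb]_(t in A2) (sinc_kernel MN.2 t * H (s, t))) +
     \int[leb2]_(p in A1 `*` B2) (sinc2 MN p * H' p)) +
    (\int[leb2]_(p in B1 `*` A2) (sinc2 MN p * H' p) +
     \int[leb2]_(p in B1 `*` B2) (sinc2 MN p * H' p)))); last first.
  by apply/funext => MN; rewrite splitE centralE.
rewrite -[X in _ --> X]addr0 -[X in _ --> X + _]addr0 -[X in _ --> _ + X](addr0 (0 : R)).
apply: cvgD; apply: cvgD.
- exact: double_jordan.
- exact: (strip1_cvg e10 e20 mH' HH' mga gai Hga HGa Gafin).
- exact: (strip2_cvg e10 e20 mH' HH' mgb gbi Hgb HGb Gbfin).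
- exact: far_corner_cvg.
Qed.

Definition sym4 (V : zmodType) (h : R * R -> V) (x0 y0 : R) (p : R * R) : V :=
  h (x0 - p.1, y0 - p.2) + h (x0 + p.1, y0 + p.2) +
  h (x0 - p.1, y0 + p.2) + h (x0 + p.1, y0 - p.2).

(** The product of two Dirichlet kernels is even in both variables, so that folding
    at (x0, y0) replaces h by its sum over the four reflections. *)
Theorem plane_dirichlet (x0 y0 e1 e2 L : R) (h h' : R * R -> R) : 0 < e1 -> 0 < e2 ->
  measurable_fun setT h' -> {ae leb2, forall p, h p = h' p} ->
  leb2.-integrable setT (EFin \o h') ->
  strip_bv 0 e1 0 e2 (sym4 h x0 y0) ->
  sym4 h x0 y0 @ filter_prod (0 : R)^'+ (0 : R)^'+ --> L ->
  strip_tame e1 e2 (sym4 h x0 y0) ->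
  (fun MN => \int[leb2]_p (sinc2 MN (x0 - p.1, y0 - p.2) * h' p)) @ oo2 -->
    (pi / 2) ^+ 2 * L.
Proof.
move=> e10 e20 mh' hh' hi bvh hL th.
have P1 : (1 : R) = 1 \/ (1 : R) = -1 by left.
have N1 : (-1 : R) = 1 \/ (-1 : R) = -1 by right.
have refl (k l : R) : (k = 1 \/ k = -1) -> (l = 1 \/ l = -1) ->
  [/\ measurable_fun setT (fun p : R * R => h' (x0 + k * p.1, y0 + l * p.2)),
      {ae leb2, forall p, h (x0 + k * p.1, y0 + l * p.2) = h' (x0 + k * p.1, y0 + l * p.2)} &
      leb2.-integrable setT (EFin \o (fun p : R * R => h' (x0 + k * p.1, y0 + l * p.2)))].
  move=> kE lE; split.
  - exact: (measurableT_comp mh' (measurable_plane_reflection x0 y0 k l)).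
  - exact: (ae_plane_reflection x0 y0 kE lE hh').
  - exact: (integrable_plane_reflection x0 y0 kE lE hi).
have [ma aa ia] := refl _ _ N1 N1; have [mb ab ib] := refl _ _ P1 P1.
have [mc ac ic] := refl _ _ N1 P1; have [md ad id] := refl _ _ P1 N1.
have symE (g : R * R -> R) : sym4 g x0 y0 = (fun p => g (x0 + -1 * p.1, y0 + -1 * p.2) +
    g (x0 + 1 * p.1, y0 + 1 * p.2) + g (x0 + -1 * p.1, y0 + 1 * p.2) +
    g (x0 + 1 * p.1, y0 + -1 * p.2)).
  by apply/funext => p; rewrite /sym4 !mulN1r !mul1r.
have mH' : measurable_fun setT (sym4 h' x0 y0).
  by rewrite symE; do 3 apply: measurable_funD => //.
have HH' : {ae leb2, forall p, sym4 h x0 y0 p = sym4 h' x0 y0 p}.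
  have aab := plane_ae_imply2 (fun p ha hb => conj ha hb) aa ab.
  have acd := plane_ae_imply2 (fun p hc hd => conj hc hd) ac ad.
  rewrite !symE; apply: plane_ae_imply2 aab acd.
  by move=> p [-> ->] [-> ->].
have Hi : leb2.-integrable setT (EFin \o sym4 h' x0 y0).
  rewrite symE; exact: plane_integrableD measurableT (plane_integrableD measurableT
    (plane_integrableD measurableT ia ib) ic) id.
have mQ : measurable (Q : set (R * R)) by exact: measurableX.
have HiQ : leb2.-integrable Q (EFin \o sym4 h' x0 y0).
  exact: plane_integrableS measurableT mQ _ Hi.
have := quadrant_dirichlet e10 e20 mH' HH' HiQ bvh hL th; apply: cvg_trans.
apply: near_eq_cvg; near=> MN.
have Fi : leb2.-integrable setT (EFin \o (fun p => sinc2 MN (x0 - p.1, y0 - p.2) * h' p)).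
  apply: (plane_integrable_bounded_mul (B := `|MN.1| * `|MN.2|)) => //.
    have := measurableT_comp (measurable_sinc2 MN) (measurable_plane_reflection x0 y0 (-1) (-1)).
    by apply: eq_measurable_fun => p _; rewrite /= /plane_reflection !mulN1r.
  by move=> p _; exact: sinc2_bound.
rewrite (Rintegral_fold x0 y0 Fi); apply: eq_Rintegral => p _ /=.
have EN (c u : R) : c - (c + u) = - u by ring.
rewrite !EN.
by rewrite /sinc2/= !sinc_kernelN /sym4 !mulrDr.
Unshelve. all: by end_near. Qed.

End PlaneInversion.

(** * Quaternion-valued functions by components *)

Section QuaternionComponents.
Variable R : realType.
Implicit Types (p q c : quat R).

Lemma quatE p q : q0 p = q0 q -> q1 p = q1 q -> q2 p = q2 q -> q3 p = q3 q -> p = q.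
Proof. by case: p => ? ? ? ?; case: q => ? ? ? ? /= -> -> -> ->. Qed.

Lemma q0D p q : q0 (p + q) = q0 p + q0 q. Proof. by []. Qed.
Lemma q1D p q : q1 (p + q) = q1 p + q1 q. Proof. by []. Qed.
Lemma q2D p q : q2 (p + q) = q2 p + q2 q. Proof. by []. Qed.
Lemma q3D p q : q3 (p + q) = q3 p + q3 q. Proof. by []. Qed.
Lemma q0N p : q0 (- p) = - q0 p. Proof. by []. Qed.
Lemma q1N p : q1 (- p) = - q1 p. Proof. by []. Qed.
Lemma q2N p : q2 (- p) = - q2 p. Proof. by []. Qed.
Lemma q3N p : q3 (- p) = - q3 p. Proof. by []. Qed.
Lemma q0Z (a : R) p : q0 (a *: p) = a * q0 p. Proof. by []. Qed.
Lemma q1Z (a : R) p : q1 (a *: p) = a * q1 p. Proof. by []. Qed.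
Lemma q2Z (a : R) p : q2 (a *: p) = a * q2 p. Proof. by []. Qed.
Lemma q3Z (a : R) p : q3 (a *: p) = a * q3 p. Proof. by []. Qed.
Definition qlinE := (q0D, q1D, q2D, q3D, q0N, q1N, q2N, q3N, q0Z, q1Z, q2Z, q3Z).

Lemma q0M p q : q0 (p * q) = q0 p * q0 q - q1 p * q1 q - q2 p * q2 q - q3 p * q3 q.
Proof. by []. Qed.
Lemma q1M p q : q1 (p * q) = q0 p * q1 q + q1 p * q0 q + q2 p * q3 q - q3 p * q2 q.
Proof. by []. Qed.
Lemma q2M p q : q2 (p * q) = q0 p * q2 q + q2 p * q0 q + q3 p * q1 q - q1 p * q3 q.
Proof. by []. Qed.
Lemma q3M p q : q3 (p * q) = q0 p * q3 q + q3 p * q0 q + q1 p * q2 q - q2 p * q1 q.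
Proof. by []. Qed.
Definition qmulE := (q0M, q1M, q2M, q3M).

Lemma q0_le_norm q : `|q0 q| <= `|q|.
Proof.
rewrite -sqrtr_sqr [leRHS]/Num.norm/= /qnorm ler_sqrt ?qsqr_ge0// /qsqr.
have := sqr_ge0 (q1 q); have := sqr_ge0 (q2 q); have := sqr_ge0 (q3 q); lra.
Qed.
Lemma q1_le_norm q : `|q1 q| <= `|q|.
Proof.
rewrite -sqrtr_sqr [leRHS]/Num.norm/= /qnorm ler_sqrt ?qsqr_ge0// /qsqr.
have := sqr_ge0 (q0 q); have := sqr_ge0 (q2 q); have := sqr_ge0 (q3 q); lra.
Qed.
Lemma q2_le_norm q : `|q2 q| <= `|q|.
Proof.
rewrite -sqrtr_sqr [leRHS]/Num.norm/= /qnorm ler_sqrt ?qsqr_ge0// /qsqr.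
have := sqr_ge0 (q0 q); have := sqr_ge0 (q1 q); have := sqr_ge0 (q3 q); lra.
Qed.
Lemma q3_le_norm q : `|q3 q| <= `|q|.
Proof.
rewrite -sqrtr_sqr [leRHS]/Num.norm/= /qnorm ler_sqrt ?qsqr_ge0// /qsqr.
have := sqr_ge0 (q0 q); have := sqr_ge0 (q1 q); have := sqr_ge0 (q2 q); lra.
Qed.

Lemma qnorm_le_sum q : `|q| <= `|q0 q| + `|q1 q| + `|q2 q| + `|q3 q|.
Proof.
have S0 : 0 <= `|q0 q| + `|q1 q| + `|q2 q| + `|q3 q| by rewrite !addr_ge0.
rewrite [leLHS]/Num.norm/= /qnorm -[leRHS]ger0_norm// -sqrtr_sqr ler_sqrt ?sqr_ge0//.
rewrite /qsqr -(real_normK (num_real (q0 q))) -(real_normK (num_real (q1 q))).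
rewrite -(real_normK (num_real (q2 q))) -(real_normK (num_real (q3 q))).
have := normr_ge0 (q0 q); have := normr_ge0 (q1 q); have := normr_ge0 (q2 q).
have := normr_ge0 (q3 q); nra.
Qed.

Definition qall (T : Type) (P : (T -> R) -> Prop) (F : T -> quat R) :=
  [/\ P (fun x => q0 (F x)), P (fun x => q1 (F x)),
      P (fun x => q2 (F x)) & P (fun x => q3 (F x))].

Section linear_property.
Variables (T : Type) (P : (T -> R) -> Prop).
Hypothesis PD : forall f g, P f -> P g -> P (fun x => f x + g x).
Hypothesis PZ : forall k f, P f -> P (fun x => k * f x).

Lemma qallD F G : qall P F -> qall P G -> qall P (fun x => F x + G x).
Proof. by move=> [? ? ? ?] [? ? ? ?]; split; apply: PD. Qed.

Let P4 (a b c d : R) f0 f1 f2 f3 : P f0 -> P f1 -> P f2 -> P f3 ->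
  P (fun x => a * f0 x + b * f1 x + c * f2 x + d * f3 x).
Proof. by move=> *; apply: PD; [apply: PD; [apply: PD|]|]; apply: PZ. Qed.

Let Pext f g : f =1 g -> P f -> P g.
Proof. by move=> /funext ->. Qed.

(** The components of a product with a constant are linear combinations of the
    components. *)
Lemma qallMl c F : qall P F -> qall P (fun x => c * F x).
Proof.
move=> [h0 h1 h2 h3]; split.
- by apply: Pext (P4 (q0 c) (- q1 c) (- q2 c) (- q3 c) h0 h1 h2 h3) => x; rewrite qmulE; ring.
- by apply: Pext (P4 (q1 c) (q0 c) (- q3 c) (q2 c) h0 h1 h2 h3) => x; rewrite qmulE; ring.
- by apply: Pext (P4 (q2 c) (q3 c) (q0 c) (- q1 c) h0 h1 h2 h3) => x; rewrite qmulE; ring.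
- by apply: Pext (P4 (q3 c) (- q2 c) (q1 c) (q0 c) h0 h1 h2 h3) => x; rewrite qmulE; ring.
Qed.

Lemma qallMr c F : qall P F -> qall P (fun x => F x * c).
Proof.
move=> [h0 h1 h2 h3]; split.
- by apply: Pext (P4 (q0 c) (- q1 c) (- q2 c) (- q3 c) h0 h1 h2 h3) => x; rewrite qmulE; ring.
- by apply: Pext (P4 (q1 c) (q0 c) (q3 c) (- q2 c) h0 h1 h2 h3) => x; rewrite qmulE; ring.
- by apply: Pext (P4 (q2 c) (- q3 c) (q0 c) (q1 c) h0 h1 h2 h3) => x; rewrite qmulE; ring.
- by apply: Pext (P4 (q3 c) (q2 c) (- q1 c) (q0 c) h0 h1 h2 h3) => x; rewrite qmulE; ring.
Qed.

End linear_property.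

Definition qcvg (T : Type) (FF : set_system T) (F : T -> quat R) (l : quat R) :=
  [/\ (fun x => q0 (F x)) @ FF --> q0 l, (fun x => q1 (F x)) @ FF --> q1 l,
      (fun x => q2 (F x)) @ FF --> q2 l & (fun x => q3 (F x)) @ FF --> q3 l].

Section qcvg.
Context (T : Type) (FF : set_system T) {FFF : Filter FF}.
Implicit Types (F G : T -> quat R).

Lemma qcvg_cvg F l : qcvg FF F l -> F @ FF --> l.
Proof.
move=> [h0 h1 h2 h3]; apply/cvgrPdist_le => e e0; have e4 : 0 < e / 4 by lra.
move/cvgrPdist_le : h0 => /(_ _ e4) h0; move/cvgrPdist_le : h1 => /(_ _ e4) h1.
move/cvgrPdist_le : h2 => /(_ _ e4) h2; move/cvgrPdist_le : h3 => /(_ _ e4) h3.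
near=> x; apply: (le_trans (qnorm_le_sum _)); rewrite !qlinE.
have : `|q0 l - q0 (F x)| <= e / 4 by near: x.
have : `|q1 l - q1 (F x)| <= e / 4 by near: x.
have : `|q2 l - q2 (F x)| <= e / 4 by near: x.
have : `|q3 l - q3 (F x)| <= e / 4 by near: x.
lra.
Unshelve. all: by end_near. Qed.

Lemma qcvgD F G l l' : qcvg FF F l -> qcvg FF G l' -> qcvg FF (fun x => F x + G x) (l + l').
Proof. by move=> [? ? ? ?] [? ? ? ?]; split; apply: cvgD. Qed.

Lemma qcvgM F G l l' : qcvg FF F l -> qcvg FF G l' -> qcvg FF (fun x => F x * G x) (l * l').
Proof.
move=> [? ? ? ?] [? ? ? ?]; split; rewrite qmulE; under eq_fun do rewrite qmulE;
do 3 ((apply: cvgB || apply: cvgD); last by apply: cvgM); by apply: cvgM.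
Qed.

Lemma qcvg_cst l : qcvg FF (fun _ => l) l.
Proof. by split; exact: cvg_cst. Qed.

Lemma qcvg_comp (U : Type) (GG : set_system U) (k : U -> T) F l :
  k @ GG `=>` FF -> qcvg FF F l -> qcvg GG (F \o k) l.
Proof.
move=> kGF [h0 h1 h2 h3].
by split; [exact: (cvg_comp _ _ kGF h0)|exact: (cvg_comp _ _ kGF h1)|
           exact: (cvg_comp _ _ kGF h2)|exact: (cvg_comp _ _ kGF h3)].
Qed.

End qcvg.

End QuaternionComponents.

(** * Integrals of quaternion-valued functions *)

Section QuaternionIntegrals.
Context d (T : measurableType d) (R : realType) (m : {measure set T -> \bar R}).
Variables (D : set T) (mD : measurable D).
Implicit Types (F G : T -> quat R).

Definition qintegrable F := qall (fun f => m.-integrable D (EFin \o f)) F.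

Let iD (f g : T -> R) : m.-integrable D (EFin \o f) -> m.-integrable D (EFin \o g) ->
  m.-integrable D (EFin \o (fun x => f x + g x)).
Proof. by move=> fi gi; exact: (integrableD mD fi gi). Qed.

Let iZ k (f : T -> R) : m.-integrable D (EFin \o f) ->
  m.-integrable D (EFin \o (fun x => k * f x)).
Proof. by move=> fi; exact: (integrableZl mD k fi). Qed.

Lemma qintegrableD F G : qintegrable F -> qintegrable G ->
  qintegrable (fun x => F x + G x).
Proof. exact: (qallD iD). Qed.

Lemma qintegrableMl c F : qintegrable F -> qintegrable (fun x => c * F x).
Proof. exact: (qallMl iD iZ). Qed.

Lemma qintegrableMr c F : qintegrable F -> qintegrable (fun x => F x * c).
Proof. exact: (qallMr iD iZ). Qed.

Lemma eq_qintegral F G : (forall x, D x -> F x = G x) ->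
  qintegral m D F = qintegral m D G.
Proof.
by move=> FG; congr Quat; apply: eq_Rintegral => x /set_mem Dx; rewrite FG.
Qed.

Lemma ae_eq_qintegral F G : {ae m, forall x, D x -> F x = G x} ->
  qintegral m D F = qintegral m D G.
Proof.
by move=> FG; congr Quat; apply: ae_eq_lower_Rintegral => //;
   apply: filterS FG => x + Dx => /(_ Dx) ->.
Qed.

Lemma qintegralD F G : qintegrable F -> qintegrable G ->
  qintegral m D (fun x => F x + G x) = qintegral m D F + qintegral m D G.
Proof. by move=> [? ? ? ?] [? ? ? ?]; apply: quatE; rewrite qlinE /= RintegralD. Qed.

Lemma qintegralZ k F : qintegrable F ->
  qintegral m D (fun x => k *: F x) = k *: qintegral m D F.
Proof. by move=> [? ? ? ?]; apply: quatE; rewrite qlinE /= RintegralZl. Qed.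

Let Rintegral4 (a b c e : R) (f0 f1 f2 f3 : T -> R) :
  m.-integrable D (EFin \o f0) -> m.-integrable D (EFin \o f1) ->
  m.-integrable D (EFin \o f2) -> m.-integrable D (EFin \o f3) ->
  \int[m]_(x in D) (a * f0 x + b * f1 x + c * f2 x + e * f3 x) =
  a * \int[m]_(x in D) f0 x + b * \int[m]_(x in D) f1 x +
  c * \int[m]_(x in D) f2 x + e * \int[m]_(x in D) f3 x.
Proof.
move=> i0 i1 i2 i3.
have [j0 j1] := (iZ a i0, iZ b i1); have [j2 j3] := (iZ c i2, iZ e i3).
have j01 := iD j0 j1; have j012 := iD j01 j2.
by rewrite (RintegralD mD j012 j3) (RintegralD mD j01 j2) (RintegralD mD j0 j1) !RintegralZl.
Qed.

(** Multiplication by a constant on either side is R-linear in the components. *)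
Lemma qintegralMl c F : qintegrable F ->
  qintegral m D (fun x => c * F x) = c * qintegral m D F.
Proof.
move=> [i0 i1 i2 i3]; apply: quatE; rewrite qmulE /=.
- transitivity (\int[m]_(x in D) (q0 c * q0 (F x) + (- q1 c) * q1 (F x) +
    (- q2 c) * q2 (F x) + (- q3 c) * q3 (F x))).
    by apply: eq_Rintegral => x _; ring.
  by rewrite Rintegral4//; ring.
- transitivity (\int[m]_(x in D) (q1 c * q0 (F x) + q0 c * q1 (F x) +
    (- q3 c) * q2 (F x) + q2 c * q3 (F x))).
    by apply: eq_Rintegral => x _; ring.
  by rewrite Rintegral4//; ring.
- transitivity (\int[m]_(x in D) (q2 c * q0 (F x) + q3 c * q1 (F x) +
    q0 c * q2 (F x) + (- q1 c) * q3 (F x))).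
    by apply: eq_Rintegral => x _; ring.
  by rewrite Rintegral4//; ring.
- transitivity (\int[m]_(x in D) (q3 c * q0 (F x) + (- q2 c) * q1 (F x) +
    q1 c * q2 (F x) + q0 c * q3 (F x))).
    by apply: eq_Rintegral => x _; ring.
  by rewrite Rintegral4//; ring.
Qed.

Lemma qintegralMr c F : qintegrable F ->
  qintegral m D (fun x => F x * c) = qintegral m D F * c.
Proof.
move=> [i0 i1 i2 i3]; apply: quatE; rewrite qmulE /=.
- transitivity (\int[m]_(x in D) (q0 c * q0 (F x) + (- q1 c) * q1 (F x) +
    (- q2 c) * q2 (F x) + (- q3 c) * q3 (F x))).
    by apply: eq_Rintegral => x _; ring.
  by rewrite Rintegral4//; ring.
- transitivity (\int[m]_(x in D) (q1 c * q0 (F x) + q0 c * q1 (F x) +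
    q3 c * q2 (F x) + (- q2 c) * q3 (F x))).
    by apply: eq_Rintegral => x _; ring.
  by rewrite Rintegral4//; ring.
- transitivity (\int[m]_(x in D) (q2 c * q0 (F x) + (- q3 c) * q1 (F x) +
    q0 c * q2 (F x) + q1 c * q3 (F x))).
    by apply: eq_Rintegral => x _; ring.
  by rewrite Rintegral4//; ring.
- transitivity (\int[m]_(x in D) (q3 c * q0 (F x) + q2 c * q1 (F x) +
    (- q1 c) * q2 (F x) + q0 c * q3 (F x))).
    by apply: eq_Rintegral => x _; ring.
  by rewrite Rintegral4//; ring.
Qed.

End QuaternionIntegrals.

Section BoundedQuaternionIntegrand.
Context d (T : measurableType d) (R : realType) (m : {measure set T -> \bar R}).

Lemma qintegrable_bounded_scale (D : set T) (h : T -> R) (F : T -> quat R) (B : R) :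
  measurable D -> measurable_fun D h -> (forall x, D x -> `|h x| <= B) ->
  qintegrable m D F -> qintegrable m D (fun x => h x *: F x).
Proof.
by move=> mD mh hB [? ? ? ?]; split; apply: (integrable_bounded_mul (B := B)).
Qed.

End BoundedQuaternionIntegrand.

Section KernelFubini.
Context d (T : measurableType d) (R : realType).
Variable m : {sigma_finite_measure set T -> \bar R}.
Local Notation leb := (@lebesgue_measure R).
Local Notation mR := (measurableTypeR R).
Variables (a b : R) (p : R -> T -> R) (B : R).
Hypothesis mp : measurable_fun setT (fun z : mR * T => p z.1 z.2).
Hypothesis pB : forall u q, `|p u q| <= B.

Let I := `[a, b]%classic : set mR.

Let mI : measurable I. Proof. exact: measurable_itv. Qed.

Let Ifin : (leb I < +oo)%E.
Proof. by rewrite lebesgue_measure_itv/=; case: ifP => _; rewrite -?EFinB ltry. Qed.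

(** Fubini's theorem; a kernel bounded on a bounded interval is harmless, as w is
    integrable. *)
Lemma kernel_Rintegral_swap (w : T -> R) : m.-integrable setT (EFin \o w) ->
  leb.-integrable I (EFin \o (fun u => \int[m]_q (p u q * w q))) /\
  \int[leb]_(u in I) \int[m]_q (p u q * w q) =
  \int[m]_q ((\int[leb]_(u in I) p u q) * w q).
Proof.
move=> wi; have /measurable_EFinP mw := measurable_int _ wi.
have ji : (leb \x m)%E.-integrable (I `*` setT)
    (EFin \o (fun z : mR * T => p z.1 z.2 * w z.2)).
  apply: (integrable_bounded_mul (B := B)); first exact: measurableX.
  - exact: measurable_funTS.
  - by move=> z _.
  have mw2 : measurable_fun setT (fun z : mR * T => w z.2).
    exact: (measurableT_comp mw measurable_snd).
  apply/(integrable_mkcond _ _).2; first exact: measurableX.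
  apply/integrable12ltyP.
    apply/(measurable_restrictT _ _).1; first exact: measurableX.
    by apply: measurable_funTS; exact/measurable_EFinP.
  apply: (@le_lt_trans _ _ (\int[leb]_(u in I) \int[m]_q `|(w q)%:E|)%E).
    rewrite [leRHS]integral_mkcond le_eqVlt; apply/orP; left; apply/eqP.
    apply: eq_integral => u _; rewrite patchE; case: ifPn => [/set_mem Iu|/negP Iu].
      by apply: eq_integral => q _; rewrite patchE mem_set.
    by apply: integral0_eq => q _; rewrite patchE memNset ?abse0// => -[/mem_set].
  rewrite integral_cst//; move/integrableP : wi => [_ wi].
  by rewrite lte_mul_pinfty// ?integral_ge0// ge0_fin_numE// integral_ge0.
split; first exact: (integrable_Rintegral1 mI measurableT ji).
have := Rintegral12 mI measurableT ji; rewrite (Rintegral21 mI measurableT ji) /= => <-.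
apply: eq_Rintegral => q _; rewrite RintegralZr//.
apply: (bounded_integrable (B := B)) => //.
apply: measurable_funTS; exact: (measurable_fun_pair1 q mp).
Qed.

Lemma kernel_qintegral_swap (G : T -> quat R) : qintegrable m setT G ->
  qintegrable leb I (fun u => qintegral m setT (fun q => p u q *: G q)) /\
  qintegral leb I (fun u => qintegral m setT (fun q => p u q *: G q)) =
  qintegral m setT (fun q => (\int[leb]_(u in I) p u q) *: G q).
Proof.
move=> [/kernel_Rintegral_swap[i0 e0] /kernel_Rintegral_swap[i1 e1]
        /kernel_Rintegral_swap[i2 e2] /kernel_Rintegral_swap[i3 e3]].
by split; [split|congr Quat].
Qed.

End KernelFubini.

(** * The linear canonical kernels *)

Section Kernels.
Variable R : realType.
Implicit Types (mu nu : quat R) (A : 'M[R]_2).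

Lemma qexpE mu t : qexp mu t = cos t *: 1 + sin t *: mu.
Proof. by rewrite /qexp -scalerAr mulr1. Qed.

Lemma qexpD mu s t : mu * mu = -1 -> qexp mu (s + t) = qexp mu s * qexp mu t.
Proof.
move=> mu2; rewrite !qexpE cosD sinD scalerBl scalerDl.
rewrite mulrDl !mulrDr -!scalerAl -!scalerAr !mul1r mulr1 mu2 !scalerA scalerN.
by rewrite [X in _ = _ + X]addrC [X in _ = X]addrACA [X in _ + X = _]addrC.
Qed.

Lemma qexp0 mu : qexp mu 0 = 1.
Proof. by rewrite qexpE cos0 sin0 scale1r scale0r addr0. Qed.

Lemma qexpK mu t : mu * mu = -1 -> qexp mu (- t) * qexp mu t = 1.
Proof. by move=> mu2; rewrite -qexpD// addNr qexp0. Qed.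

Lemma qexpC mu s t : mu * mu = -1 -> qexp mu s * qexp mu t = qexp mu t * qexp mu s.
Proof. by move=> mu2; rewrite -!qexpD// addrC. Qed.

Lemma quat_inv_unique (x y : quat R) : x * y = 1 -> x^-1 = y.
Proof.
move=> xy; have xU : x \is a GRing.unit.
  apply/eqP => x0; move: xy; rewrite x0 mul0r => /esym/eqP.
  by rewrite oner_eq0.
by rewrite -[LHS]mulr1 -xy mulrA mulVr// mul1r.
Qed.

Lemma lct_sqrtV mu b : mu * mu = -1 -> b != 0 ->
  (lct_sqrt mu b)^-1 = (Num.sqrt (2 * pi * `|b|))^-1 *: qexp mu (- (Num.sg b * (pi / 4))).
Proof.
move=> mu2 b0; apply: quat_inv_unique; rewrite /lct_sqrt -scalerAl -scalerAr scalerA.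
have r0 : Num.sqrt (2 * pi * `|b|) != 0.
  by rewrite gt_eqF// sqrtr_gt0 !mulr_gt0 ?pi_gt0// normr_gt0.
by rewrite divff// scale1r qexpC// qexpK.
Qed.

(** The phases e^(mu pi/4) and e^(- mu pi/4) cancel and only the modulus remains. *)
Lemma lct_sqrt_mul mu b : mu * mu = -1 -> 0 < b ->
  (lct_sqrt mu (- b))^-1 * (lct_sqrt mu b)^-1 = (2 * pi * b)^-1 *: 1.
Proof.
move=> mu2 b0; rewrite !lct_sqrtV ?oppr_eq0 ?gt_eqF// normrN sgrN.
rewrite -scalerAl -scalerAr scalerA -qexpD// mulNr opprK subrr qexp0.
rewrite -invfM -expr2 sqr_sqrtr ?gtr0_norm//.
by rewrite !mulr_ge0 ?pi_ge0// ltW.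
Qed.

Lemma lct_sqrtVC mu b t : mu * mu = -1 -> b != 0 ->
  qexp mu t * (lct_sqrt mu b)^-1 = (lct_sqrt mu b)^-1 * qexp mu t.
Proof.
move=> mu2 b0; rewrite lct_sqrtV//; set r := (Num.sqrt _)^-1.
by rewrite -scalerAl -scalerAr qexpC.
Qed.

Lemma invmx2 A : \det A = 1 ->
  [/\ invmx A 0 0 = A 1 1, invmx A 0 1 = - A 0 1 & invmx A 1 1 = A 0 0].
Proof.
move=> dA; pose B : 'M[R]_2 := \matrix_(i, j)
  if i == 0 then (if j == 0 then A 1 1 else - A 0 1)
  else (if j == 0 then - A 1 0 else A 0 0).
have AB : A *m B = 1%:M.
  have l1 : lift ord0 ord0 = 1 :> 'I_2 by apply/val_inj.
  have d2 : A 0 0 * A 1 1 - A 0 1 * A 1 0 = 1.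
    rewrite -dA (expand_det_row A 0) !big_ord_recl big_ord0 /cofactor !det_mx11 !mxE.
    rewrite !l1 (_ : lift 1 0 = 0 :> 'I_2); last by apply/val_inj.
    rewrite /= expr0 expr1; ring.
  have z0 : ord0 = 0 :> 'I_2 by [].
  apply/matrixP => i j; rewrite !mxE !big_ord_recl big_ord0 !mxE /= addr0 !l1.
  have two (k : 'I_2) : k = 0 \/ k = 1.
    by case: k => [[|[|//]] h]; [left|right]; apply/val_inj.
  case: (two i) => ->; case: (two j) => ->; rewrite /= -?d2 ?z0 ?mulr1n ?mulr0n; ring.
have -> : invmx A = B.
  have /mulmx1_unit[uA _] := AB.
  by rewrite -[B]mul1mx -(mulVmx uA) -mulmxA AB mulmx1.
by rewrite !mxE.
Qed.

(** Inverting A exchanges a and d and changes the sign of b, so that the terms in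
    d u^2 cancel, the terms in a make the chirps in s and x0, and the mixed terms
    make u (x0 - s) / b. *)
Lemma lct_kernel_mul mu A u s x0 : mu * mu = -1 -> \det A = 1 -> 0 < A 0 1 ->
  let al := A 0 0 / (2 * A 0 1) in
  lct_kernel mu (invmx A) u x0 * lct_kernel mu A s u =
  (2 * pi * A 0 1)^-1 *: (qexp mu (- (al * x0 ^+ 2)) * qexp mu (u * ((x0 - s) / A 0 1)) *
     qexp mu (al * s ^+ 2)).
Proof.
move=> mu2 dA b0 al; have [i00 i01 i11] := invmx2 dA.
rewrite /lct_kernel i00 i01 i11; have bN0 : A 0 1 != 0 by rewrite gt_eqF.
set E1 := qexp mu _; set E2 := qexp mu _.
have -> : (lct_sqrt mu (- A 0 1))^-1 * E1 * ((lct_sqrt mu (A 0 1))^-1 * E2) =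
    (lct_sqrt mu (- A 0 1))^-1 * (lct_sqrt mu (A 0 1))^-1 * (E1 * E2).
  by rewrite -!mulrA; congr (_ * _); rewrite !mulrA lct_sqrtVC.
rewrite lct_sqrt_mul//; set c := (2 * _ * _)^-1.
rewrite -scalerAl mul1r -!qexpD//; congr (_ *: qexp _ _).
by rewrite /al; field.
Qed.

(** All kernels of one unit mu lie in the commutative algebra spanned by 1 and mu. *)
Lemma lct_kernel_span mu A (s u : R) : mu * mu = -1 -> A 0 1 != 0 ->
  exists r t, lct_kernel mu A s u = r *: qexp mu t.
Proof.
move=> mu2 bA; rewrite /lct_kernel lct_sqrtV//.
set E1 := qexp mu (_ + _); set r := (Num.sqrt _)^-1.
by exists r; eexists; rewrite -scalerAl -qexpD.
Qed.

Lemma lct_kernelC mu (A B : 'M[R]_2) (s u v w : R) : mu * mu = -1 ->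
  A 0 1 != 0 -> B 0 1 != 0 ->
  lct_kernel mu A s u * lct_kernel mu B v w = lct_kernel mu B v w * lct_kernel mu A s u.
Proof.
move=> mu2 bA bB; have [r [t ->]] := lct_kernel_span s u mu2 bA.
have [r' [t' ->]] := lct_kernel_span v w mu2 bB.
by rewrite -!scalerAl -!scalerAr !scalerA qexpC// [r * _]mulrC.
Qed.

End Kernels.

(** * Averaging an exponential over a symmetric interval *)

Section QexpIntegrable.
Context d (T : measurableType d) (R : realType).
Variable m : {measure set T -> \bar R}.
Implicit Types (F : T -> quat R) (c : T -> R) (mu : quat R) (t : R).

Lemma qexp_mull mu t (q : quat R) : qexp mu t * q = cos t *: q + sin t *: (mu * q).
Proof. by rewrite qexpE mulrDl -!scalerAl mul1r. Qed.

Lemma qexp_mulr mu t (q : quat R) : q * qexp mu t = cos t *: q + sin t *: (q * mu).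
Proof. by rewrite qexpE mulrDr -!scalerAr mulr1. Qed.

Lemma measurable_cos_comp c : measurable_fun setT c -> measurable_fun setT (cos \o c).
Proof. by move=> mc; apply: measurableT_comp => //; exact: (continuous_measurable_fun (@continuous_cos _)). Qed.

Lemma measurable_sin_comp c : measurable_fun setT c -> measurable_fun setT (sin \o c).
Proof. by move=> mc; apply: measurableT_comp => //; exact: (continuous_measurable_fun (@continuous_sin _)). Qed.

Lemma qintegrable_qexpMl mu c F : measurable_fun setT c -> qintegrable m setT F ->
  qintegrable m setT (fun q => qexp mu (c q) * F q).
Proof.
move=> mc iF; rewrite (_ : (fun q => _) =
  fun q => cos (c q) *: F q + sin (c q) *: (mu * F q)); last by apply/funext => q; rewrite qexp_mull.
apply: qintegrableD => //; apply: (qintegrable_bounded_scale (B := 1)) => //.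
- exact: measurable_cos_comp.
- by move=> q _; rewrite ler_norml cos_geN1 cos_le1.
- exact: measurable_sin_comp.
- by move=> q _; rewrite ler_norml sin_geN1 sin_le1.
- exact: qintegrableMl.
Qed.

Lemma qintegrable_qexpMr mu c F : measurable_fun setT c -> qintegrable m setT F ->
  qintegrable m setT (fun q => F q * qexp mu (c q)).
Proof.
move=> mc iF; rewrite (_ : (fun q => _) =
  fun q => cos (c q) *: F q + sin (c q) *: (F q * mu)); last by apply/funext => q; rewrite qexp_mulr.
apply: qintegrableD => //; apply: (qintegrable_bounded_scale (B := 1)) => //.
- exact: measurable_cos_comp.
- by move=> q _; rewrite ler_norml cos_geN1 cos_le1.
- exact: measurable_sin_comp.
- by move=> q _; rewrite ler_norml sin_geN1 sin_le1.
- exact: qintegrableMr.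
Qed.

End QexpIntegrable.

Section OscillatingAverage.
Context d (T : measurableType d) (R : realType).
Variable m : {sigma_finite_measure set T -> \bar R}.
Local Notation leb := (@lebesgue_measure R).
Local Notation mR := (measurableTypeR R).
Implicit Types (F : T -> quat R) (mu : quat R).
Variables (c : T -> R) (M : R).
Hypotheses (mc : measurable_fun setT c) (M0 : 0 <= M).

Let mk : measurable_fun setT (fun z : mR * T => z.1 * c z.2).
Proof.
apply: measurable_funM; first exact: measurable_fst.
exact: (measurableT_comp mc measurable_snd).
Qed.

(** F' will be mu F or F mu: its coefficient is odd in u, so that it disappears and
    the position of mu with respect to F no longer matters. *)
Let average F F' : qintegrable m setT F -> qintegrable m setT F' ->
  qintegrable leb `[- M, M] (fun u =>
    qintegral m setT (fun q => cos (u * c q) *: F q + sin (u * c q) *: F' q)) /\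
  qintegral leb `[- M, M] (fun u =>
    qintegral m setT (fun q => cos (u * c q) *: F q + sin (u * c q) *: F' q)) =
  qintegral m setT (fun q => (\int[leb]_(u in `[- M, M]) cos (u * c q)) *: F q).
Proof.
move=> iF iF'.
have [ci ce] := kernel_qintegral_swap (- M) M (B := 1)
  (p := fun u q => cos (u * c q)) (measurableT_comp (continuous_measurable_fun (@continuous_cos _)) mk)
  ltac:(by move=> u q; rewrite ler_norml cos_geN1 cos_le1) iF.
have [si se] := kernel_qintegral_swap (- M) M (B := 1)
  (p := fun u q => sin (u * c q)) (measurableT_comp (continuous_measurable_fun (@continuous_sin _)) mk)
  ltac:(by move=> u q; rewrite ler_norml sin_geN1 sin_le1) iF'.
have mcu u : measurable_fun setT (fun q => u * c q) by exact: measurable_funM.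
have e u : qintegral m setT (fun q => cos (u * c q) *: F q + sin (u * c q) *: F' q) =
    qintegral m setT (fun q => cos (u * c q) *: F q) +
    qintegral m setT (fun q => sin (u * c q) *: F' q).
  apply: qintegralD => //; apply: (qintegrable_bounded_scale (B := 1)) => //.
  - exact: (measurable_cos_comp (mcu u)).
  - by move=> q _; rewrite ler_norml cos_geN1 cos_le1.
  - exact: (measurable_sin_comp (mcu u)).
  - by move=> q _; rewrite ler_norml sin_geN1 sin_le1.
rewrite (funext e : (fun u => _) = (fun u => _)).
split; first exact: qintegrableD.
rewrite qintegralD// ce se -[RHS]addr0; congr (_ + _).
by congr Quat; under eq_Rintegral do rewrite /= integral_sinM// mul0r; rewrite Rintegral_cst// mul0r.
Qed.

Lemma qexp_averagel mu F : qintegrable m setT F ->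
  qintegrable leb `[- M, M] (fun u => qintegral m setT (fun q => qexp mu (u * c q) * F q)) /\
  qintegral leb `[- M, M] (fun u => qintegral m setT (fun q => qexp mu (u * c q) * F q)) =
  qintegral m setT (fun q => (\int[leb]_(u in `[- M, M]) cos (u * c q)) *: F q).
Proof.
move=> iF; rewrite (_ : (fun u => _) = fun u =>
  qintegral m setT (fun q => cos (u * c q) *: F q + sin (u * c q) *: (mu * F q))).
  by apply: average => //; exact: qintegrableMl.
by apply/funext => u; apply: eq_qintegral => q _; rewrite qexp_mull.
Qed.

Lemma qexp_averager mu F : qintegrable m setT F ->
  qintegrable leb `[- M, M] (fun u => qintegral m setT (fun q => F q * qexp mu (u * c q))) /\
  qintegral leb `[- M, M] (fun u => qintegral m setT (fun q => F q * qexp mu (u * c q))) =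
  qintegral m setT (fun q => (\int[leb]_(u in `[- M, M]) cos (u * c q)) *: F q).
Proof.
move=> iF; rewrite (_ : (fun u => _) = fun u =>
  qintegral m setT (fun q => cos (u * c q) *: F q + sin (u * c q) *: (F q * mu))).
  by apply: average => //; exact: qintegrableMr.
by apply/funext => u; apply: eq_qintegral => q _; rewrite qexp_mulr.
Qed.

End OscillatingAverage.

(** * The truncated inverse transform as a Dirichlet integral *)

Section PlaneMeasure.
Variable R : realType.
Local Notation leb := (@lebesgue_measure R).
Local Notation mR := (measurableTypeR R).
Local Notation leb2 := (@product_measure1 _ _ mR mR R leb leb).

Lemma plane_sigma_finite : sigma_finite setT leb2.
Proof.
have /sigma_finiteP[F [TF ndF Foo]] := @sigma_finiteT _ mR R leb.
exists (fun n => F n `*` F n).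
  rewrite -setXTT TF; apply/seteqP; split=> [[x y] [[n _ Fx] [k _ Fy]]|[x y] [n _ [Fx Fy]]].
    exists (maxn n k) => //; split => /=.
      by have /subsetPset := ndF _ _ (leq_maxl n k); apply.
    by have /subsetPset := ndF _ _ (leq_maxr n k); apply.
  by split; exists n.
move=> k; have [mF ?] := Foo k; split; first exact: measurableX.
by rewrite product_measure1E// lte_mul_pinfty// ge0_fin_numE.
Qed.

(** Lebesgue measure on the plane together with its sigma-finiteness. *)
Definition plane_measure : {sigma_finite_measure set (mR * mR)%type -> \bar R} :=
  HB.pack leb2 (Measure_isSigmaFinite.Build _ _ _ leb2 plane_sigma_finite).

Variables (c : R * R -> R) (M : R).
Hypotheses (mc : measurable_fun setT (c : mR * mR -> R)) (M0 : 0 <= M).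

Lemma plane_qexp_averagel mu F : qintegrable leb2 setT F ->
  qintegrable leb `[- M, M] (fun u => qintegral leb2 setT (fun q => qexp mu (u * c q) * F q)) /\
  qintegral leb `[- M, M] (fun u => qintegral leb2 setT (fun q => qexp mu (u * c q) * F q)) =
  qintegral leb2 setT (fun q => (\int[leb]_(u in `[- M, M]) cos (u * c q)) *: F q).
Proof. exact: (@qexp_averagel _ _ R plane_measure c M mc M0 mu F). Qed.

Lemma plane_qexp_averager mu F : qintegrable leb2 setT F ->
  qintegrable leb `[- M, M] (fun u => qintegral leb2 setT (fun q => F q * qexp mu (u * c q))) /\
  qintegral leb `[- M, M] (fun u => qintegral leb2 setT (fun q => F q * qexp mu (u * c q))) =
  qintegral leb2 setT (fun q => (\int[leb]_(u in `[- M, M]) cos (u * c q)) *: F q).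
Proof. exact: (@qexp_averager _ _ R plane_measure c M mc M0 mu F). Qed.

End PlaneMeasure.

Section Truncation.
Variable R : realType.
Local Notation leb := (@lebesgue_measure R).
Local Notation leb2 := (leb \x leb)%E.
Local Notation mR := (measurableTypeR R).

Lemma plane_ae_neq (x0 y0 : R) : {ae leb2, forall p : R * R, x0 - p.1 != 0 /\ y0 - p.2 != 0}.
Proof.
apply: (negligibleS _ (leb2_cross0 x0 y0)) => -[x y] /= /not_andP.
by rewrite !subr_eq0 => -[/negP|/negP]; rewrite negbK => /eqP ->; [left|right].
Qed.

Lemma integral_cos_sinc (b M s : R) : 0 < b -> 0 <= M -> s != 0 ->
  \int[leb]_(u in `[- M, M]) cos (u * (s / b)) = 2 * b * sinc_kernel (M / b) s.
Proof.
move=> b0 M0 s0; have bN0 : b != 0 by rewrite gt_eqF.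
rewrite integral_cosM//; last by rewrite mulf_neq0// invr_eq0.
rewrite /sinc_kernel (_ : M * (s / b) = M / b * s); last by rewrite mulrA mulrAC.
by field; rewrite s0 bN0.
Qed.

Variables (mu nu : quat R) (A1 A2 : 'M[R]_2).
Hypotheses (mu2 : mu * mu = -1) (nu2 : nu * nu = -1).
Hypotheses (dA1 : \det A1 = 1) (dA2 : \det A2 = 1).
Hypotheses (b1_gt0 : 0 < A1 0 1) (b2_gt0 : 0 < A2 0 1).
Variables (g g' : R * R -> quat R) (x0 y0 : R).
Hypothesis g'_int : qintegrable leb2 setT g'.
Hypothesis gg' : {ae leb2, forall p, g p = g' p}.

Let b1 := A1 0 1.
Let b2 := A2 0 1.
Let al1 := A1 0 0 / (2 * b1).
Let al2 := A2 0 0 / (2 * b2).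

(** The function that the class LC is about. *)
Definition chirped (h : R * R -> quat R) (p : R * R) : quat R :=
  qexp mu (al1 * p.1 ^+ 2) * h p * qexp nu (al2 * p.2 ^+ 2).

Let mfst : measurable_fun setT (fun p : mR * mR => p.1). Proof. exact: measurable_fst. Qed.
Let msnd : measurable_fun setT (fun p : mR * mR => p.2). Proof. exact: measurable_snd. Qed.
Let mchirp1 a : measurable_fun setT (fun p : mR * mR => a * p.1 ^+ 2).
Proof. by apply: measurable_funM => //; apply: measurable_funX. Qed.
Let mchirp2 a : measurable_fun setT (fun p : mR * mR => a * p.2 ^+ 2).
Proof. by apply: measurable_funM => //; apply: measurable_funX. Qed.

Let mc1 : measurable_fun setT (fun p : mR * mR => (x0 - p.1) / b1).
Proof. by apply: measurable_funM => //; apply: measurable_funB. Qed.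
Let mc2 : measurable_fun setT (fun p : mR * mR => (y0 - p.2) / b2).
Proof. by apply: measurable_funM => //; apply: measurable_funB. Qed.

Lemma chirped_integrable : qintegrable leb2 setT (chirped g').
Proof.
exact: (qintegrable_qexpMr nu (mchirp2 al2) (qintegrable_qexpMl mu (mchirp1 al1) g'_int)).
Qed.

Let E1 := qexp mu (- (al1 * x0 ^+ 2)).
Let E2 := qexp nu (- (al2 * y0 ^+ 2)).

Let kernel_prod u v : lct_kernel mu (invmx A1) u x0 * qlct mu nu A1 A2 g u v *
    lct_kernel nu (invmx A2) v y0 =
  ((2 * pi * b1)^-1 * (2 * pi * b2)^-1) *: (E1 * qintegral leb2 setT (fun p =>
    qexp mu (u * ((x0 - p.1) / b1)) * (chirped g' p * qexp nu (v * ((y0 - p.2) / b2)))) * E2).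
Proof.
have iW : qintegrable leb2 setT (fun p : mR * mR =>
    qexp mu (u * ((x0 - p.1) / b1)) * (chirped g' p * qexp nu (v * ((y0 - p.2) / b2)))).
  apply: qintegrable_qexpMl; first by apply: measurable_funM => //; exact: mc1.
  apply: qintegrable_qexpMr; first by apply: measurable_funM => //; exact: mc2.
  exact: chirped_integrable.
have iK : qintegrable leb2 setT (fun p : mR * mR =>
    lct_kernel mu A1 p.1 u * g' p * lct_kernel nu A2 p.2 v).
  have mt1 : measurable_fun setT (fun p : mR * mR => A1 0 0 / (2 * A1 0 1) * p.1 ^+ 2 -
      (A1 0 1)^-1 * p.1 * u + A1 1 1 / (2 * A1 0 1) * u ^+ 2).
    apply: measurable_funD => //; apply: measurable_funB; first exact: mchirp1.
    by apply: measurable_funM => //; apply: measurable_funM.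
  have mt2 : measurable_fun setT (fun p : mR * mR => A2 0 0 / (2 * A2 0 1) * p.2 ^+ 2 -
      (A2 0 1)^-1 * p.2 * v + A2 1 1 / (2 * A2 0 1) * v ^+ 2).
    apply: measurable_funD => //; apply: measurable_funB; first exact: mchirp2.
    by apply: measurable_funM => //; apply: measurable_funM.
  have := qintegrable_qexpMr nu mt2 (qintegrableMr measurableT (lct_sqrt nu (A2 0 1))^-1
    (qintegrableMl measurableT (lct_sqrt mu (A1 0 1))^-1 (qintegrable_qexpMl mu mt1 g'_int))).
  by congr qintegrable; apply/funext => p; rewrite /lct_kernel; set r := g' p;
     move: (qexp _ _) (qexp _ _) => t1 t2; rewrite !mulrA.
have -> : qlct mu nu A1 A2 g u v = qintegral leb2 setT (fun p =>
    lct_kernel mu A1 p.1 u * g' p * lct_kernel nu A2 p.2 v).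
  apply: (@ae_eq_qintegral _ (mR * mR)%type R leb2); first exact: measurableT.
  by apply: (plane_ae_imply _ gg') => p gp _; rewrite gp.
rewrite -(qintegralMl measurableT)// -(qintegralMr measurableT)//; last exact: qintegrableMl.
rewrite -(qintegralMl measurableT)// -(qintegralMr measurableT)//; last exact: qintegrableMl.
rewrite -(qintegralZ measurableT); last by apply: qintegrableMr => //; exact: qintegrableMl.
apply: eq_qintegral => p _.
have bC : invmx A2 0 1 != 0 by have [_ -> _] := invmx2 dA2; rewrite oppr_eq0 gt_eqF.
have bC' : A2 0 1 != 0 by rewrite gt_eqF.
have k1 := lct_kernel_mul u p.1 x0 mu2 dA1 b1_gt0.
have k2 := lct_kernel_mul v p.2 y0 nu2 dA2 b2_gt0.
rewrite lct_kernelC// in k2; move: k1 k2; rewrite /= -/b1 -/b2 -/al1 -/al2 -/E1 -/E2 /chirped.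
set K1 := lct_kernel mu A1 _ _; set K1' := lct_kernel mu _ _ _.
set K2 := lct_kernel nu A2 _ _; set K2' := lct_kernel nu _ _ _.
set X1 := qexp mu (u * _); set X2 := qexp nu (v * _).
set Y1 := qexp mu (al1 * _); set Y2 := qexp nu (al2 * _) => k1 k2.
rewrite (_ : K1' * (K1 * g' p * K2) * K2' = (K1' * K1) * g' p * (K2 * K2')); last by rewrite !mulrA.
rewrite k1 k2; set r1 := (2 * pi * b1)^-1; set r2 := (2 * pi * b2)^-1.
have -> : E2 * X2 * Y2 = Y2 * X2 * E2.
  by rewrite /E2 /X2 /Y2 -!qexpD//; congr qexp; ring.
rewrite -!scalerAl -!scalerAr scalerA; congr (_ *: _).
by move: (E1) (E2) (Y2) => F1 F2 F3; rewrite !mulrA.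
Qed.

(** The integral in u acts on the left exponential and the integral in v on the
    right one; each leaves a real Dirichlet kernel, for almost every (s, t), since
    the formula fails where s = x0 or t = y0.  Rescaling by b1 and b2 gives
    4 b1 b2 / (4 pi^2 b1 b2) = pi^-2. *)
Lemma qlct_inv_truncE M N : 0 <= M -> 0 <= N ->
  qlct_inv_trunc mu nu A1 A2 g x0 y0 M N =
  (pi ^- 2) *: (E1 * qintegral leb2 setT (fun p =>
     sinc2 (M / b1, N / b2) (x0 - p.1, y0 - p.2) *: chirped g' p) * E2).
Proof.
move=> M0 N0; rewrite /qlct_inv_trunc.
set k := (2 * pi * b1)^-1 * (2 * pi * b2)^-1.
pose CM (p : R * R) := \int[leb]_(u in `[- M, M]) cos (u * ((x0 - p.1) / b1)).
pose CN (p : R * R) := \int[leb]_(u in `[- N, N]) cos (u * ((y0 - p.2) / b2)).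
pose SM (p : R * R) := 2 * b1 * sinc_kernel (M / b1) (x0 - p.1).
pose SN (p : R * R) := 2 * b2 * sinc_kernel (N / b2) (y0 - p.2).
have iG := chirped_integrable.
have iS : qintegrable leb2 setT (fun p : mR * mR => SM p *: chirped g' p).
  apply: (qintegrable_bounded_scale (B := 2 * b1 * `|M / b1|)) => //.
    apply: measurable_funM => //; apply: (measurableT_comp (measurable_sinc_kernel _)).
    exact: measurable_funB.
  move=> p _; rewrite normrM ler_pM// ?sinc_kernel_bound// ger0_norm// mulr_ge0// ltW//.
have inner v : qintegral leb `[- M, M] (fun u => lct_kernel mu (invmx A1) u x0 *
    qlct mu nu A1 A2 g u v * lct_kernel nu (invmx A2) v y0) =
    k *: (E1 * qintegral leb2 setT (fun p =>
      (SM p *: chirped g' p) * qexp nu (v * ((y0 - p.2) / b2))) * E2).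
  rewrite (funext (kernel_prod ^~ v)).
  have iH : qintegrable leb2 setT (fun p : mR * mR =>
      chirped g' p * qexp nu (v * ((y0 - p.2) / b2))).
    by apply: qintegrable_qexpMr => //; apply: measurable_funM => //; exact: mc2.
  have [i e] := plane_qexp_averagel mc1 M0 mu iH.
  rewrite qintegralZ//; last by apply: qintegrableMr => //; exact: qintegrableMl.
  rewrite qintegralMr//; last exact: qintegrableMl.
  rewrite (qintegralMl _ E1 i)//; congr (_ *: (_ * _ * _)); apply: etrans e _.
  apply: (@ae_eq_qintegral _ (mR * mR)%type R leb2); first exact: measurableT.
  apply: (plane_ae_imply _ (plane_ae_neq x0 y0)) => p [px _] _.
  by rewrite integral_cos_sinc//; exact: scalerAl.
rewrite (funext inner).
have [i e] := plane_qexp_averager mc2 N0 nu iS.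
rewrite qintegralZ//; last by apply: qintegrableMr => //; exact: qintegrableMl.
rewrite qintegralMr//; last exact: qintegrableMl.
rewrite (qintegralMl _ E1 i)//.
transitivity (k *: (E1 * qintegral leb2 setT (fun p => CN p *: (SM p *: chirped g' p)) * E2)).
  by congr (_ *: (_ * _ * _)); exact: e.
have -> : qintegral leb2 setT (fun p => CN p *: (SM p *: chirped g' p)) =
    (4 * b1 * b2) *: qintegral leb2 setT (fun p =>
     sinc2 (M / b1, N / b2) (x0 - p.1, y0 - p.2) *: chirped g' p).
  rewrite -(qintegralZ measurableT); last first.
    apply: (qintegrable_bounded_scale (B := `|M / b1| * `|N / b2|)) => //.
      apply: (measurableT_comp (measurable_sinc2 _)).
      by apply/measurable_fun_pairP; split; exact: measurable_funB.
    by move=> p _; exact: sinc2_bound.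
  apply: (@ae_eq_qintegral _ (mR * mR)%type R leb2); first exact: measurableT.
  apply: (plane_ae_imply _ (plane_ae_neq x0 y0)) => p [_ py] _.
  rewrite /CN integral_cos_sinc// !scalerA; congr (_ *: _).
  by rewrite /SM /sinc2 /=; ring.
set c := 4 * b1 * b2; set V := qintegral _ _ _.
rewrite -scalerAr -scalerAl scalerA; congr (_ *: _).
have p0 : (pi : R) != 0 by rewrite gt_eqF// pi_gt0.
have B1 := lt0r_neq0 b1_gt0; have B2 := lt0r_neq0 b2_gt0.
rewrite /c /k /b1 /b2; move: (pi : R) (A1 0 1) (A2 0 1) p0 B1 B2 => P x y P0 X Y.
by field; rewrite P0 X Y.
Qed.

End Truncation.

(** * Regularity of the function multiplied by chirps *)

Section ComponentVersions.
Context d (T : measurableType d) (R : realType) (m : {measure set T -> \bar R}).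

Lemma component_integrable_version (F : T -> quat R) (k : quat R -> R) :
  (forall q, `|k q| <= `|q|) -> ae_measurable m (k \o F) ->
  (\int[m]_x (`|F x|)%:E < +oo)%E -> integrable_version m (k \o F).
Proof.
move=> kle [g mg kg] Ffin; exists g; split => //; apply/integrableP; split.
  exact/measurable_EFinP.
apply: le_lt_trans Ffin; apply: ge0_ae_le_lower_integral => //.
by apply: (ae_imply _ kg) => x /= <- _; rewrite lee_fin.
Qed.

Lemma qL1_integrable_versions (F : T -> quat R) :
  qL1 m F -> qall (integrable_version m) F.
Proof.
move=> [[m0 m1 m2 m3] Ffin]; split.
- exact: (component_integrable_version (@q0_le_norm R)).
- exact: (component_integrable_version (@q1_le_norm R)).
- exact: (component_integrable_version (@q2_le_norm R)).
- exact: (component_integrable_version (@q3_le_norm R)).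
Qed.

Lemma integrable_version_cst0 : integrable_version m (cst 0).
Proof.
exists (cst 0); split => //; first exact: integrable0.
by apply: aeW.
Qed.

End ComponentVersions.

Section ChirpRegularity.
Variable R : realType.
Implicit Types (mu nu : quat R).

(** The derivative of al x^2 is bounded on a bounded interval. *)
Lemma chirp_lipschitz (al lo hi : R) : exists L : R,
  (forall x y, lo <= x -> x <= y -> y <= hi ->
     `|cos (al * y ^+ 2) - cos (al * x ^+ 2)| <= L * (y - x)) /\
  (forall x y, lo <= x -> x <= y -> y <= hi ->
     `|sin (al * y ^+ 2) - sin (al * x ^+ 2)| <= L * (y - x)).
Proof.
exists (`|al| * 2 * (`|lo| + `|hi|)).
have bnd (w t x y : R) : lo <= x -> x <= y -> y <= hi -> `|w| <= 1 ->
    t \in `]Num.min y x, Num.max y x[ -> `|w * (al * (t *+ 2))| <= `|al| * 2 * (`|lo| + `|hi|).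
  move=> lox xy yhi w1; rewrite min_r// max_l// in_itv/= => /andP[xt ty].
  rewrite -[leRHS]mul1r normrM; apply: ler_pM => //.
  rewrite normrM -mulrA; apply: ler_wpM2l => //.
  rewrite -(mulr_natl t) normrM ger0_norm//; apply: ler_wpM2l => //; rewrite ler_norml.
  have := ler_norm hi; have := ler_norm (- lo); rewrite normrN.
  have := normr_ge0 hi; have := normr_ge0 lo; lra.
have dc (x : R) : is_derive x 1 (fun z => cos (al * z ^+ 2)) (- sin (al * x ^+ 2) * (al * (x *+ 2))).
  by apply: is_derive_eq; rewrite /GRing.scale/=; ring.
have ds (x : R) : is_derive x 1 (fun z => sin (al * z ^+ 2)) (cos (al * x ^+ 2) * (al * (x *+ 2))).
  by apply: is_derive_eq; rewrite /GRing.scale/=; ring.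
split=> x y lox xy yhi; rewrite -[leRHS](congr1 (fun z => _ * z) (ger0_norm _)) ?subr_ge0//.
  apply: (is_derive_lipschitz dc) => t; apply: bnd => //.
  by rewrite normrN ler_norml sin_geN1 sin_le1.
apply: (is_derive_lipschitz ds) => t; apply: bnd => //.
by rewrite ler_norml cos_geN1 cos_le1.
Qed.

Section strip.
Variables (a1 b1 a2 b2 : R).
Hypotheses (ab1 : a1 <= b1) (ab2 : a2 <= b2).
Local Notation SB := (strip_bv a1 b1 a2 b2).

Lemma strip_bvZ (k : R) h : SB h -> SB (fun p => k * h p).
Proof.
apply: (strip_bvMr (p := fun _ => k) (B := `|k|) (L := 0)) => //.
by move=> x y _ _ _; rewrite subrr normr0 mul0r.
Qed.

Lemma strip_bv_chirpl mu al F : qall SB F ->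
  qall SB (fun p => qexp mu (al * p.1 ^+ 2) * F p).
Proof.
move=> hF; have [L [Lc Ls]] := chirp_lipschitz al a1 b1.
have hM := qallMl (@strip_bvD R a1 b1 a2 b2) strip_bvZ mu hF.
rewrite (_ : (fun p => _) = fun p => cos (al * p.1 ^+ 2) *: F p +
  sin (al * p.1 ^+ 2) *: (mu * F p)); last by apply/funext => p; rewrite qexp_mull.
apply: (qallD (@strip_bvD R a1 b1 a2 b2)).
  by case: hF => ? ? ? ?; split; apply: (strip_bvMl ab1 ab2 (B := 1) _ Lc) => // t _ _;
    rewrite ler_norml cos_geN1 cos_le1.
by case: hM => ? ? ? ?; split; apply: (strip_bvMl ab1 ab2 (B := 1) _ Ls) => // t _ _;
  rewrite ler_norml sin_geN1 sin_le1.
Qed.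

Lemma strip_bv_chirpr nu al F : qall SB F ->
  qall SB (fun p => F p * qexp nu (al * p.2 ^+ 2)).
Proof.
move=> hF; have [L [Lc Ls]] := chirp_lipschitz al a2 b2.
have hM := qallMr (@strip_bvD R a1 b1 a2 b2) strip_bvZ nu hF.
rewrite (_ : (fun p => _) = fun p => cos (al * p.2 ^+ 2) *: F p +
  sin (al * p.2 ^+ 2) *: (F p * nu)); last by apply/funext => p; rewrite qexp_mulr.
apply: (qallD (@strip_bvD R a1 b1 a2 b2)).
  by case: hF => ? ? ? ?; split; apply: (strip_bvMr ab2 (B := 1) _ Lc) => // t _ _;
    rewrite ler_norml cos_geN1 cos_le1.
by case: hM => ? ? ? ?; split; apply: (strip_bvMr ab2 (B := 1) _ Ls) => // t _ _;
  rewrite ler_norml sin_geN1 sin_le1.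
Qed.

End strip.

Lemma strip_bv_sym4 (x0 y0 e1 e2 : R) (h : R * R -> R) : 0 < e1 -> 0 < e2 ->
  strip_bv (x0 - e1) (x0 + e1) (y0 - e2) (y0 + e2) h ->
  strip_bv 0 e1 0 e2 (sym4 h x0 y0).
Proof.
move=> e10 e20 hh.
have refl k l : k = 1 \/ k = -1 -> l = 1 \/ l = -1 ->
    strip_bv 0 e1 0 e2 (fun p => h (x0 + k * p.1, y0 + l * p.2)).
  move=> kE lE; apply: strip_bv_reflection hh => //; try exact: ltW.
  - by move=> t t0 te; case: kE => ->; rewrite ?mul1r ?mulN1r; lra.
  - by move=> t t0 te; case: lE => ->; rewrite ?mul1r ?mulN1r; lra.
have -> : sym4 h x0 y0 = fun p => h (x0 + -1 * p.1, y0 + -1 * p.2) +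
    h (x0 + 1 * p.1, y0 + 1 * p.2) + h (x0 + -1 * p.1, y0 + 1 * p.2) +
    h (x0 + 1 * p.1, y0 + -1 * p.2).
  by apply/funext => p; rewrite /sym4 !mul1r !mulN1r.
by apply: strip_bvD (strip_bvD (strip_bvD (refl (-1) (-1) _ _) (refl 1 1 _ _))
  (refl (-1) 1 _ _)) (refl 1 (-1) _ _); (by left) || (by right).
Qed.

Lemma qcvg_qexp (U : Type) (FF : set_system U) {FFF : Filter FF} mu (t : U -> R) t0 :
  t @ FF --> t0 -> qcvg FF (fun x => qexp mu (t x)) (qexp mu t0).
Proof.
move=> tt0.
have c : (fun x => cos (t x)) @ FF --> cos t0 by apply: continuous_cvg => //; exact: continuous_cos.
have s : (fun x => sin (t x)) @ FF --> sin t0 by apply: continuous_cvg => //; exact: continuous_sin.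
by split; rewrite qexpE; under eq_fun do rewrite qexpE; rewrite !qlinE;
  under eq_fun do rewrite !qlinE; apply: cvgD; apply: cvgM => //; exact: cvg_cst.
Qed.

End ChirpRegularity.

(** * Inversion for one pair of imaginary units *)

Section QuaternionInversion.
Variable R : realType.
Local Notation leb := (@lebesgue_measure R).
Local Notation leb2 := (leb \x leb)%E.
Local Notation mR := (measurableTypeR R).
Local Notation oo2 := (filter_prod (+oo : set_system R) (+oo : set_system R)).
Local Notation corner := (filter_prod (0 : R)^'+ (0 : R)^'+).

Lemma LC_component_tame (x0 y0 e1 e2 : R) (G : R * R -> quat R) (k : quat R -> R) :
  (forall q r, k (q + r) = k q + k r) -> (forall q r, k (q - r) = k q - k r) ->
  (forall a q, k (a *: q) = a * k q) ->
  (forall q, `|k q| <= `|q|) ->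
  (forall F : R -> quat R, qL1 leb F -> integrable_version leb (k \o F)) ->
  LC x0 y0 e1 e2 G -> strip_tame e1 e2 (sym4 (k \o G) x0 y0).
Proof.
move=> kD kB kZ kle kL1 [a [b [Aa Bb Ia Ib]]].
have kS p : sym4 (k \o G) x0 y0 p = k (symmetrization G x0 y0 p) by rewrite !kD.
exists a, b; rewrite (funext kS); split.
- exact: kL1 Aa.
- exact: kL1 Bb.
- exists (fun s t => `|s^-1 *: (symmetrization G x0 y0 (s, t) - symmetrization G x0 y0 (a, t))|).
    by move=> s t; rewrite -kB -kZ.
  exact: Ia.
- exists (fun s t => `|t^-1 *: (symmetrization G x0 y0 (s, t) - symmetrization G x0 y0 (s, b))|).
    by move=> s t; rewrite -kB -kZ.
  exact: Ib.
Qed.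

Lemma LC_tame (x0 y0 e1 e2 : R) (G : R * R -> quat R) : LC x0 y0 e1 e2 G ->
  qall (fun h => strip_tame e1 e2 (sym4 h x0 y0)) G.
Proof.
have L1 (F : R -> quat R) : qL1 leb F -> qall (integrable_version leb) F.
  exact: (@qL1_integrable_versions _ mR R leb F).
by split; apply: LC_component_tame H => //; first [exact: q0_le_norm|exact: q1_le_norm|
  exact: q2_le_norm|exact: q3_le_norm|by move=> F /L1[]].
Qed.

Lemma quat_version (g : R * R -> quat R) : qall (integrable_version leb2) g ->
  exists g', qintegrable leb2 setT g' /\ {ae leb2, forall p, g p = g' p}.
Proof.
move=> [[g0 [_ i0 E0]] [g1 [_ i1 E1]] [g2 [_ i2 E2]] [g3 [_ i3 E3]]].
exists (fun p => Quat (g0 p) (g1 p) (g2 p) (g3 p)); split; first by split.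
have E01 : {ae leb2, forall p, q0 (g p) = g0 p /\ q1 (g p) = g1 p}.
  by apply: (plane_ae_imply2 _ E0 E1) => p.
have E23 : {ae leb2, forall p, q2 (g p) = g2 p /\ q3 (g p) = g3 p}.
  by apply: (plane_ae_imply2 _ E2 E3) => p.
by apply: (plane_ae_imply2 _ E01 E23) => p [? ?] [? ?]; exact: quatE.
Qed.

Variables (mu nu : quat R) (A1 A2 : 'M[R]_2).
Hypotheses (mu2 : mu * mu = -1) (nu2 : nu * nu = -1).
Hypotheses (dA1 : \det A1 = 1) (dA2 : \det A2 = 1).
Hypotheses (b1_gt0 : 0 < A1 0 1) (b2_gt0 : 0 < A2 0 1).
Local Notation chirp := (chirped mu nu A1 A2).
Local Notation al1 := (A1 0 0 / (2 * A1 0 1)).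
Local Notation al2 := (A2 0 0 / (2 * A2 0 1)).

Lemma chirped_quadrant_limit (g : R * R -> quat R) x0 y0 (k l : R) q :
  qcvg corner (fun p => g (x0 + k * p.1, y0 + l * p.2)) q ->
  qcvg corner (fun p => chirp g (x0 + k * p.1, y0 + l * p.2))
    (qexp mu (al1 * x0 ^+ 2) * q * qexp nu (al2 * y0 ^+ 2)).
Proof.
move=> gq.
have sq (c m : R) (f : R * R -> R) (z : R) : f @ corner --> (0 : R) ->
    (fun p => c * (z + m * f p) ^+ 2) @ corner --> c * z ^+ 2.
  move=> f0; apply: cvgM; first exact: cvg_cst.
  have h : (fun p => z + m * f p) @ corner --> z.
    have := cvgD (@cvg_cst _ z _ corner _) (cvgM (@cvg_cst _ m _ corner _) f0).
    by rewrite mulr0 addr0 => H; exact: H.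
  by rewrite expr2; under eq_fun do rewrite expr2; exact: cvgM.
have f1 : (fun p : R * R => p.1) @ corner --> (0 : R).
  by apply: (cvg_trans cvg_fst); exact: cvg_within.
have f2 : (fun p : R * R => p.2) @ corner --> (0 : R).
  by apply: (cvg_trans cvg_snd); exact: cvg_within.
apply: qcvgM; last by apply: qcvg_qexp; exact: sq.
by apply: qcvgM => //; apply: qcvg_qexp; exact: sq.
Qed.

(** [plane_dirichlet] for each component of G, then multiplication by the inverse
    chirps at (x0, y0), which cancel the chirps in the quadrant limits of G. *)
Theorem qlct_inversion (g : R * R -> quat R) (x0 y0 e1 e2 : R) (lpp lpm lmp lmm : quat R) :
  0 < e1 -> 0 < e2 -> qall (integrable_version leb2) g ->
  qall (strip_bv (x0 - e1) (x0 + e1) (y0 - e2) (y0 + e2)) g ->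
  LC x0 y0 e1 e2 (chirp g) ->
  qcvg corner (fun p => g (x0 + 1 * p.1, y0 + 1 * p.2)) lpp ->
  qcvg corner (fun p => g (x0 + 1 * p.1, y0 + -1 * p.2)) lpm ->
  qcvg corner (fun p => g (x0 + -1 * p.1, y0 + 1 * p.2)) lmp ->
  qcvg corner (fun p => g (x0 + -1 * p.1, y0 + -1 * p.2)) lmm ->
  qlct_inv_cvg mu nu A1 A2 g x0 y0 (4^-1 *: (lpp + lpm + lmp + lmm)).
Proof.
move=> e10 e20 ig bvg LCg hpp hpm hmp hmm.
have [g' [ig' gg']] := quat_version ig.
(* the chirps at (x0, y0) *)
pose E1 := qexp mu (al1 * x0 ^+ 2); pose E2 := qexp nu (al2 * y0 ^+ 2).
pose L := E1 * (lpp + lpm + lmp + lmm) * E2.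
have symL : qcvg corner (fun p => symmetrization (chirp g) x0 y0 p) L.
  have symE p : symmetrization (chirp g) x0 y0 p = chirp g (x0 + -1 * p.1, y0 + -1 * p.2) +
      chirp g (x0 + 1 * p.1, y0 + 1 * p.2) + chirp g (x0 + -1 * p.1, y0 + 1 * p.2) +
      chirp g (x0 + 1 * p.1, y0 + -1 * p.2).
    by rewrite /symmetrization !mul1r !mulN1r.
  have LE : L = E1 * lmm * E2 + E1 * lpp * E2 + E1 * lmp * E2 + E1 * lpm * E2.
    rewrite /L; move: (E1) (E2) => X Y; rewrite !mulrDr !mulrDl.
    move: (X * lpp * Y) (X * lpm * Y) (X * lmp * Y) (X * lmm * Y) => a b c d.
    rewrite -[RHS]addrA [X in _ = X + _]addrC [X in _ = _ + X]addrC [RHS]addrACA.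
    by rewrite -[LHS]addrA [X in _ = _ + X]addrC.
  have qmm := chirped_quadrant_limit hmm; have qpp := chirped_quadrant_limit hpp.
  have qmp := chirped_quadrant_limit hmp; have qpm := chirped_quadrant_limit hpm.
  rewrite (funext symE) LE.
  exact: (qcvgD (qcvgD (qcvgD qmm qpp) qmp) qpm).
have ab1 : x0 - e1 <= x0 + e1 by lra.
have ab2 : y0 - e2 <= y0 + e2 by lra.
have bvG : qall (strip_bv (x0 - e1) (x0 + e1) (y0 - e2) (y0 + e2)) (chirp g).
  have bv1 := strip_bv_chirpl ab1 ab2 mu al1 bvg.
  exact: (strip_bv_chirpr ab2 nu al2 bv1).
have tmG := LC_tame LCg.
have iG' := chirped_integrable mu nu A1 A2 ig'.
have GG' : {ae leb2, forall p, chirp g p = chirp g' p}.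
  by apply: (plane_ae_imply _ gg') => p gp; rewrite /chirped gp.
have V_cvg : qcvg oo2 (fun MN => qintegral leb2 setT
    (fun p => sinc2 MN (x0 - p.1, y0 - p.2) *: chirp g' p)) ((pi / 2) ^+ 2 *: L).
  have dirichlet (k : quat R -> R) :
      leb2.-integrable setT (EFin \o (k \o chirp g')) ->
      strip_bv (x0 - e1) (x0 + e1) (y0 - e2) (y0 + e2) (k \o chirp g) ->
      strip_tame e1 e2 (sym4 (k \o chirp g) x0 y0) ->
      sym4 (k \o chirp g) x0 y0 @ corner --> k L ->
      (fun MN => \int[leb2]_p (sinc2 MN (x0 - p.1, y0 - p.2) * k (chirp g' p))) @ oo2 -->
        (pi / 2) ^+ 2 * k L.
    move=> ik bvk tk Lk.
    apply: (plane_dirichlet (h := k \o chirp g) (h' := k \o chirp g') e10 e20) => //.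
    - by have /measurable_EFinP := measurable_int _ ik.
    - by apply: (plane_ae_imply _ GG') => p Gp; rewrite /= Gp.
    - exact: strip_bv_sym4.
  by case: iG' bvG tmG symL => ? ? ? ? [? ? ? ?] [? ? ? ?] [? ? ? ?];
     split; rewrite qlinE; exact: dirichlet.
pose b1 := A1 0 1; pose b2 := A2 0 1.
have scale : (fun MN : R * R => (MN.1 / b1, MN.2 / b2)) @ oo2 `=>` oo2.
  have div_cvg (b : R) : 0 < b -> (fun M => M / b) @ +oo --> (+oo : set_system R).
    move=> b0; apply/cvgryPge => A.
    by apply: filterS (nbhs_pinfty_ge (num_real (A * b))) => M; rewrite ler_pdivlMr.
  have c1 : (fun MN : R * R => MN.1 / b1) @ oo2 --> (+oo : set_system R).
    exact: (cvg_comp _ _ cvg_fst (div_cvg _ b1_gt0)).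
  have c2 : (fun MN : R * R => MN.2 / b2) @ oo2 --> (+oo : set_system R).
    exact: (cvg_comp _ _ cvg_snd (div_cvg _ b2_gt0)).
  exact: (cvg_pair c1 c2).
have ge0 : \forall MN \near oo2, 0 <= MN.1 /\ 0 <= MN.2.
  exists ([set M | 0 <= M], [set M | 0 <= M]); last by move=> [M N] [].
  by split; apply: nbhs_pinfty_ge; exact: num_real.
have F2 : Filter oo2 by exact: filter_prod_filter.
have cst (c : quat R) : qcvg oo2 (fun=> c) c by exact: qcvg_cst.
have EVE := qcvgM (FFF := F2) (qcvgM (FFF := F2) (cst (qexp mu (- (al1 * x0 ^+ 2))))
  (qcvg_comp scale V_cvg)) (cst (qexp nu (- (al2 * y0 ^+ 2)))).
have := qcvgM (FFF := F2) (cst ((pi ^- 2) *: 1)) EVE.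
have -> : (pi ^- 2 *: 1) * (qexp mu (- (al1 * x0 ^+ 2)) * ((pi / 2) ^+ 2 *: L) *
    qexp nu (- (al2 * y0 ^+ 2))) = 4^-1 *: (lpp + lpm + lmp + lmm).
  have K1 : qexp mu (- (al1 * x0 ^+ 2)) * E1 = 1 by exact: qexpK.
  have K2 : E2 * qexp nu (- (al2 * y0 ^+ 2)) = 1 by rewrite /E2 qexpC// qexpK.
  have k4 : pi ^- 2 * (pi / 2) ^+ 2 = 4^-1 :> R.
    have p0 : (pi : R) != 0 by rewrite gt_eqF// pi_gt0.
    by move: (pi : R) p0 => P P0; field.
  move: K1 K2; rewrite /L; move: (qexp mu _) (qexp nu _) (E1) (E2) => X Y X' Y' K1 K2.
  move: (lpp + lpm + lmp + lmm) k4 => S; move: (pi ^- 2) ((pi / 2) ^+ 2) => c c' k4.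
  rewrite -scalerAr -!scalerAl mul1r scalerA k4; congr (_ *: _).
  by rewrite !mulrA K1 mul1r -mulrA K2 mulr1.
move=> /qcvg_cvg; apply: cvg_trans; apply: near_eq_cvg.
near=> MN; have [M0 N0] : 0 <= MN.1 /\ 0 <= MN.2 by near: MN.
by rewrite (qlct_inv_truncE mu2 nu2 dA1 dA2 b1_gt0 b2_gt0 x0 y0 ig' gg' M0 N0) -scalerAl mul1r.
Unshelve. all: by end_near. Qed.

End QuaternionInversion.

(** * The four parts of a quaternion-valued function *)

Section CornerLimits.
Variable R : realType.
Local Notation leb := (@lebesgue_measure R).
Local Notation leb2 := (leb \x leb)%E.
Local Notation mR := (measurableTypeR R).
Local Notation corner := (filter_prod (0 : R)^'+ (0 : R)^'+).

Lemma QBVF_in_strip_bv (f : R * R -> quat R) (x0 y0 e1 e2 : R) : 0 < e1 -> 0 < e2 ->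
  QBVF_in (cross_nbhd x0 y0 e1 e2) f ->
  qall (strip_bv (x0 - e1) (x0 + e1) (y0 - e2) (y0 + e2)) f.
Proof.
move=> e10 e20 fbv; have lt1 : x0 - e1 < x0 + e1 by lra.
have lt2 : y0 - e2 < y0 + e2 by lra.
have [] := fbv _ _ _ _ lt1 lt2.
  move=> [s t] /= [+ _]; rewrite in_itv/= => /andP[s1 s2]; left.
  by rewrite /= ler_norml; apply/andP; split; lra.
by move=> h0 h1 h2 h3; split; exact: BVF_strip_bv.
Qed.

(** After a reflection the quadrant limit is a limit at the lower left corner. *)
Lemma strip_bv_quadrant_limit (h : R * R -> R) (x0 y0 e1 e2 k l : R) :
  0 < e1 -> 0 < e2 -> k = 1 \/ k = -1 -> l = 1 \/ l = -1 ->
  strip_bv (x0 - e1) (x0 + e1) (y0 - e2) (y0 + e2) h ->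
  exists c : R, (fun p => h (x0 + k * p.1, y0 + l * p.2)) @ corner --> c.
Proof.
move=> e10 e20 kE lE hbv; apply: (strip_bv_corner_limit e10 e20).
apply: strip_bv_reflection hbv => //; try exact: ltW.
- by move=> t t0 te; case: kE => ->; rewrite ?mul1r ?mulN1r; apply/andP; split; lra.
- by move=> t t0 te; case: lE => ->; rewrite ?mul1r ?mulN1r; apply/andP; split; lra.
Qed.

Lemma quadrant_limit_exists (f : R * R -> quat R) (x0 y0 e1 e2 k l : R) :
  0 < e1 -> 0 < e2 -> k = 1 \/ k = -1 -> l = 1 \/ l = -1 ->
  qall (strip_bv (x0 - e1) (x0 + e1) (y0 - e2) (y0 + e2)) f ->
  exists c, qcvg corner (fun p => f (x0 + k * p.1, y0 + l * p.2)) c.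
Proof.
move=> e10 e20 kE lE [h0 h1 h2 h3].
have [c0 l0] := strip_bv_quadrant_limit e10 e20 kE lE h0.
have [c1 l1] := strip_bv_quadrant_limit e10 e20 kE lE h1.
have [c2 l2] := strip_bv_quadrant_limit e10 e20 kE lE h2.
have [c3 l3] := strip_bv_quadrant_limit e10 e20 kE lE h3.
by exists (Quat c0 c1 c2 c3).
Qed.

Definition qpart_a (q : quat R) : quat R := (q0 q)%:A + qi * (q1 q)%:A.
Definition qpart_b (q : quat R) : quat R := (q2 q)%:A + qi * (q3 q)%:A.
Definition qpart_d (q : quat R) : quat R := (q0 q)%:A + qj * (q2 q)%:A.
Definition qpart_e (q : quat R) : quat R := (q1 q)%:A + qj * (q3 q)%:A.

Lemma qpart_aE q : qpart_a q = Quat (q0 q) (q1 q) 0 0.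
Proof. by apply: quatE; rewrite /qpart_a /=; ring. Qed.
Lemma qpart_bE q : qpart_b q = Quat (q2 q) (q3 q) 0 0.
Proof. by apply: quatE; rewrite /qpart_b /=; ring. Qed.
Lemma qpart_dE q : qpart_d q = Quat (q0 q) 0 (q2 q) 0.
Proof. by apply: quatE; rewrite /qpart_d /=; ring. Qed.
Lemma qpart_eE q : qpart_e q = Quat (q1 q) 0 (q3 q) 0.
Proof. by apply: quatE; rewrite /qpart_e /=; ring. Qed.
Definition qpartE := (qpart_aE, qpart_bE, qpart_dE, qpart_eE).

(** Properties of f that hold componentwise pass to f_a, f_b, f_d and f_e, whose
    components are components of f or 0. *)
Definition component_map (S : quat R -> quat R) :=
  [/\ forall q r, S (q + r) = S q + S r,
      forall (T : Type) (P : (T -> R) -> Prop) F, P (fun=> 0) -> qall P F ->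
        qall P (fun x => S (F x))
    & forall (T : Type) (FF : set_system T) F l, Filter FF -> qcvg FF F l ->
        qcvg FF (fun x => S (F x)) (S l)].

Lemma qpart_component_map :
  [/\ component_map qpart_a, component_map qpart_b,
      component_map qpart_d & component_map qpart_e].
Proof.
split; split=> [q r|T P F P0 [? ? ? ?]|T FF F l FFF [? ? ? ?]].
all: rewrite ?qpartE.
all: try by apply: quatE; rewrite /= ?addr0.
all: try by split; (under eq_fun do rewrite qpartE /=).
all: by split; (under eq_fun do rewrite qpartE /=) => //; exact: cvg_cst.
Qed.

Section part.
Variables (A1 A2 : 'M[R]_2) (f : R * R -> quat R) (x0 y0 e1 e2 : R).
Hypotheses (dA1 : \det A1 = 1) (dA2 : \det A2 = 1).
Hypotheses (b1_gt0 : 0 < A1 0 1) (b2_gt0 : 0 < A2 0 1).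
Hypotheses (f_int : qall (integrable_version leb2) f) (e10 : 0 < e1) (e20 : 0 < e2).
Hypothesis f_bv : qall (strip_bv (x0 - e1) (x0 + e1) (y0 - e2) (y0 + e2)) f.
Variables lpp lpm lmp lmm : quat R.
Hypotheses (hpp : qcvg corner (fun p => f (x0 + 1 * p.1, y0 + 1 * p.2)) lpp)
  (hpm : qcvg corner (fun p => f (x0 + 1 * p.1, y0 + -1 * p.2)) lpm)
  (hmp : qcvg corner (fun p => f (x0 + -1 * p.1, y0 + 1 * p.2)) lmp)
  (hmm : qcvg corner (fun p => f (x0 + -1 * p.1, y0 + -1 * p.2)) lmm).

Lemma part_inversion (mu nu : quat R) S : mu * mu = -1 -> nu * nu = -1 ->
  component_map S -> LC x0 y0 e1 e2 (chirped mu nu A1 A2 (S \o f)) ->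
  qlct_inv_cvg mu nu A1 A2 (S \o f) x0 y0 (4^-1 *: S (lpp + lpm + lmp + lmm)).
Proof.
move=> mu2 nu2 [SD SP Sc] LCf; rewrite !SD.
apply: (qlct_inversion mu2 nu2 dA1 dA2 b1_gt0 b2_gt0 e10 e20) => //.
- apply: (SP _ _ _ _ f_int).
  exact: (@integrable_version_cst0 _ (mR * mR)%type R leb2).
- apply: (SP _ _ _ _ f_bv).
  have [h0 _ _ _] := f_bv.
  have -> : (fun=> 0) = (fun p : R * R => 0 * q0 (f p)) by apply/funext => p; rewrite mul0r.
  by apply: strip_bvZ h0; rewrite lerD2l (le_trans _ (ltW e20))// oppr_le0 ltW.
- exact: Sc hpp.
- exact: Sc hpm.
- exact: Sc hmp.
- exact: Sc hmm.
Qed.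

End part.

End CornerLimits.

Theorem corollary3p2 (R : realType) (A1 A2 : 'M[R]_2) (f : R * R -> quat R)
    (x0 y0 e1 e2 : R) :
  \det A1 = 1 -> \det A2 = 1 -> 0 < A1 0 1 -> 0 < A2 0 1 ->
  qL1_plane f ->
  0 < e1 -> 0 < e2 -> QBVF_in (cross_nbhd x0 y0 e1 e2) f ->
  let a1 := A1 0 0 in let b1 := A1 0 1 in
  let a2 := A2 0 0 in let b2 := A2 0 1 in
  let fa := fun p => (q0 (f p))%:A + qi * (q1 (f p))%:A in
  let fb := fun p => (q2 (f p))%:A + qi * (q3 (f p))%:A in
  let fd := fun p => (q0 (f p))%:A + qj * (q2 (f p))%:A in
  let fe := fun p => (q1 (f p))%:A + qj * (q3 (f p))%:A in
  (LC x0 y0 e1 e2 (fun p => qexp qi (a1 / (2 * b1) * p.1 ^+ 2) * fa p *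
                            qexp qj (a2 / (2 * b2) * p.2 ^+ 2)) ->
   LC x0 y0 e1 e2 (fun p => qexp (- qi) (a1 / (2 * b1) * p.1 ^+ 2) * fb p *
                            qexp qj (a2 / (2 * b2) * p.2 ^+ 2)) ->
   exists l1 l2 : quat R,
     [/\ qlct_inv_cvg qi qj A1 A2 fa x0 y0 l1,
         qlct_inv_cvg (- qi) qj A1 A2 fb x0 y0 l2
       & quadrant_mean f x0 y0 (l1 + l2 * qj)]) /\
  (LC x0 y0 e1 e2 (fun p => qexp qi (a1 / (2 * b1) * p.1 ^+ 2) * fd p *
                            qexp qj (a2 / (2 * b2) * p.2 ^+ 2)) ->
   LC x0 y0 e1 e2 (fun p => qexp qi (a1 / (2 * b1) * p.1 ^+ 2) * fe p *
                            qexp (- qj) (a2 / (2 * b2) * p.2 ^+ 2)) ->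
   exists l1 l2 : quat R,
     [/\ qlct_inv_cvg qi qj A1 A2 fd x0 y0 l1,
         qlct_inv_cvg qi (- qj) A1 A2 fe x0 y0 l2
       & quadrant_mean f x0 y0 (l1 + qi * l2)]).
Proof.
move=> dA1 dA2 b1_gt0 b2_gt0 fL1 e10 e20 fbv a1 b1 a2 b2 fa fb fd fe.
have f_int := @qL1_integrable_versions _ (measurableTypeR R * measurableTypeR R)%type
  R _ f fL1.
have f_bv := QBVF_in_strip_bv e10 e20 fbv.
have P1 : (1 : R) = 1 \/ (1 : R) = -1 by left.
have N1 : (-1 : R) = 1 \/ (-1 : R) = -1 by right.
have [lpp hpp] := quadrant_limit_exists e10 e20 P1 P1 f_bv.
have [lpm hpm] := quadrant_limit_exists e10 e20 P1 N1 f_bv.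
have [lmp hmp] := quadrant_limit_exists e10 e20 N1 P1 f_bv.
have [lmm hmm] := quadrant_limit_exists e10 e20 N1 N1 f_bv.
have [[i2 j2 _] _] := quat_units R.
have ni2 : (- qi) * (- qi) = -1 :> quat R by rewrite mulrNN.
have nj2 : (- qj) * (- qj) = -1 :> quat R by rewrite mulrNN.
have [Sa Sb Sd Se] := qpart_component_map R.
have inv mu nu S := part_inversion dA1 dA2 b1_gt0 b2_gt0 f_int e10 e20 f_bv hpp hpm hmp hmm
  (mu := mu) (nu := nu) (S := S).
have mean q : q = 4^-1 *: (lpp + lpm + lmp + lmm) -> quadrant_mean f x0 y0 q.
  by move=> ->; exists lpp, lpm, lmp, lmm; split=> //; exact: qcvg_cvg.
split=> LC1 LC2.
- exists (4^-1 *: qpart_a (lpp + lpm + lmp + lmm)), (4^-1 *: qpart_b (lpp + lpm + lmp + lmm)).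
  split; [exact: (inv _ _ _ i2 j2 Sa LC1)|exact: (inv _ _ _ ni2 j2 Sb LC2)|].
  (* q = q_a + q_b j *)
  apply: mean; rewrite -scalerAl -scalerDr !qpartE; congr (_ *: _).
  by apply: quatE; rewrite /=; ring.
- exists (4^-1 *: qpart_d (lpp + lpm + lmp + lmm)), (4^-1 *: qpart_e (lpp + lpm + lmp + lmm)).
  split; [exact: (inv _ _ _ i2 j2 Sd LC1)|exact: (inv _ _ _ i2 nj2 Se LC2)|].
  (* q = q_d + i q_e *)
  apply: mean; rewrite -scalerAr -scalerDr !qpartE; congr (_ *: _).
  by apply: quatE; rewrite /=; ring.
Qed.
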